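(* Let $\mathcal{L}$ denote Lebesgue measure on $(0,1)$ and $\mathbb{I}=(0,1)\setminus\mathbb{Q}$. For the signed Engel digits $d_n(x)$ the following hold. (1) (Law of large numbers) For Lebesgue almost all $x\in(0,1)$, $\lim_{n\to\infty}\frac{\log d_n(x)}{n}=1$. (2) (Central limit theorem) For every $t\in\mathbb{R}$, $$\lim_{n\to\infty}\mathcal{L}\left\{x\in\mathbb{I}\colon \frac{\log d_n(x)-n}{\sqrt n}\le t\right\}=\frac{1}{\sqrt{2\pi}}\int_{-\infty}^t e^{-u^2/2}\,du.$$ (3) (Law of the iterated logarithm) For Lebesgue almost all $x\in(0,1)$, $$\limsup_{n\to\infty}\frac{\log d_n(x)-n}{\sqrt{2n\log\log n}}=1,\qquad \liminf_{n\to\infty}\frac{\log d_n(x)-n}{\sqrt{2n\log\log n}}=-1.$$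
   Context: Signed Engel expansion. Define $T\colon[0,1)\to[0,1)$ by: for $k\in\mathbb{N}$, $Tx=\lceil 1/x\rceil x-1$ if $x\in(\frac{1}{2k},\frac{1}{2k-1})$; $Tx=1-\lfloor 1/x\rfloor x$ if $x\in(\frac{1}{2k+1},\frac{1}{2k})$; and $Tx=0$ if $x\in\{0\}\cup\{1/n\colon n\ge 2\}$. For $x\in(0,1)$ define $d_1(x)=\lceil 1/x\rceil$ and $s_1(x)=1$ if $x\in[\frac{1}{2k},\frac{1}{2k-1})$ for some $k\in\mathbb{N}$, and $d_1(x)=\lfloor 1/x\rfloor$, $s_1(x)=-1$ if $x\in[\frac{1}{2k+1},\frac{1}{2k})$ for some $k\in\mathbb{N}$. Set $d_{n+1}(x)=d_1(T^nx)$, $s_{n+1}(x)=s_1(T^nx)$ (whenever $T^nx\neq0$), $\epsilon_1(x)=1$, $\epsilon_{n+1}(x)=\prod_{k=1}^n s_k(x)$. For irrational $x$ all these are defined for every $n$, and $x=\sum_{n\ge1}\frac{\epsilon_n(x)}{d_1(x)\cdots d_n(x)}$. *)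

(* Defs.v *)
From HB Require Import structures.
From mathcomp Require Import all_boot all_order all_algebra.
From mathcomp Require Import all_classical all_reals all_analysis.
Set Implicit Arguments. Unset Strict Implicit. Unset Printing Implicit Defensive.
Import Order.TTheory GRing.Theory Num.Theory.
Local Open Scope ring_scope.

Section SignedEngel.
Variable R : realType.

(* x \in [1/(2k), 1/(2k-1)) for some k >= 1  <->  ceil(1/x) is even
   (for x in (0,1)); otherwise x \in [1/(2k+1), 1/(2k)) and ceil(1/x) is odd. *)
Definition s1_pos (x : R) : bool := ~~ odd `|Num.ceil (x^-1)|%N.

Definition d1 (x : R) : R :=
  if s1_pos x then (Num.ceil (x^-1))%:~R else (Num.floor (x^-1))%:~R.

Definition s1 (x : R) : R := if s1_pos x then 1 else -1.

Definition Tmap (x : R) : R :=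
  if (x == 0) || ((Num.floor (x^-1))%:~R == x^-1) then 0
  else if s1_pos x then (Num.ceil (x^-1))%:~R * x - 1
  else 1 - (Num.floor (x^-1))%:~R * x.

(* d_n(x) = d_1(T^{n-1} x) for n >= 1 (the value at n = 0 is irrelevant) *)
Definition digit (n : nat) (x : R) : R := d1 (iter n.-1 Tmap x).


End SignedEngel.

(* Main.v *)
(* Put S_n = floor(1 / (2 T^(n-1) x)) and M_n = 2 S_n + 1, with S_0 = 0. The digit
   d_n is 2 S_n or 2 S_n + 2, so log d_n and log M_n differ by at most 1. Given
   S_1, ..., S_n, the point T^n x is uniform on (0, 1/M_n); hence S_n is a Markov
   chain with an explicit kernel, and log M_n is close to a sum of n independent
   exponential variables of mean 1.

   The function f_t(j) = (2j+1) prod_(l=1..j) (2l - t)/(2l + t) is an eigenfunction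
   of the kernel for the eigenvalue 1/t, and it equals (2j+1)^(1-t) up to a bounded
   factor. The exact martingales t^n f_t(S_n) therefore replace the exponential
   martingales of the random walk: Doob's inequality and Borel-Cantelli give the
   upper half of the law of the iterated logarithm, and a tilting argument on the
   blocks [Q^l, Q^(l+1)] with a conditional form of the second Borel-Cantelli lemma
   gives the lower half. The law of large numbers follows.

   For the central limit theorem, the Gamma(n) tail G_n at log(y/(2i+1)) satisfies
   the same recursion as P(d_n > y | S_0 = i) up to errors of total size o(1), and
   G_n converges to the Gaussian tail after centring and scaling. *)
Require Import Defs.
From HB Require Import structures.
From mathcomp Require Import all_boot all_order all_algebra.
From mathcomp Require Import all_classical all_reals all_analysis.
From mathcomp Require Import measurable_realfun.
From mathcomp Require Import ring lra zify.
Set Implicit Arguments. Unset Strict Implicit. Unset Printing Implicit Defensive.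
Import Order.TTheory GRing.Theory Num.Theory numFieldNormedType.Exports.
Local Open Scope classical_set_scope.
Local Open Scope ring_scope.

(** * States of the signed Engel map *)

Section Dynamics.
Variable R : realType.
Implicit Types (x y : R) (i j n : nat).

(** The digit alone is not a usable state: the value 2j occurs on both sides of 1/(2j), and the two
    branches meeting there have different images. The two branches meeting at 1/(2j+1) are both
    affine onto (0, 1/(2j+1)); pairing them is what makes T^n x exactly uniform given the past,
    although d_n takes two values on one state. Off the diagonal the kernel from i to j is a
    function of i times a function of j. Every sum against it that is needed can therefore be made
    to telescope, and the eigenvalue equation reduces to a first-order recursion whose solution is
    the product in f_t. No random walk is coupled to the chain and no conditional expectation is
    formed. The probabilistic arguments rest on one-sided bounds: a lower bound for the probability
    of an event, valid for every past with a given state, is carried backwards through the kernel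
    one step at a time. Upper bounds come from complements, and a bound uniform over the past takes
    the place of independence in the second Borel-Cantelli argument. *)

Definition irr01 : set R := [set x | 0 < x < 1 /\ irrational x].

Definition state1 y : nat := Num.truncn ((2 * y)^-1).

(* S_n: the two branches of [Tmap] around 1/(2j+1) share the state j. *)
Fixpoint state n x : nat :=
  if n is n'.+1 then state1 (iter n' (@Tmap R) x) else 0%N.

Lemma rationalE (x : R) : ~ irrational x <-> exists q : rat, x = ratr q.
Proof.
rewrite irrationalE /=; split.
  by move=> /existsNP [q /= /not_implyP[_ /contrapT [_ -> <-]]]; exists q.
move=> [q ->] /(_ q I) /=; apply; by exists q.
Qed.

Lemma irrational_affine (a b x : R) : irrational x -> a != 0 ->
  (exists q : rat, a = ratr q) -> (exists q : rat, b = ratr q) ->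
  irrational (a * x + b).
Proof.
move=> ix a0 [q aq] [r br]; apply/not_notP => /rationalE [s e].
move/not_notP: ix; apply; apply/rationalE; exists ((s - r) / q).
by rewrite fmorph_div rmorphB /= -e -aq -br addrK mulrC mulKf.
Qed.

Lemma natr_ratr (n : nat) : exists q : rat, n%:R = ratr q :> R.
Proof. by exists (n%:R : rat); rewrite ratr_nat. Qed.

Lemma irrational_neq_natM (n : nat) x : irrational x -> n%:R * x != 1.
Proof.
move=> ix; apply/eqP => e; have n0 : n%:R != 0 :> R.
  by apply/eqP => n0; move/eqP: e; rewrite n0 mul0r eq_sym oner_eq0.
move/not_notP: ix; apply; apply/rationalE; exists (n%:R^-1).
by rewrite fmorphV /= ratr_nat -[LHS](mulKf n0) e mulr1.
Qed.

Lemma state1P y : irr01 y ->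
  (2 * state1 y)%:R * y < 1 < (2 * state1 y + 2)%:R * y.
Proof.
move=> [/andP[y0 y1] iy]; set j := state1 y.
have y20 : 0 < 2 * y by rewrite mulr_gt0.
have /truncn_itv /andP[l u] : 0 <= (2 * y)^-1 by rewrite invr_ge0 ltW.
apply/andP; split.
- rewrite lt_neqAle irrational_neq_natM //=.
  rewrite -/(state1 y) -/j -(ler_pM2r y20) mulVf ?gt_eqF // in l.
  by rewrite natrM (mulrC 2) -mulrA.
- rewrite -/(state1 y) -/j -(ltr_pM2r y20) mulVf ?gt_eqF // in u.
  by rewrite mulrA -natrM mulnC mulnS addnC in u.
Qed.

Lemma state1_eq y j : 0 < y -> (2 * j)%:R * y < 1 < (2 * j + 2)%:R * y ->
  state1 y = j.
Proof.
move=> y0 /andP[l u]; have y20 : 0 < 2 * y by rewrite mulr_gt0.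
apply: truncn_def; apply/andP; split.
- rewrite -(ler_pM2r y20) mulVf ?gt_eqF // mulrA (mulrC _ 2) -natrM.
  exact: ltW.
- rewrite -(ltr_pM2r y20) mulVf ?gt_eqF // mulrA -natrM mulnC mulnS addnC.
  exact: u.
Qed.

(** For irrational [y] the number 1/y is never an integer, so the boundary cases of [Tmap] and
    [s1_pos] disappear and the branch depends only on the side of 1/(2j+1) on which [y] lies. *)
Lemma Tmap_branch y : irr01 y -> let j := state1 y in
  ([/\ (0 < j)%N, 1 < (2 * j + 1)%:R * y, Tmap y = 1 - (2 * j)%:R * y &
     d1 y = (2 * j)%:R]) \/
  ([/\ (2 * j + 1)%:R * y < 1, Tmap y = (2 * j + 2)%:R * y - 1 &
     d1 y = (2 * j + 2)%:R]).
Proof.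
move=> Hy j; have /andP[l u] := state1P Hy; rewrite -/j in l u.
case: Hy => /andP[y0 y1] iy.
have yV (n : nat) : (n%:R < y^-1) = (n%:R * y < 1).
  by rewrite -[LHS](ltr_pM2r y0) mulVf ?gt_eqF.
have Vy (n : nat) : (y^-1 < n%:R) = (1 < n%:R * y).
  by rewrite -[LHS](ltr_pM2r y0) mulVf ?gt_eqF.
have Vn (n : nat) : (n%:~R == y^-1) = false.
  rewrite -pmulrn; apply/eqP => e; move: (irrational_neq_natM n iy).
  by rewrite e mulVf ?eqxx // gt_eqF.
have fl (n : nat) : n%:R * y < 1 -> 1 < n.+1%:R * y -> Num.floor y^-1 = n.
  move=> h1 h2; apply: floor_def; rewrite -addn1 in h2.
  by rewrite -[(n%:Z + 1)]/((n + 1)%N%:Z) -!pmulrn ltW ?yV // Vy.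
have ce (n : nat) : n%:R * y < 1 -> 1 < n.+1%:R * y -> Num.ceil y^-1 = n.+1.
  move=> h1 h2; apply: ceil_def; rewrite -addn1 PoszD addrK -PoszD addn1.
  by rewrite -!pmulrn yV h1 ltW ?Vy.
rewrite /Tmap /d1 /s1_pos (gt_eqF y0) /=.
have [h|h|h] := ltgtP ((2 * j + 1)%:R * y) 1.
- right; have h2 : 1 < (2 * j + 1).+1%:R * y by rewrite -addnS.
  rewrite (fl _ h h2) (ce _ h h2) Vn /= -addnS oddD oddM /=.
  by rewrite -pmulrn.
- left; have h2 : 1 < (2 * j).+1%:R * y by rewrite -addn1.
  rewrite (fl _ l h2) (ce _ l h2) Vn /= oddM /= -pmulrn; split => //.
  by rewrite lt0n; apply/eqP => j0; move: h; rewrite j0 mul1r ltNge ltW.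
- by move/eqP: h; rewrite (negbTE (irrational_neq_natM _ iy)).
Qed.

Lemma irr01_Tmap y : irr01 y ->
  irr01 (Tmap y) /\ (2 * state1 y + 1)%:R * Tmap y < 1.
Proof.
move=> Hy; have /andP[l u] := state1P Hy; have := Tmap_branch Hy.
case: Hy => /andP[y0 y1] iy; set j := state1 y in l u *.
case => [[j0 h Ty _]|[h Ty _]].
- have iT : irrational (Tmap y).
    rewrite Ty addrC -mulNr; apply: irrational_affine => //.
    + by rewrite oppr_eq0 pnatr_eq0 muln_eq0 /= -lt0n.
    + by have [q e] := natr_ratr (2 * j); exists (- q); rewrite rmorphN /= -e.
    + exact: (natr_ratr 1).
  have b : (2 * j + 1)%:R * Tmap y < 1.
    have : (2 * j)%:R > 0 :> R by rewrite ltr0n muln_gt0.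
    rewrite Ty; move: h; rewrite natrD; set a := (2 * j)%:R => h a0; nra.
  split => //; split => //.
  have : 0 < (2 * j)%:R * y by rewrite mulr_gt0 // ltr0n muln_gt0.
  by rewrite Ty; lra.
- have iT : irrational (Tmap y).
    rewrite Ty; apply: irrational_affine => //.
    + exact: natr_ratr.
    + by exists (-1); rewrite rmorphN rmorph1.
  have b : (2 * j + 1)%:R * Tmap y < 1.
    have : (2 * j)%:R >= 0 :> R by rewrite ler0n.
    rewrite Ty; move: h; rewrite (natrD _ (2 * j) 1) (natrD _ (2 * j) 2); set a := (2 * j)%:R => h a0; nra.
  split => //; split => //.
  have T0 : 0 < Tmap y by rewrite Ty; lra.
  rewrite T0 /=; move: h b; rewrite natrD mulrDl => h b.
  have : 0 <= (2 * j)%:R * Tmap y by rewrite mulr_ge0 // ltW.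
  by lra.
Qed.

Lemma irr01_iter n x : irr01 x -> irr01 (iter n (@Tmap R) x).
Proof. by move=> Hx; elim: n => [//|n /irr01_Tmap[]]. Qed.

Lemma iter_state_lt n x : irr01 x ->
  (2 * state n x + 1)%:R * iter n (@Tmap R) x < 1.
Proof.
move=> Hx; case: n => [|n] /=.
  by rewrite mul1r; case: Hx => /andP[].
by have [] := irr01_Tmap (irr01_iter n Hx).
Qed.

Lemma state_le n x : irr01 x -> (state n x <= state n.+1 x)%N.
Proof.
move=> Hx; have /andP[_] := state1P (irr01_iter n Hx).
have := iter_state_lt n Hx; rewrite [state n.+1 x]/=.
have [/andP[y0 _] _] := irr01_iter n Hx.
move: y0; set y := iter n _ x; move=> y0 h1 h2.
have : (2 * state n x + 1)%:R < (2 * state1 y + 2)%:R :> R.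
  by rewrite -(ltr_pM2r y0); exact: lt_trans h2.
by rewrite ltr_nat; lia.
Qed.

Lemma digit_state n x : irr01 x ->
  digit n.+1 x = (2 * state n.+1 x + 2)%:R \/
  ((0 < state n.+1 x)%N /\ digit n.+1 x = (2 * state n.+1 x)%:R).
Proof.
move=> Hx; have := Tmap_branch (irr01_iter n Hx); rewrite /digit /=.
by case=> [[? _ _ ->]|[_ _ ->]]; [right|left].
Qed.

End Dynamics.

(** * Conditional uniformity and the transition kernel *)

Section Uniform.
Variable R : realType.
Implicit Types (x y a b : R) (i j n : nat) (A B : set R).
Notation mu := (@lebesgue_measure R).
Notation T := (@Tmap R).

Definition win n a b : set R := [set x | a < iter n T x < b].

(* [A] lies in {S_n = i} and, conditionally on [A], the point T^n x is uniformly
   distributed on (0, 1/(2i+1)). *)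
Definition unif_on n i A :=
  [/\ A `<=` @irr01 R, forall x, A x -> state n x = i &
    forall a b, 0 <= a -> a <= b -> (2 * i + 1)%:R * b <= 1 ->
      measurable (A `&` win n a b) /\
      mu (A `&` win n a b) = (((2 * i + 1)%:R * (b - a))%:E * mu A)%E].

(** Lengths relative to (0, 1/(2i+1)): for j > i both branches are reached, on an interval of length
    1/(2j) - 1/(2j+2); for j = i only the part from 1/(2i+2) to 1/(2i+1) is. *)
Definition kern i j : R :=
  if j == i then (2 * i + 2)%:R^-1
  else if (i < j)%N then (2 * i + 1)%:R / (2 * j * j.+1)%:R else 0.

Lemma unif_on_win n i A : unif_on n i A -> A `&` win n 0 (2 * i + 1)%:R^-1 = A.
Proof.
case=> AI As _; apply/seteqP; split => [x []//|x Ax]; split => //.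
have := iter_state_lt n (AI _ Ax); rewrite (As _ Ax) /win /=.
rewrite -[X in _ < X](divr1) invr1 mulr1 => h.
have [/andP[-> _] _] := irr01_iter n (AI _ Ax).
by rewrite -[ltRHS]mul1r ltr_pdivlMr ?ltr0n ?addn1 // mulrC -addn1.
Qed.

Lemma unif_on_measurable n i A : unif_on n i A -> measurable A.
Proof.
move=> gA; rewrite -(unif_on_win gA); have [_ _ h] := gA.
by have [] := h 0 (2 * i + 1)%:R^-1; rewrite ?invr_ge0 // mulfV // pnatr_eq0 addn1.
Qed.

Lemma irr01E : @irr01 R = `]0, 1[ `\` rational.
Proof.
by apply/seteqP; split => x; rewrite /irr01 /irrational /= in_itv.
Qed.

Lemma measurable_rational : measurable (@rational R).
Proof.
apply: countable_measurable; first exact: measurable_set1.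
by apply: card_le_trans (card_image_le _ _) _; exact: countableP.
Qed.

Lemma measure_diff_rational A : measurable A -> mu (A `\` rational) = mu A.
Proof.
move=> mA; have mr := measurable_rational.
have r0 : mu (A `&` rational) = 0%E.
  apply/eqP; rewrite eq_le measure_ge0 andbT -(lebesgue_measure_rat R).
  by apply: le_measure; rewrite ?inE //; exact: measurableI.
have -> : mu A = (mu (A `\` rational) + mu (A `&` rational))%E by exact: measureDI.
by rewrite r0 adde0.
Qed.

Lemma unif_on_irr01 : unif_on 0 0 (@irr01 R) /\ mu (@irr01 R) = 1%E.
Proof.
have m1 : mu (@irr01 R) = 1%E.
  rewrite irr01E measure_diff_rational //= lebesgue_measure_itv /= lte01.
  by rewrite oppr0 addr0.
split => //; split => // a b a0 ab; rewrite mul1r => b1.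
have -> : @irr01 R `&` win 0 a b = `]a, b[ `\` rational.
  rewrite irr01E; apply/seteqP; split => x /=; rewrite !in_itv /=.
    by move=> [[_ ?] ?].
  move=> [/andP[h1 h2] ?]; split; last first.
    by rewrite /win /= h1 h2.
  by split => //; rewrite (le_lt_trans a0 h1) (lt_le_trans h2 b1).
split; first by apply: measurableD => //; exact: measurable_rational.
rewrite m1 mule1 measure_diff_rational //= lebesgue_measure_itv /= lte_fin.
rewrite mul1r; case: ifPn => //; rewrite -leNgt => ba.
by have -> : b = a by [lra]; rewrite subrr.
Qed.

(** Both branches of state [j] are affine, so the preimage of a window has a length proportional to
    that of the window, wherever it lies. This transfers uniformity; the full window then gives the
    transition probability. *)
Lemma unif_on_next n i j A : unif_on n i A -> (i <= j)%N ->
  let B := A `&` [set x | state n.+1 x = j] in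
  unif_on n.+1 j B /\ mu B = ((kern i j)%:E * mu A)%E.
Proof.
move=> gA ij B; have [AI As h] := gA.
have key a b : 0 <= a -> a <= b -> (2 * j + 1)%:R * b <= 1 ->
  measurable (B `&` win n.+1 a b) /\
  mu (B `&` win n.+1 a b) = ((kern i j * ((2 * j + 1)%:R * (b - a)))%:E * mu A)%E.
  move=> a0 ab jb.
  have J0 : 0 <= (2 * j)%:R :> R by [].
  set J := (2 * j)%:R : R in J0.
  have J2E : (2 * j + 2)%:R = J + 2 by rewrite natrD.
  have J1E : (2 * j + 1)%:R = J + 1 by rewrite natrD.
  rewrite J1E in jb.
  (* Preimages of (a, b) under the increasing branch, of slope 2j+2, and the decreasing one, of
     slope -2j. When j = i the second lies beyond 1/(2i+1), out of reach of T^n x; this also covers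
     j = 0, where division by 2j would fail. *)
  set W1 := A `&` win n ((1 + a) / (J + 2)) ((1 + b) / (J + 2)).
  set W2 := if j == i then set0 else A `&` win n ((1 - b) / J) ((1 - a) / J).
  have I0 : (2 * i + 1)%:R <= J + 1 by rewrite -J1E ler_nat; lia.
  have i0 : (0:R) <= (2 * i + 1)%:R by [].
  have b0 : 0 <= b by lra.
  have lo z : 0 < z -> (J + 2) * z < 1 + b -> (J + 1) * z < 1.
    move=> z0 h1; have : (J + 1) * ((J + 2) * z) < (J + 2).
      apply: (@lt_le_trans _ _ ((J + 1) * (1 + b))); last lra.
      by rewrite ltr_pM2l //; lra.
    by rewrite mulrCA -[ltRHS]mulr1 ltr_pM2l //; lra.
  have hi z : 0 < J -> 1 - b < z * J -> 1 < (J + 1) * z.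
    move=> Jp w1.
    have : (J + 1) * (1 - b) < (J + 1) * (z * J) by rewrite ltr_pM2l //; lra.
    move=> q1; have : J * 1 < J * ((J + 1) * z) by lra.
    by rewrite ltr_pM2l.
  have E : B `&` win n.+1 a b = W1 `|` W2.
    apply/seteqP; split.
    - move=> x [[Ax /= sx] wx]; have Ix := irr01_iter n (AI _ Ax).
      have /andP[wa wb] : a < T (iter n T x) < b by [].
      have := Tmap_branch Ix; cbv zeta; rewrite sx J2E J1E -/J => -[[j0 h1 Ty _]|[h1 Ty _]].
      + right; rewrite /W2; case: ifPn => [/eqP ji|ji].
          have := iter_state_lt n (AI _ Ax); rewrite (As _ Ax) -ji J1E.
          by rewrite ltNge ltW.
        split => //; have Jp : 0 < J by rewrite ltr0n muln_gt0.
        rewrite /win /= ltr_pdivrMr // ltr_pdivlMr // [_ * J]mulrC.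
        by rewrite Ty in wa wb; apply/andP; split; lra.
      + left; split => //; rewrite /win /= ltr_pdivrMr ?ltr_pdivlMr; lra.
    - move=> x; rewrite /W1 /W2.
      move=> [[Ax wx]|]; last case: ifPn => // ji [Ax wx].
      + have Ix := irr01_iter n (AI _ Ax); have [/andP[y0 y1] _] := Ix.
        move: wx; rewrite /win /= ltr_pdivrMr ?ltr_pdivlMr; try lra.
        move=> /andP[w1 w2]; rewrite /win /B /=.
        have h1 : (J + 1) * iter n T x < 1 by apply: lo => //; lra.
        have sj : state1 (iter n T x) = j.
          apply: state1_eq => //; rewrite J2E -/J; apply/andP; split; [nra|lra].
        have := Tmap_branch Ix; cbv zeta; rewrite sj J1E J2E => -[[_ ? _ _]|[_ -> _]]; first lra.
        by split => //; apply/andP; split; lra.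
      + have Ix := irr01_iter n (AI _ Ax); have [/andP[y0 y1] _] := Ix.
        have Jp : 0 < J by rewrite ltr0n; lia.
        move: wx; rewrite /win /= ltr_pdivrMr // ltr_pdivlMr // => /andP[w1 w2].
        have h1 := hi _ Jp w1.
        have sj : state1 (iter n T x) = j.
          apply: state1_eq => //; rewrite J2E -/J; apply/andP; split; lra.
        have := Tmap_branch Ix; cbv zeta; rewrite sj J1E J2E -/J => -[[_ _ -> _]|[? _ _]]; last lra.
        by split => //; apply/andP; split; lra.
  have [m1 e1] : measurable W1 /\ mu W1 = (((2 * i + 1)%:R * ((b - a) / (J + 2)))%:E * mu A)%E.
    have [|||mW ->] := h ((1 + a) / (J + 2)) ((1 + b) / (J + 2)).
    - by rewrite divr_ge0 //; lra.
    - by rewrite ler_pM2r ?invr_gt0; lra.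
    - rewrite mulrA ler_pdivrMr; last lra.
      apply: (@le_trans _ _ ((J + 1) * (1 + b))); last lra.
      by rewrite ler_wpM2r //; lra.
    split => //; congr (_%:E * _)%E; congr (_ * _); rewrite -mulrBl; congr (_ / _); lra.
  have [m2 e2] : measurable W2 /\ mu W2 = (((2 * i + 1)%:R * (if j == i then 0 else (b - a) / J))%:E * mu A)%E.
    rewrite /W2; case: ifPn => [_|ji]; first by rewrite mulr0 mul0e measure0.
    have Jp : 0 < J by rewrite ltr0n; lia.
    have I1 : (2 * i + 1)%:R <= J by rewrite ler_nat; lia.
    have [|||mW ->] := h ((1 - b) / J) ((1 - a) / J).
    - rewrite divr_ge0 //; nra.
    - by rewrite ler_pM2r ?invr_gt0 //; lra.
    - rewrite mulrA ler_pdivrMr // mul1r.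
      apply: (@le_trans _ _ (J * (1 - a))); last nra.
      by rewrite ler_wpM2r //; nra.
    split => //; congr (_%:E * _)%E; congr (_ * _); rewrite -mulrBl; congr (_ / _); lra.
  rewrite E; split; first exact: measurableU.
  have dW : W1 `&` W2 = set0.
    rewrite /W1 /W2; case: ifPn => [_|ji]; first by rewrite setI0.
    apply/seteqP; split => // x [[Ax w1] [_ w2]] /=.
    have Jp : 0 < J by rewrite ltr0n; lia.
    have [/andP[y0 _] _] := irr01_iter n (AI _ Ax).
    have J2p : 0 < J + 2 by lra.
    move: w1 w2; rewrite /win /= !ltr_pdivrMr ?ltr_pdivlMr //.
    move=> /andP[_ w2] /andP[w3 _]; have := hi _ Jp w3.
    by rewrite ltNge ltW // lo // mulrC.
  have -> : mu (W1 `|` W2) = (mu W1 + mu W2)%E by apply: measureU.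
  rewrite e1 e2 -ge0_muleDl ?lee_fin; last 2 first.
  - by rewrite mulr_ge0 // divr_ge0 //; lra.
  - by rewrite mulr_ge0 //; case: ifPn => // _; rewrite divr_ge0 //; lra.
  congr (_ * _)%E; rewrite -EFinD; congr (_%:E).
  rewrite /kern; have := ij; rewrite leq_eqVlt [j == i]eq_sym; case: eqP => [eij _|_ /= lij].
    rewrite eij -/J J1E J2E; field; lra.
  have Jp : J != 0 by rewrite pnatr_eq0; lia.
  rewrite lij J1E natrM -/J -[j.+1%:R]natr1; have -> : j%:R = J / 2 by rewrite /J natrM; field.
  have j0 : j%:R != 0 :> R by rewrite pnatr_eq0; lia.
  have j1 : 0 <= j%:R :> R by [].
  by field; rewrite j0 /=; apply/andP; split; apply: lt0r_neq0; lra.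
have kE : mu B = ((kern i j)%:E * mu A)%E.
  have BE : B `&` win n.+1 0 (2 * j + 1)%:R^-1 = B.
    apply/seteqP; split => [x []//|x [Ax sx]]; split => //.
    have := iter_state_lt n.+1 (AI _ Ax); rewrite sx /win => l.
    have [/andP[/= -> _] _] := irr01_iter n.+1 (AI _ Ax).
    by rewrite -[ltRHS]mul1r ltr_pdivlMr ?ltr0n ?addn1 // mulrC -addn1.
  have J0 : (2 * j + 1)%:R != 0 :> R by rewrite pnatr_eq0 addn1.
  have [|||_] := key 0 (2 * j + 1)%:R^-1; rewrite ?invr_ge0 ?mulfV //.
  by rewrite BE subr0 mulfV // mulr1.
split => //; split.
- by move=> x [/AI].
- by move=> x [].
move=> a b a0 ab jb; have [m ->] := key a b a0 ab jb; split => //.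
by rewrite kE muleA -EFinM mulrC.
Qed.

(* The conditional probability of [B] is at least [c] for every past of S_n = i. *)
Definition cond_lb n i B (c : R) := forall A, unif_on n i A ->
  measurable (A `&` B) /\ (c%:E * mu A <= mu (A `&` B))%E.

Lemma unif_on_fin n i A : unif_on n i A -> mu A \is a fin_num.
Proof.
move=> gA; rewrite ge0_fin_numE // (@le_lt_trans _ _ 1%E) // ?ltry //.
have [gi <-] := unif_on_irr01; apply: le_measure; rewrite ?inE.
- exact: unif_on_measurable gA.
- exact: unif_on_measurable gi.
- by case: gA.
Qed.

Lemma cond_lb_le n i B c d : cond_lb n i B d -> c <= d -> cond_lb n i B c.
Proof.
move=> L cd A gA; have [mAB h] := L _ gA; split => //.
by apply: le_trans h; rewrite lee_wpmul2r // lee_fin.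
Qed.

(** The Markov property for lower bounds. Splitting by the next state gives a disjoint union whose
    partial sums lie below the full measure, so convergence of the partial sums suffices and [g] may
    take either sign. *)
Lemma cond_lb_step n i B (g : nat -> R) (c : R) :
  (forall j, (i <= j)%N -> cond_lb n.+1 j B (g j)) ->
  (\sum_(0 <= k < N) kern i (i + k) * g (i + k)%N @[N --> \oo] --> c) ->
  cond_lb n i B c.
Proof.
move=> L cv A gA; have [AI As _] := gA.
pose A_ k := A `&` [set x | state n.+1 x = (i + k)%N].
have gA_ k : unif_on n.+1 (i + k) (A_ k) /\ mu (A_ k) = ((kern i (i + k))%:E * mu A)%E.
  by apply: unif_on_next => //; exact: leq_addr.
have mAB k : measurable (A_ k `&` B).
  by have [gk _] := gA_ k; have [] := L _ (leq_addr k i) _ gk.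
have E : A `&` B = \bigcup_k (A_ k `&` B).
  apply/seteqP; split => [x [Ax Bx]|x [k _ [[Ax _] Bx]]] //.
  exists (state n.+1 x - i)%N => //; split => //; split => //=.
  by have := state_le n (AI _ Ax); rewrite (As _ Ax) => ?; rewrite subnKC.
have mE : measurable (A `&` B) by rewrite E; exact: bigcupT_measurable.
split => //.
have tr : trivIset setT (fun k => A_ k `&` B).
  apply/trivIsetP => k l _ _ /eqP kl; apply/seteqP; split => // x.
  move=> [[[_ /= e1] _] [[_ /= e2] _]]; apply: kl; apply: (@addnI i).
  by rewrite -e1 -e2.
have fA := unif_on_fin gA.
have fAB : mu (A `&` B) \is a fin_num.
  rewrite ge0_fin_numE // (@le_lt_trans _ _ (mu A)) ?ltey_eq ?fA //.
  by apply: le_measure; rewrite ?inE //; exact: unif_on_measurable gA.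
rewrite -(fineK fA) -(fineK fAB) -EFinM lee_fin.
apply: (ler_cvg_to (cvgMr_tmp (b := fine (mu A)) cv)
  (cvg_cst (fine (mu (A `&` B))))).
apply: nearW => N; rewrite -lee_fin fineK // E.
have -> : mu (\bigcup_k (A_ k `&` B)) = (\sum_(k <oo) mu (A_ k `&` B))%E.
  by apply: measure_semi_bigcup => //; rewrite -E.
apply: le_trans (nneseries_lim_ge N _); last by [].
rewrite mulr_suml -sumEFin; apply: lee_sum => k _.
have [gk ek] := gA_ k; have [_] := L _ (leq_addr k i) _ gk; apply: le_trans.
by rewrite ek -(fineK fA) -!EFinM lee_fin mulrA (mulrC (kern _ _)).
Qed.

End Uniform.

(** * Eigenfunctions of the kernel *)

Section Eigen.
Variable R : realType.
Implicit Types (x y t : R) (i j n : nat).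

Lemma ln_le_subr1 x : 0 < x -> ln x <= x - 1.
Proof. by move=> x0; rewrite -{1}(subrK 1 x) addrC le_ln1Dx // ltrBrDr addNr. Qed.

Lemma ln_ge_1subV x : 0 < x -> 1 - x^-1 <= ln x.
Proof.
move=> x0; have := @ln_le_subr1 x^-1; rewrite invr_gt0 => /(_ x0).
by rewrite lnV ?posrE //; lra.
Qed.

(** The common form of the sums for constants, eigenfunctions and Gamma averages: [r n] is the part
    of the sum beyond [n]. *)
Lemma kern_sum_telescope i (f r : nat -> R) c :
  (forall j, (i <= j)%N -> kern R i j.+1 * f j.+1 = r j - r j.+1) ->
  kern R i i * f i + r i = c -> (r n @[n --> \oo] --> 0) ->
  \sum_(0 <= k < N) kern R i (i + k) * f (i + k)%N @[N --> \oo] --> c.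
Proof.
move=> Hr Hc r0; rewrite -cvg_shiftS /=.
have E N : \sum_(0 <= k < N.+1) kern R i (i + k) * f (i + k)%N = c - r (N + i)%N.
  elim: N => [|N IH].
    by rewrite big_nat1 addn0 add0n -Hc addrK.
  rewrite big_nat_recr //= IH addnS Hr ?leq_addr // addSn (addnC i).
  by rewrite addrA subrK.
suff: c - r (N + i)%N @[N --> \oo] --> c - 0.
  by rewrite subr0; under eq_fun do rewrite -E.
by apply: cvgB; [exact: cvg_cst|rewrite (cvg_shiftn i)].
Qed.

Definition lodd j : R := ln (2 * j + 1)%:R.

(** Put g(i) = f(i)/(2i+1) in the eigenvalue equation, divide by 2i+1 and subtract the equations for
    l-1 and l: this leaves g(l) (1/t + 1/(2l)) = g(l-1) (1/t - 1/(2l)), hence the factor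
    (2l-t)/(2l+t). *)
Definition ppi t j : R :=
  \prod_(0 <= l < j) (((2 * l.+1)%:R - t) / ((2 * l.+1)%:R + t)).

Definition eigen t j : R := (2 * j + 1)%:R * ppi t j.

Lemma ppiS t j :
  ppi t j.+1 = ppi t j * (((2 * j.+1)%:R - t) / ((2 * j.+1)%:R + t)).
Proof. by rewrite /ppi big_nat_recr. Qed.

Let fac_gt0 t j : 2^-1 <= t <= 3 / 2 ->
  0 < ((2 * j.+1)%:R - t) / ((2 * j.+1)%:R + t).
Proof.
move=> /andP[t1 t2]; suff fac (l : R) : 2 <= l -> 0 < (l - t) / (l + t).
  by apply: fac; rewrite ler_nat; lia.
by move=> l2; rewrite divr_gt0 //; lra.
Qed.

Lemma ppi_gt0 t j : 2^-1 <= t <= 3 / 2 -> 0 < ppi t j.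
Proof. by move=> ht; apply: prodr_gt0 => l _; exact: fac_gt0. Qed.

Lemma eigen_gt0 t j : 2^-1 <= t <= 3 / 2 -> 0 < eigen t j.
Proof. by move=> ht; rewrite mulr_gt0 ?ppi_gt0 // ltr0n addn1. Qed.

(** The logarithm of the l-th factor and t times the l-th increment of [lodd] cancel up to 8/l^2.
    The induction carries 16 (1 - 1/(j+1)), whose increments 16/(l(l+1)) dominate these errors. *)
Lemma ln_ppi_bound t j : 2^-1 <= t <= 3 / 2 ->
  `|ln (ppi t j) + t * lodd j| <= 16.
Proof.
move=> ht; have /andP[t1 t2] := ht.
have key : `|ln (ppi t j) + t * lodd j| <= 16 * (1 - j.+1%:R^-1).
  elim: j => [|j IH].
    by rewrite /ppi /lodd big_geq // muln0 add0n ln1 mulr0 addr0 invr1 subrr mulr0 normr0.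
  rewrite ppiS lnM ?posrE ?ppi_gt0 ?fac_gt0 //.
  set l : R := j.+1%:R.
  have l1 : 1 <= l by rewrite ler1n.
  have e2 : (2 * j.+1)%:R = 2 * l by rewrite natrM.
  have lo : lodd j.+1 = lodd j + ln ((2 * l + 1) / (2 * l - 1)).
    rewrite /lodd -lnM ?posrE; last 2 first.
    - by rewrite ltr0n addn1.
    - by rewrite divr_gt0; lra.
    congr ln; rewrite (natrD _ (2 * j.+1) 1) (natrD _ (2 * j) 1) e2.
    have -> : (2 * j)%:R = 2 * l - 2 :> R by rewrite /l natrM -natr1; lra.
    by field; rewrite gt_eqF //; lra.
  have j2 : j.+2%:R = l + 1 by rewrite -[j.+2%:R]natr1.
  rewrite -/l in IH.
  clearbody l; rewrite lo e2.
  set q := (2 * l - t) / (2 * l + t).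
  have q0 : 0 < q by rewrite divr_gt0; lra.
  have p0 : 0 < (2 * l + 1) / (2 * l - 1) by rewrite divr_gt0; lra.
  have q1 := ln_le_subr1 q0; have q2 := ln_ge_1subV q0.
  have p1 := ln_le_subr1 p0; have p2 := ln_ge_1subV p0.
  set d := ln q + t * ln ((2 * l + 1) / (2 * l - 1)).
  have -> : ln (ppi t j) + ln q + t * (lodd j + ln ((2 * l + 1) / (2 * l - 1))) =
     (ln (ppi t j) + t * lodd j) + d by rewrite /d; ring.
  have l10 : l != 0 by rewrite gt_eqF //; lra.
  have l2p : 0 < 2 * l - 1 by lra.
  have l3p : 0 < 2 * l + 1 by lra.
  have l4p : 0 < 2 * l - t by lra.
  have l5p : 0 < 2 * l + t by lra.
  have dl : `|d| <= 8 / l ^+ 2.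
    have hu : d <= 2 * t * (1 + t) / ((2 * l - 1) * (2 * l + t)).
      have -> : 2 * t * (1 + t) / ((2 * l - 1) * (2 * l + t)) =
        (q - 1) + t * ((2 * l + 1) / (2 * l - 1) - 1).
        by rewrite /q; field; repeat (apply/andP; split); apply: lt0r_neq0; lra.
      by rewrite lerD // ler_wpM2l //; lra.
    have hl : - (2 * t * (1 + t) / ((2 * l + 1) * (2 * l - t))) <= d.
      have -> : - (2 * t * (1 + t) / ((2 * l + 1) * (2 * l - t))) =
        (1 - q^-1) + t * (1 - ((2 * l + 1) / (2 * l - 1))^-1).
        by rewrite /q; field; repeat (apply/andP; split); apply: lt0r_neq0; lra.
      by rewrite lerD // ler_wpM2l //; lra.
    have l20 : 0 < l ^+ 2 by rewrite exprn_gt0 //; lra.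
    have T : 2 * t * (1 + t) <= 15 / 2 by nra.
    rewrite ler_norml; apply/andP; split.
      apply: le_trans hl; rewrite lerN2 ler_pdivrMr ?mulr_gt0 //.
      rewrite [leRHS]mulrAC ler_pdivlMr //.
      apply: (@le_trans _ _ (15 / 2 * l ^+ 2)); first by rewrite ler_wpM2r //; lra.
      by rewrite expr2; nra.
    apply: (le_trans hu); rewrite ler_pdivrMr ?mulr_gt0 //.
    rewrite [leRHS]mulrAC ler_pdivlMr //.
    apply: (@le_trans _ _ (15 / 2 * l ^+ 2)); first by rewrite ler_wpM2r //; lra.
    by rewrite expr2; nra.
  apply: (le_trans (ler_normD _ _)); apply: (le_trans (lerD IH dl)).
  rewrite j2.
  have -> : 16 * (1 - (l + 1)^-1) = 16 * (1 - l^-1) + 16 / (l * (l + 1)).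
    by field; rewrite l10 gt_eqF //; lra.
  rewrite lerD2l ler_pdivlMr ?mulr_gt0; try lra.
  rewrite [leLHS]mulrAC ler_pdivrMr ?exprn_gt0; try lra.
  by rewrite expr2; nra.
by apply: (le_trans key); rewrite -[leRHS]mulr1 ler_pM2l // gerBl invr_ge0.
Qed.

Lemma eigen_bound t j : 2^-1 <= t <= 3 / 2 ->
  expR (- 16) * expR ((1 - t) * lodd j) <= eigen t j <=
    expR 16 * expR ((1 - t) * lodd j).
Proof.
move=> ht; have := ln_ppi_bound j ht; rewrite ler_norml => /andP[h1 h2].
have E : eigen t j = expR (lodd j + ln (ppi t j)).
  by rewrite expRD /lodd !lnK ?posrE ?ppi_gt0 // ltr0n addn1.
by rewrite E -!expRD !ler_expR; apply/andP; split; lra.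
Qed.

Lemma cvgryMl (c : R) (u : nat -> R) : 0 < c ->
  (u n @[n --> \oo] --> +oo) -> c * u n @[n --> \oo] --> +oo.
Proof.
move=> c0 /cvgryPge uy; apply/cvgryPge => A.
by apply: filterS (uy (A / c)) => n; rewrite ler_pdivrMr // mulrC.
Qed.

Lemma lodd_ge0 j : 0 <= lodd j.
Proof. by rewrite ln_ge0 // ler1n addn1. Qed.

Lemma lodd_cvg : lodd j @[j --> \oo] --> +oo.
Proof.
apply/cvgryPge => A; exists (Num.truncn (expR A)).+1 => // j /= jA.
rewrite -[A]expRK ler_ln ?posrE ?expR_gt0 // ?ltr0n ?addn1 //.
apply: (@le_trans _ _ j%:R); last by rewrite ler_nat; lia.
by rewrite (le_trans (ltW (truncnS_gt _))) // ler_nat.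
Qed.

Lemma ppi_cvg0 t : 2^-1 <= t <= 3 / 2 -> ppi t j @[j --> \oo] --> 0.
Proof.
move=> ht; have /andP[t1 t2] := ht.
apply: (@squeeze_cvgr _ _ _ _ (fun=> 0) (fun j => expR 16 * expR (- (t * lodd j)))).
- apply: nearW => j; rewrite ltW ?ppi_gt0 //=.
  have := ln_ppi_bound j ht; rewrite ler_norml => /andP[h1 h2].
  by rewrite -expRD -[leLHS]lnK ?posrE ?ppi_gt0 // ler_expR; lra.
- exact: cvg_cst.
- rewrite -[X in _ --> X](mulr0 (expR 16)); apply: cvgMl_tmp.
  apply: (cvg_comp (fun j => t * lodd j) (fun x => expR (- x))); last exact: cvgr_expR.
  by apply: cvgryMl lodd_cvg; lra.
Qed.

Lemma eigen_sum t i : 2^-1 <= t <= 3 / 2 ->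
  \sum_(0 <= k < N) kern R i (i + k) * eigen t (i + k) @[N --> \oo]
    --> eigen t i / t.
Proof.
move=> ht; have /andP[t1 t2] := ht; pose r j := (2 * i + 1)%:R * (ppi t j * (t^-1 - (2 * j + 2)%:R^-1)).
have t0 : t != 0 by rewrite gt_eqF //; lra.
apply: (@kern_sum_telescope i _ r).
- move=> j ij; rewrite /kern /r /eigen gtn_eqF // ltnS ij ppiS.
  have -> : (2 * j + 2)%:R = (2 * j.+1)%:R :> R by congr _%:R; lia.
  rewrite (natrD _ (2 * i) 1) (natrD _ (2 * j.+1) 1) (natrD _ (2 * j.+1) 2) !natrM -[j.+2%:R]natr1.
  have : 1 <= j.+1%:R :> R by rewrite ler1n.
  set l := j.+1%:R => l1.
  by field; rewrite t0 /= !gt_eqF //; lra.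
- rewrite /kern /r eqxx /eigen.
  have : 0 < (2 * i + 2)%:R :> R by rewrite ltr0n addn2.
  by move=> ?; field; rewrite t0 gt_eqF.
- rewrite -[X in _ --> X](mulr0 (2 * i + 1)%:R); apply: cvgMl_tmp.
  rewrite -[X in _ --> X](mul0r t^-1); apply: cvgM; first exact: ppi_cvg0.
  rewrite -[X in _ --> X]subr0; apply: cvgB; first exact: cvg_cst.
  have -> : (fun j => (2 * j + 2)%:R^-1) = (fun j => 2^-1 * harmonic j : R).
    by apply/funext => j /=; rewrite -invfM -natrM; congr (_%:R^-1); lia.
  by rewrite -[X in _ --> X](mulr0 2^-1); apply: cvgMl_tmp; exact: cvg_harmonic.
Qed.
End Eigen.

(** * Real estimates *)

Section LnBounds.
Variable R : realType.
Implicit Types (x y t : R) (n k : nat).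

Lemma le_of_derive_ge0 (f df : R -> R) a b : a <= b ->
  (forall x, a <= x <= b -> is_derive x 1 f (df x)) ->
  (forall x, a <= x <= b -> 0 <= df x) -> f a <= f b.
Proof.
move=> ab fd df0.
have cf : {within `[a, b], continuous f}.
  apply: derivable_within_continuous => x; rewrite in_itv /= => h.
  by have [] := fd _ h.
have fd' x : x \in `]a, b[%R -> is_derive x 1 f (df x).
  by rewrite in_itv /= => /andP[? ?]; apply: fd; rewrite !ltW.
have [c] := MVT_segment ab fd' cf.
rewrite in_itv /= => h E; rewrite -subr_ge0 E mulr_ge0 ?df0 // subr_ge0 //.
Qed.

Section DeriveRules.
Variables (f g : R -> R) (x a b : R).
Hypotheses (df : is_derive x 1 f a) (dg : is_derive x 1 g b).

Lemma deriv_add : is_derive x 1 (fun y => f y + g y) (a + b).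
Proof. exact: is_deriveD. Qed.

Lemma deriv_sub : is_derive x 1 (fun y => f y - g y) (a - b).
Proof. exact: is_deriveB. Qed.

Lemma deriv_mul : is_derive x 1 (fun y => f y * g y) (a * g x + f x * b).
Proof.
apply: (is_derive_eq (is_deriveM df dg)).
by rewrite addrC; congr (_ + _); rewrite /GRing.scale /= mulrC.
Qed.

Lemma deriv_scale (c : R) : is_derive x 1 (fun y => c * f y) (c * a).
Proof. exact: is_deriveZ. Qed.

Lemma deriv_inv : f x != 0 -> is_derive x 1 (fun y => (f y)^-1) (- a / f x ^+ 2).
Proof.
move=> fx; apply: (is_derive_eq (is_deriveV fx df)).
by rewrite /GRing.scale /= mulNr mulrC mulNr.
Qed.

Lemma deriv_ln : 0 < f x -> is_derive x 1 (fun y => ln (f y)) (a / f x).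
Proof.
move=> fx; have := is_derive1_ln fx => dl.
by apply: (is_derive_eq (is_derive1_comp dl df)); rewrite mulrC.
Qed.

Lemma deriv_exp : is_derive x 1 (fun y => expR (f y)) (expR (f x) * a).
Proof. exact: (is_derive1_comp (is_derive_expR (f x)) df). Qed.

End DeriveRules.

Lemma deriv_cst (x c : R) : is_derive x 1 (fun=> c) 0.
Proof. exact: is_derive_cst. Qed.

Lemma deriv_id (x : R) : is_derive x 1 (fun y => y) 1.
Proof. exact: is_derive_id. Qed.

Lemma ln_le_half x : 1 <= x -> ln x <= (x - x^-1) / 2.
Proof.
move=> x1; pose f y := 2^-1 * (y - y^-1) - ln y.
have := @le_of_derive_ge0 f (fun y => (1 - y^-1) ^+ 2 / 2) 1 x x1.
rewrite /f ln1 invr1 subrr mulr0 subr0 subr_ge0 [_^-1 * _]mulrC; apply.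
- move=> y /andP[y1 _]; have y0 : 0 < y by lra.
  have y0' : y != 0 by rewrite gt_eqF.
  have di := deriv_id y; have dv := deriv_inv di y0'; have dl := deriv_ln di y0.
  apply: (is_derive_eq (deriv_sub (deriv_scale (deriv_sub di dv) 2^-1) dl)).
  by field.
- by move=> y _; rewrite divr_ge0 // sqr_ge0.
Qed.

Lemma ln_le_quad x : 0 < x -> x <= 1 -> ln x <= (x - 1) - (x - 1) ^+ 2 / 2.
Proof.
move=> x0 x1; pose f y := ln y - (y - 2^-1 * ((y - 1) * (y - 1))).
have := @le_of_derive_ge0 f (fun y => (1 - y) ^+ 2 / y) x 1 x1.
rewrite /f ln1 => H.
suff : ln x - (x - 2^-1 * ((x - 1) * (x - 1))) <= 0 - (1 - 2^-1 * ((1 - 1) * (1 - 1))).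
  by rewrite expr2; lra.
apply: H.
- move=> y /andP[y1 _]; have y0 : 0 < y by lra.
  have y0' : y != 0 by rewrite gt_eqF.
  have d1 : is_derive y 1 (fun y => y - 1) (1 - 0).
    exact: deriv_sub (deriv_id _) (deriv_cst _ _).
  have di := deriv_id y; have dl := deriv_ln di y0.
  apply: (is_derive_eq (deriv_sub dl (deriv_sub di (deriv_scale (deriv_mul d1 d1) 2^-1)))).
  by field.
- by move=> y /andP[y1 _]; rewrite divr_ge0 ?sqr_ge0 //; lra.
Qed.

(** Quadratic near 0 and linear for large [x]: this shape yields an integrable majorant, independent
    of n, for the rescaled Gamma densities. *)
Lemma subr_ln_ge x : -1 < x -> x ^+ 2 / (2 * (1 + `|x|)) <= x - ln (1 + x).
Proof.
move=> x1; have [x0|x0] := leP 0 x.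
  have := @ln_le_half (1 + x); rewrite lerDl => /(_ x0) h.
  rewrite ger0_norm //; apply: (@le_trans _ _ (x - ((1 + x) - (1 + x)^-1) / 2)); last lra.
  by rewrite le_eqVlt; apply/orP; left; apply/eqP; field; rewrite gt_eqF //; lra.
have E : 1 + x - 1 = x by ring.
have := @ln_le_quad (1 + x); rewrite E => h.
have {}h : ln (1 + x) <= x - x ^+ 2 / 2 by apply: h; lra.
apply: (@le_trans _ _ (x ^+ 2 / 2)); last lra.
rewrite ler_wpM2l ?sqr_ge0 // lef_pV2 ?posrE; first by rewrite ler_pMr // lerDl.
  by rewrite mulr_gt0 // ltr_wpDr.
by [].
Qed.

(* [psi] is the cumulant generating function of a centred exponential variable *)
Definition psi t := - ln (1 - t) - t.

Lemma psi_ge0 t : t < 1 -> 0 <= psi t.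
Proof.
by move=> t1; have := @le_ln1Dx R (- t); rewrite /psi => h; have := h _; lra.
Qed.

(** The remainder has derivative y^2/(1-y), which lies between 0 and 2 y^2 for |y| at most 1/2; so
    both the remainder and 2 y^3/3 minus the remainder are nondecreasing. *)
Lemma psi_cubic t : `|t| <= 2^-1 -> `|psi t - t ^+ 2 / 2| <= 2 * `|t| ^+ 3.
Proof.
pose f y := - ln (1 - y) - y - 2^-1 * (y * y).
have df y : y < 1 -> is_derive y 1 f (y ^+ 2 / (1 - y)).
  move=> y1; have y0 : 1 - y != 0 by rewrite gt_eqF //; lra.
  have d1 : is_derive y 1 (fun y => 1 - y) (0 - 1).
    exact: deriv_sub (deriv_cst _ _) (deriv_id _).
  have di := deriv_id y.
  have dl : is_derive y 1 (fun y => - ln (1 - y)) (- ((0 - 1) / (1 - y))).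
    by apply: is_deriveN; apply: deriv_ln d1 _; lra.
  apply: (is_derive_eq (deriv_sub (deriv_sub dl di) (deriv_scale (deriv_mul di di) 2^-1))).
  by field.
have f0 : f 0 = 0 by rewrite /f !mulr0 !subr0 ln1 oppr0.
have -> : psi t - t ^+ 2 / 2 = f t by rewrite /psi /f expr2; ring.
have bd y : - 2^-1 <= y <= 2^-1 -> 0 <= y ^+ 2 / (1 - y) <= 2 * y ^+ 2.
  move=> /andP[h1 h2]; have y1 : 0 < 1 - y by lra.
  rewrite divr_ge0 ?sqr_ge0 //=; last exact: ltW.
  by rewrite mulrC ler_wpM2r ?sqr_ge0 // invf_ple ?posrE //; lra.
have dc (z : R) : is_derive z 1 (fun y => 2 / 3 * (y * y * y)) (2 * z ^+ 2).
  have di := deriv_id z.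
  apply: (is_derive_eq (deriv_scale (deriv_mul (deriv_mul di di) di) (2 / 3))).
  by field.
move=> ht; have /andP[t1 t2] : - 2^-1 <= t <= 2^-1 by rewrite -ler_norml.
have c0 : 0 <= `|t| ^+ 3 by rewrite exprn_ge0.
pose g y := 2 / 3 * (y * y * y) - f y.
have g0 : g 0 = 0 by rewrite /g f0 !mulr0 subr0.
have dg y : y < 1 -> is_derive y 1 g (2 * y ^+ 2 - y ^+ 2 / (1 - y)).
  by move=> /df dfy; exact: (deriv_sub (dc y) dfy).
have mono a b : - 2^-1 <= a -> a <= b -> b <= 2^-1 -> f a <= f b /\ g a <= g b.
  move=> ha ab hb; split.
    apply: (@le_of_derive_ge0 f (fun y => y ^+ 2 / (1 - y)) _ _ ab) => y /andP[y1 y2].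
      by apply: df; lra.
    by have /andP[] : 0 <= y ^+ 2 / (1 - y) <= 2 * y ^+ 2 by apply: bd; lra.
  have dg' y : a <= y <= b -> is_derive y 1 g (2 * y ^+ 2 - y ^+ 2 / (1 - y)).
    by move=> /andP[y1 y2]; apply: dg; lra.
  have pos y : a <= y <= b -> 0 <= 2 * y ^+ 2 - y ^+ 2 / (1 - y).
    move=> /andP[y1 y2]; rewrite subr_ge0.
    by have /andP[] : 0 <= y ^+ 2 / (1 - y) <= 2 * y ^+ 2 by apply: bd; lra.
  exact: (le_of_derive_ge0 ab dg' pos).
have [t0|t0] := leP 0 t.
- have tE : `|t| ^+ 3 = t * t * t by rewrite ger0_norm //; ring.
  have [] : f 0 <= f t /\ g 0 <= g t by apply: mono => //; lra.
  rewrite f0 g0 /g => l1 l2; rewrite ger0_norm // tE; rewrite tE in c0.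
  by move: (t * t * t) c0 l1 l2 => c; move: (f t) => ft; lra.
- have tE : `|t| ^+ 3 = - (t * t * t) by rewrite ltr0_norm //; ring.
  have [] : f t <= f 0 /\ g t <= g 0 by apply: mono => //; lra.
  rewrite f0 g0 /g => l1 l2; rewrite ler0_norm // tE; rewrite tE in c0.
  by move: (t * t * t) c0 l1 l2 => c; move: (f t) => ft; lra.
Qed.

End LnBounds.

(** * Gamma tails and their Gaussian limit *)

Section GammaTail.
Variable R : realType.
Implicit Types (s t u v b : R) (n k i j : nat).

Definition exp_trunc k t : R := \sum_(0 <= j < k) t ^+ j / j`!%:R.

(* Tail of the Gamma distribution with parameter [k], i.e. of a sum of [k]
   independent exponential variables. *)
Definition Gtail k t : R := if t <= 0 then 1 else expR (- t) * exp_trunc k t.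

(** Density of a sum of k+1 exponential variables, so minus the derivative of [Gtail k.+1] on the
    positive axis; its mode is k. *)
Definition gam k t : R := expR (- t) * (t ^+ k / k`!%:R).

Lemma exp_truncS k t : exp_trunc k.+1 t = exp_trunc k t + t ^+ k / k`!%:R.
Proof. by rewrite /exp_trunc big_nat_recr. Qed.

Lemma deriv_pow n t : is_derive t 1 (fun x => x ^+ n.+1) (n.+1%:R * t ^+ n).
Proof.
elim: n => [|n IH].
  have -> : (fun x : R => x ^+ 1) = (fun x => x) by apply/funext => x; rewrite expr1.
  by rewrite expr0 mulr1; exact: deriv_id.
have -> : (fun x : R => x ^+ n.+2) = (fun x => x * x ^+ n.+1).
  by apply/funext => x; rewrite exprS.
apply: (is_derive_eq (deriv_mul (deriv_id t) IH)).
by rewrite -[n.+2%:R]natr1 exprS; ring.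
Qed.

Lemma deriv_exp_trunc k t : is_derive t 1 (exp_trunc k.+1) (exp_trunc k t).
Proof.
elim: k t => [|k IH] t.
  have -> : exp_trunc 1 = fun=> 1.
    by apply/funext => x; rewrite /exp_trunc big_nat1 expr0 fact0 divr1.
  by rewrite /exp_trunc big_geq //; exact: deriv_cst.
have -> : exp_trunc k.+2 = (fun x => exp_trunc k.+1 x + (k.+1)`!%:R^-1 * x ^+ k.+1).
  by apply/funext => x; rewrite exp_truncS mulrC.
apply: (is_derive_eq (deriv_add (IH t) (deriv_scale (deriv_pow k t) (k.+1)`!%:R^-1))).
rewrite exp_truncS; congr (_ + _); rewrite factS natrM.
have f0 : k`!%:R != 0 :> R by rewrite pnatr_eq0 -lt0n fact_gt0.
have k0 : k.+1%:R != 0 :> R by [].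
by field; rewrite f0 ?natr1 ?nat1r ?k0.
Qed.

Lemma deriv_expN t : is_derive t 1 (fun x : R => expR (- x)) (- expR (- t)).
Proof.
have dN : is_derive t 1 (fun x => - x) (- 1) by exact: is_deriveN.
by apply: (is_derive_eq (deriv_exp dN)); rewrite mulrN1.
Qed.

Lemma deriv_Egam k t : is_derive t 1 (fun x => expR (- x) * exp_trunc k.+1 x) (- gam k t).
Proof.
apply: (is_derive_eq (deriv_mul (deriv_expN t) (deriv_exp_trunc k t))).
by rewrite exp_truncS /gam; ring.
Qed.

Lemma gam_ge0 k t : 0 <= t -> 0 <= gam k t.
Proof. by move=> t0; rewrite mulr_ge0 ?expR_ge0 // divr_ge0 // exprn_ge0. Qed.

Lemma exp_trunc_ge0 k t : 0 <= t -> 0 <= exp_trunc k t.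
Proof. by move=> t0; apply: sumr_ge0 => j _; rewrite divr_ge0 // exprn_ge0. Qed.

Lemma exp_trunc0 k : exp_trunc k.+1 0 = 1.
Proof.
elim: k => [|k IH]; first by rewrite /exp_trunc big_nat1 expr0 fact0 divr1.
by rewrite exp_truncS IH expr0n mul0r addr0.
Qed.

Definition gam_max k : R := gam k k%:R.

Lemma gam_le_max k t : 0 <= t -> gam k t <= gam_max k.
Proof.
move=> t0; rewrite /gam_max /gam; case: k => [|k].
  by rewrite !expr0 fact0 divr1 !mulr1 ler_expR lerN2.
move: t0; rewrite le_eqVlt => /predU1P[<-|t0].
  by rewrite expr0n mul0r mulr0 mulr_ge0 ?expR_ge0 // divr_ge0 // exprn_ge0.
have k0 : 0 < k.+1%:R :> R by [].
set K : R := k.+1%:R in k0 *.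
rewrite !mulrA ler_wpM2r ?invr_ge0 //.
have E x : 0 < x -> expR (- x) * x ^+ k.+1 = expR (K * ln x - x).
  by move=> x0; rewrite addrC expRD expRM_natl lnK.
rewrite !E // ler_expR.
have := @ln_le_subr1 R (t / K); rewrite divr_gt0 // => /(_ isT).
rewrite ln_div ?posrE // => h.
have : K * (ln t - ln K) <= K * (t / K - 1) by rewrite ler_pM2l.
by rewrite mulrBr mulrBr mulr1 mulrCA mulfV ?gt_eqF // mulr1; lra.
Qed.

Lemma Egam_lip k s t : 0 <= s -> s <= t ->
  0 <= expR (- s) * exp_trunc k.+1 s - expR (- t) * exp_trunc k.+1 t <= gam_max k * (t - s).
Proof.
move=> s0 st; set F := fun x => expR (- x) * exp_trunc k.+1 x.
have dF (x : R) : is_derive x 1 F (- gam k x) by exact: deriv_Egam.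
have dG1 (x : R) : s <= x <= t -> is_derive x 1 (fun x => - F x) (gam k x).
  by move=> _; apply: (is_derive_eq (is_deriveN (dF x))); rewrite opprK.
have dG2 (x : R) : s <= x <= t -> is_derive x 1 (fun x => F x + gam_max k * x) (- gam k x + gam_max k * 1).
  by move=> _; exact: deriv_add (dF x) (deriv_scale (deriv_id x) _).
have p1 x : s <= x <= t -> 0 <= gam k x.
  by move=> /andP[? _]; apply: gam_ge0; lra.
have p2 x : s <= x <= t -> 0 <= - gam k x + gam_max k * 1.
  by move=> /andP[? _]; rewrite mulr1 addrC subr_ge0 gam_le_max //; lra.
have := le_of_derive_ge0 st dG1 p1; have := le_of_derive_ge0 st dG2 p2.
rewrite -/(F s) -/(F t); move: (F s) (F t) (gam_max k) => a c m h1 h2.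
by rewrite mulrBr; apply/andP; split; lra.
Qed.

Lemma Gtail_lip k s t : s <= t ->
  0 <= Gtail k.+1 s - Gtail k.+1 t <= gam_max k * (t - s).
Proof.
move=> st; have m0 : 0 <= gam_max k by apply: gam_ge0.
have E0 : expR (- 0) * exp_trunc k.+1 0 = 1 :> R by rewrite exp_trunc0 oppr0 expR0 mulr1.
rewrite /Gtail; have [s0|s0] := leP s 0; have [t0|t0] := leP t 0; last 2 first.
- lra.
- by apply: Egam_lip => //; exact: ltW.
- by rewrite subrr lexx /=; apply: mulr_ge0 => //; rewrite subr_ge0.
have := @Egam_lip k 0 t (lexx 0) (ltW t0); rewrite E0 => /andP[-> h] /=.
by apply: (le_trans h); rewrite ler_wpM2l //; lra.
Qed.

Lemma Gtail_itv k t : 0 <= Gtail k t <= 1.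
Proof.
case: k => [|k].
  by rewrite /Gtail; case: ifP => _; rewrite ?ler01 ?lexx // /exp_trunc big_geq // mulr0 lexx ler01.
apply/andP; split.
  by rewrite /Gtail; case: (leP t 0) => // t0; rewrite mulr_ge0 ?expR_ge0 // exp_trunc_ge0 // ltW.
have [t0|t0] := leP t 0; first by rewrite /Gtail t0.
by have := Gtail_lip k (ltW t0); rewrite {1}/Gtail lexx subr_ge0 => /andP[].
Qed.

Lemma Gtail_le k s t : s <= t -> Gtail k t <= Gtail k s.
Proof.
case: k => [|k] st; last by rewrite -subr_ge0; have /andP[] := Gtail_lip k st.
rewrite /Gtail /exp_trunc !big_geq // !mulr0.
by case: (leP t 0); case: (leP s 0) => //; lra.
Qed.

Lemma Gtail_lip_norm k s t : `|Gtail k.+1 s - Gtail k.+1 t| <= gam_max k * `|s - t|.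
Proof.
wlog st : s t / s <= t.
  move=> H; have [/H//|/ltW /H] := leP s t.
  by rewrite distrC [`|t - s|]distrC.
have /andP[h1 h2] := Gtail_lip k st.
by rewrite ger0_norm // distrC ger0_norm ?subr_ge0.
Qed.

(** For v > 0 and k at least 2 its derivative is the preceding Gamma tail at ln v. If E is
    exponential then exp(-E) is uniform on (0, 1), so adding E to a sum averages its tail at ln u
    over u in (0, v); [Wtail] is the integral of that average. *)
Definition Wtail k v : R := v * Gtail k (ln v).

Lemma Wtail_le1 k v : v <= 1 -> Wtail k v = v.
Proof. by move=> v1; rewrite /Wtail /Gtail ln_le0 // mulr1. Qed.

Lemma Wtail_ge1 k v : 1 <= v -> Wtail k.+1 v = exp_trunc k.+1 (ln v).
Proof.
move=> v1; have v0 : 0 < v by lra.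
rewrite /Wtail /Gtail; have l0 := ln_ge0 v1.
case: (leP (ln v) 0) => l.
  have -> : ln v = 0 by apply/eqP; rewrite eq_le l l0.
  have /eqP : ln v = 0 by apply/eqP; rewrite eq_le l l0.
  by rewrite exp_trunc0 ln_eq0 // => /eqP ->; rewrite mulr1.
by rewrite expRN lnK ?posrE // mulrA mulfV ?gt_eqF // mul1r.
Qed.

(** The slope at a point z is the Gamma tail at ln z, which decreases. The closed forms of [Wtail]
    differ below and above 1, so an interval containing 1 is cut there. *)
Lemma Wtail_slope k u v : 0 < u -> u <= v ->
  (v - u) * Gtail k.+1 (ln v) <= Wtail k.+2 v - Wtail k.+2 u <=
    (v - u) * Gtail k.+1 (ln u).
Proof.
have le1 x y : x <= y -> y <= 1 ->
  (y - x) * Gtail k.+1 (ln y) <= Wtail k.+2 y - Wtail k.+2 x <=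
    (y - x) * Gtail k.+1 (ln x).
  move=> xy y1; have x1 : x <= 1 by lra.
  by rewrite !Wtail_le1 // /Gtail !ln_le0 // mulr1 lexx.
have ge1 x y : 1 <= x -> x <= y ->
  (y - x) * Gtail k.+1 (ln y) <= Wtail k.+2 y - Wtail k.+2 x <=
    (y - x) * Gtail k.+1 (ln x).
  move=> x1 xy; have x0 : 0 < x by lra.
  have y1 : 1 <= y by lra.
  rewrite !Wtail_ge1 //.
  pose q z := exp_trunc k.+1 (ln z) * (1 / z).
  have Gq z : 1 <= z -> Gtail k.+1 (ln z) = q z.
    move=> z1; have z0 : 0 < z by lra.
    rewrite /q -Wtail_ge1 // /Wtail; field; exact: lt0r_neq0.
  have dE (z : R) : 0 < z -> is_derive z 1 (fun z => exp_trunc k.+2 (ln z)) (q z).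
    by move=> z0; exact: (is_derive1_comp (deriv_exp_trunc _ (ln z)) (deriv_ln (deriv_id z) z0)).
  have dE1 (z : R) : x <= z <= y -> is_derive z 1
      (fun z => exp_trunc k.+2 (ln z) - Gtail k.+1 (ln y) * z) (q z - Gtail k.+1 (ln y) * 1).
    move=> /andP[? _]; have z0 : 0 < z by lra.
    exact: deriv_sub (dE z z0) (deriv_scale (deriv_id z) _).
  have dE2 (z : R) : x <= z <= y -> is_derive z 1
      (fun z => Gtail k.+1 (ln x) * z - exp_trunc k.+2 (ln z)) (Gtail k.+1 (ln x) * 1 - q z).
    move=> /andP[? _]; have z0 : 0 < z by lra.
    exact: deriv_sub (deriv_scale (deriv_id z) _) (dE z z0).
  have p1 z : x <= z <= y -> 0 <= q z - Gtail k.+1 (ln y) * 1.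
    move=> /andP[z1 z2]; rewrite -Gq ?mulr1 ?subr_ge0; last lra.
    by apply: Gtail_le; rewrite ler_ln ?posrE; lra.
  have p2 z : x <= z <= y -> 0 <= Gtail k.+1 (ln x) * 1 - q z.
    move=> /andP[z1 z2]; rewrite -Gq ?mulr1 ?subr_ge0; last lra.
    by apply: Gtail_le; rewrite ler_ln ?posrE; lra.
  have := le_of_derive_ge0 xy dE1 p1; have := le_of_derive_ge0 xy dE2 p2.
  move: (exp_trunc _ _) (exp_trunc _ _) (Gtail _ _) (Gtail _ _) => a1 a2 a3 a4 h1 h2.
  by rewrite !mulrBl; apply/andP; split; lra.
move=> u0 uv; have [v1|v1] := leP v 1; first exact: le1.
have [u1|u1] := leP 1 u; first exact: ge1.
have /andP[h1 h2] := le1 u 1 (ltW u1) (lexx 1).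
have /andP[h3 h4] := ge1 1 v (lexx 1) (ltW v1).
have G1 : Gtail k.+1 (ln 1) = 1 by rewrite /Gtail ln1 lexx.
have G2 : Gtail k.+1 (ln u) = 1 by rewrite /Gtail ln_le0 // ltW.
have /andP[_ G3] := Gtail_itv k.+1 (ln v).
rewrite G1 in h1 h4; rewrite G2 in h2 *.
have h5 : (1 - u) * Gtail k.+1 (ln v) <= 1 - u.
  by rewrite -[leRHS]mulr1 ler_wpM2l //; lra.
have -> : (v - u) * Gtail k.+1 (ln v) = (v - 1) * Gtail k.+1 (ln v) + (1 - u) * Gtail k.+1 (ln v) by ring.
move: (_ * Gtail _ _) (_ * Gtail _ _) h3 h5 => b1 b2 h3 h5.
by apply/andP; split; lra.
Qed.

End GammaTail.

(** * Convergence of rescaled Gamma densities to the Gaussian density *)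

Section GammaCLT.
Variable R : realType.
Implicit Types (s t u a : R) (n k : nat).
Notation mu := (@lebesgue_measure R).

Definition gauss u : R := expR (- (u ^+ 2) / 2).

Definition gden n u : R := Num.sqrt n%:R * gam n (n%:R + u * Num.sqrt n%:R).

Definition gpeak n : R := Num.sqrt n%:R * gam_max R n.

(** Height 1 at u = 0: dividing by the peak cancels the factorial and leaves an explicit
    exponential. The cut at -sqrt n is the left end of the support of the Gamma law. *)
Definition gshape n : R -> R :=
  (fun u => gden n u / gpeak n) \_ `[- Num.sqrt n%:R, +oo[.

Lemma gam_gt0 n t : 0 < t -> 0 < gam n t.
Proof.
by move=> t0; rewrite mulr_gt0 ?expR_gt0 // divr_gt0 ?exprn_gt0 // ltr0n fact_gt0.
Qed.

Lemma gpeak_gt0 n : 0 < gpeak n.+1.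
Proof. by rewrite mulr_gt0 ?sqrtr_gt0 // gam_gt0. Qed.

Lemma gshapeE n u : - Num.sqrt n.+1%:R < u ->
  gshape n.+1 u = expR (- (n.+1%:R * (u / Num.sqrt n.+1%:R - ln (1 + u / Num.sqrt n.+1%:R)))).
Proof.
set r := Num.sqrt _ => ur; have r0 : 0 < r by rewrite sqrtr_gt0.
have rr : r ^+ 2 = n.+1%:R by rewrite sqr_sqrtr.
rewrite /gshape patchE mem_set /=; last by rewrite in_itv /= andbT ltW.
rewrite /gden /gpeak -/r; set N : R := n.+1%:R in rr *.
have N0 : 0 < N by rewrite ltr0n.
rewrite -mulf_div mulfV ?gt_eqF // mul1r.
set x := u / r; have x1 : 0 < 1 + x.
  by rewrite addrC -(@ltr_pM2r _ r) // mul0r mulrDl mul1r /x divfK ?gt_eqF //; lra.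
have -> : N + u * r = N * (1 + x).
  by rewrite -rr /x; field; rewrite gt_eqF.
rewrite /gam_max /gam -/N exprMn.
have f0 : n.+1`!%:R != 0 :> R by rewrite pnatr_eq0 -lt0n fact_gt0.
have e0 : expR (- N) != 0 by rewrite gt_eqF // expR_gt0.
have -> : - (N * (x - ln (1 + x))) = - (N * (1 + x)) + N + N * ln (1 + x) by ring.
rewrite expRD expRM_natl lnK ?posrE // expRD -[expR N]invrK -expRN.
have p0 : N ^+ n.+1 != 0 by rewrite expf_neq0 // gt_eqF.
by field; rewrite f0 e0 p0.
Qed.

Lemma gshape_ge0 n u : 0 <= gshape n.+1 u.
Proof.
rewrite /gshape patchE; case: ifPn => // /set_mem; rewrite /= in_itv /= andbT => h.
apply: divr_ge0; last exact/ltW/gpeak_gt0.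
apply: mulr_ge0 => //; apply: gam_ge0.
move: h; set r := Num.sqrt _ => h; have r0 : 0 <= r by exact: sqrtr_ge0.
have -> : n.+1%:R = r ^+ 2 by rewrite /r sqr_sqrtr.
by rewrite expr2 -mulrDl mulr_ge0 //; lra.
Qed.

(** With w = |u| and r = sqrt(n+1) at least 1, [subr_ln_ge] bounds the exponent by -w^2/(2(1+w/r)),
    and w^2/(2(1+w/r)) is at least w^2/(2(1+w)), hence at least (w-1)/2. *)
Lemma gshape_le n u : gshape n.+1 u <= expR ((1 - `|u|) / 2).
Proof.
have r1 : 1 <= Num.sqrt n.+1%:R :> R by rewrite -[X in X <= _]sqrtr1 ler_sqrt // ler1n.
have [ur|ur] := ltP (- Num.sqrt n.+1%:R) u; last first.
  rewrite /gshape patchE; case: ifPn => [/set_mem|_]; last exact: expR_ge0.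
  rewrite /= in_itv /= andbT => h.
  have -> : u = - Num.sqrt n.+1%:R by lra.
  rewrite /gden mulNr -expr2 sqr_sqrtr // subrr /gam expr0n /= !mul0r.
  by rewrite !mulr0 mul0r expR_ge0.
rewrite gshapeE // ler_expR; move: ur r1; set r := Num.sqrt _ => ur r1.
have rr : r ^+ 2 = n.+1%:R by rewrite sqr_sqrtr.
have r0 : 0 < r by lra.
have := @subr_ln_ge R (u / r); rewrite ltr_pdivlMr // mulN1r => /(_ ur) h.
suff : (`|u| - 1) / 2 <= n.+1%:R * ((u / r) ^+ 2 / (2 * (1 + `|u / r|))).
  move=> h1; have : n.+1%:R * ((u / r) ^+ 2 / (2 * (1 + `|u / r|))) <=
     n.+1%:R * (u / r - ln (1 + u / r)) by rewrite ler_wpM2l.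
  move: (_ * (_ - ln _)) (_ * (_ / _)) h1 => b1 b2; lra.
rewrite -rr mulrA -exprMn (mulrC r) divfK ?gt_eqF //.
rewrite normrM normfV (gtr0_norm r0).
rewrite -[u ^+ 2]real_normK ?num_real //; move: (normr_ge0 u); set w := `|u| => w0.
have q1 : w / r <= w by rewrite ler_pdivrMr // ler_peMr.
have q0 : 0 <= w / r by rewrite divr_ge0 // ltW.
apply: (@le_trans _ _ (w ^+ 2 / (2 * (1 + w)))).
  by rewrite ler_pdivlMr ?expr2; nra.
by rewrite ler_wpM2l ?sqr_ge0 // lef_pV2 ?posrE; lra.
Qed.

Lemma gshape_cvg u : gshape n.+1 u @[n --> \oo] --> gauss u.
Proof.
have sqy : Num.sqrt n.+1%:R @[n --> \oo] --> (+oo : set_system R).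
  apply/cvgryPge => A; exists (Num.truncn (A ^+ 2)).+1 => // k /= Ak.
  rewrite (le_trans (ler_norm A)) // -sqrtr_sqr ler_sqrt //.
  by rewrite (le_trans (ltW (truncnS_gt _))) // ler_nat ltnW.
have iv : (Num.sqrt n.+1%:R)^-1 @[n --> \oo] --> (0 : R).
  apply/gtr0_cvgV0; last exact: sqy.
    by apply: nearW => k; rewrite sqrtr_gt0.
(* By [gshapeE] this is the exponent for large n; the cubic error of [psi] contributes at most
   2|u|^3/sqrt(n+1). *)
pose e n : R := - (n.+1%:R * psi (- (u / Num.sqrt n.+1%:R))).
have ce : e n @[n --> \oo] --> (- (u ^+ 2) / 2).
  have cb : 2 * `|u| ^+ 3 * (Num.sqrt n.+1%:R)^-1 @[n --> \oo] --> (0 : R).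
    by rewrite -[X in _ --> X](mulr0 (2 * `|u| ^+ 3)); apply: cvgMl_tmp.
  apply/cvgrPdist_le => eps eps0.
  have h1 : \forall x \near \oo, 2 * `|u| + 1 <= Num.sqrt x.+1%:R by move/cvgryPge : sqy; apply.
  move/cvgrPdist_le: cb => /(_ _ eps0) h2.
  near=> n.
  have l1 : 2 * `|u| + 1 <= Num.sqrt n.+1%:R by near: n.
  have : `|0 - 2 * `|u| ^+ 3 * (Num.sqrt n.+1%:R)^-1| <= eps by near: n.
  rewrite /e; move: l1; set r := Num.sqrt _ => l1.
  have rr : n.+1%:R = r ^+ 2 by rewrite /r sqr_sqrtr.
  have r0 : 0 < r by have := normr_ge0 u; lra.
  rewrite sub0r normrN ger0_norm; last by rewrite !mulr_ge0 // ?exprn_ge0 // invr_ge0 ltW.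
  move=> l2; apply: le_trans l2; rewrite rr.
  have := @psi_cubic R (- (u / r)); rewrite normrN normrM normfV (gtr0_norm r0) sqrrN.
  rewrite ler_pdivrMr // => /(_ ltac:(lra)).
  move=> l3; rewrite opprK.
  have -> : - u ^+ 2 / 2 + r ^+ 2 * psi (- (u / r)) = r ^+ 2 * (psi (- (u / r)) - (u / r) ^+ 2 / 2).
    by field; rewrite gt_eqF.
  rewrite normrM (ger0_norm (sqr_ge0 _)).
  have -> : 2 * `|u| ^+ 3 / r = r ^+ 2 * (2 * (`|u| / r) ^+ 3) by field; rewrite gt_eqF.
  by rewrite ler_wpM2l ?sqr_ge0.
apply: (@cvg_trans _ ((fun n => expR (e n)) @ \oo)); last first.
  by apply: (cvg_comp _ expR ce); exact: continuous_expR.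
apply: near_eq_cvg.
move/cvgryPge : sqy => /(_ (`|u| + 1)); apply: filterS => n h.
rewrite gshapeE; last first.
  have := ler_norm (- u); rewrite normrN; lra.
by rewrite /e /psi opprK; congr (expR (- (_ * _))); ring.
Unshelve. all: by end_near.
Qed.

(** A crude decay rate, enough to make the antiderivative of the density vanish at infinity. *)
Lemma Egam_le k s : 0 < s -> expR (- s) * exp_trunc k s <= k%:R * k%:R / s.
Proof.
move=> s0; have term j : (j < k)%N -> s ^+ j / j`!%:R <= expR s * (k%:R / s).
  move=> jk; have := @expR_ge1Dxn R s j (ltW s0); rewrite factS natrM => h.
  have j0 : 0 < j.+1%:R :> R by [].
  have f0 : 0 < j`!%:R :> R by rewrite ltr0n fact_gt0.
  have h2 : s ^+ j.+1 / (j.+1%:R * j`!%:R) <= expR s by apply: le_trans h; rewrite lerDr.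
  have -> : s ^+ j / j`!%:R = s ^+ j.+1 / (j.+1%:R * j`!%:R) * (j.+1%:R / s).
    by rewrite exprS; field; rewrite !gt_eqF.
  apply: ler_pM => //.
  - by rewrite divr_ge0 ?exprn_ge0 ?ltW // mulr_gt0.
  - by rewrite divr_ge0 ?ltW.
  - by rewrite ler_pM2r ?invr_gt0 // ler_nat.
have : exp_trunc k s <= \sum_(0 <= j < k) expR s * (k%:R / s).
  by rewrite /exp_trunc !big_nat; apply: ler_sum => j /andP[_ jk]; exact: term.
rewrite sumr_const_nat subn0 -mulr_natl => h.
rewrite expRN mulrC ler_pdivrMr ?expR_gt0 //; apply: (le_trans h).
by rewrite le_eqVlt; apply/orP; left; apply/eqP; ring.
Qed.

Lemma is_derive_cvg (f : R -> R) (x d : R) : is_derive x 1 f d -> {for x, continuous f}.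
Proof. by move=> [df _]; exact/differentiable_continuous/derivable1_diffP. Qed.

Lemma deriv_gam k t : exists d, is_derive t 1 (@gam R k.+1) d.
Proof.
eexists; apply: (deriv_mul (deriv_expN t) _).
by have := deriv_scale (deriv_pow k t) (k.+1)`!%:R^-1; under eq_fun do rewrite mulrC.
Qed.

Lemma deriv_shift n a : is_derive a 1 (fun u => n%:R + u * Num.sqrt n%:R) (Num.sqrt n%:R).
Proof.
apply: (is_derive_eq (deriv_add (deriv_cst a n%:R) (deriv_mul (deriv_id a) (deriv_cst a (Num.sqrt n%:R))))).
by rewrite mul1r mulr0 addr0 add0r.
Qed.

Lemma gden_continuous n : continuous (gden n.+1).
Proof.
move=> a; have [d dg] := deriv_gam n (n.+1%:R + a * Num.sqrt n.+1%:R).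
have H := deriv_scale (@is_derive1_comp R _ (fun u => n.+1%:R + u * Num.sqrt n.+1%:R) a _ _ dg (deriv_shift _ a)) (Num.sqrt n.+1%:R).
exact: (is_derive_cvg H).
Qed.

Let F n u : R := - (expR (- (n%:R + u * Num.sqrt n%:R)) * exp_trunc n.+1 (n%:R + u * Num.sqrt n%:R)).

Let deriv_F n a : is_derive a 1 (F n) (gden n a).
Proof.
have dE := deriv_Egam n (n%:R + a * Num.sqrt n%:R).
have dc := @is_derive1_comp R _ (fun u => n%:R + u * Num.sqrt n%:R) a _ _ dE (deriv_shift _ a).
apply: (is_derive_eq (is_deriveN dc)).
by rewrite /gden mulNr opprK mulrC.
Qed.

Let F_cvg n : F n.+1 x @[x --> +oo] --> (0 : R).
Proof.
apply/cvgrPdist_le => eps eps0; rewrite /F.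
set r : R := Num.sqrt n.+1%:R; set K : R := n.+2%:R * n.+2%:R.
have r1 : 1 <= r by rewrite -[X in X <= _]sqrtr1 ler_sqrt // ler1n.
have K0 : 0 < K by rewrite mulr_gt0.
near=> x.
have x1 : K / eps <= x by near: x; apply: nbhs_pinfty_ge; exact: num_real.
have x0 : 0 < x by apply: lt_le_trans x1; rewrite divr_gt0.
have s0 : 0 < n.+1%:R + x * r by apply: ltr_pwDl => //; apply: mulr_ge0; lra.
rewrite sub0r opprK ger0_norm; last by rewrite mulr_ge0 ?expR_ge0 // exp_trunc_ge0 // ltW.
apply: (le_trans (Egam_le n.+2 s0)); rewrite -/K ler_pdivrMr // mulrC.
rewrite -ler_pdivrMr //; apply: (le_trans x1).
apply: ler_wpDl => //; rewrite -[leLHS]mulr1; apply: ler_wpM2l => //.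
Unshelve. all: by end_near. Qed.

Lemma integral_gden n a : - Num.sqrt n.+1%:R <= a ->
  (\int[mu]_(u in `[a, +oo[) (gden n.+1 u)%:E =
    (Gtail n.+2 (n.+1%:R + a * Num.sqrt n.+1%:R))%:E)%E.
Proof.
set r := Num.sqrt _ => ar; have r0 : 0 <= r by exact: sqrtr_ge0.
have sE u : n.+1%:R + u * r = (r + u) * r.
  by rewrite mulrDl -expr2 sqr_sqrtr.
have s0 u : a <= u -> 0 <= n.+1%:R + u * r.
  by move=> au; rewrite sE mulr_ge0 //; lra.
rewrite (@ge0_continuous_FTC2y R (gden n.+1) (F n.+1) a 0).
- rewrite -EFinB; congr (_%:E); rewrite /F sub0r opprK -/r /Gtail.
  case: (leP (_ + _) 0) => // h.
  have -> : n.+1%:R + a * r = 0 by apply/eqP; rewrite eq_le h s0.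
  by rewrite oppr0 expR0 mul1r exp_trunc0.
- by move=> x ax; rewrite mulr_ge0 // gam_ge0 // s0.
- by apply: continuous_subspaceT; exact: gden_continuous.
- exact: F_cvg.
- by move=> x _; have [] := deriv_F n.+1 x.
- by apply: cvg_at_right_filter; apply: is_derive_cvg (deriv_F n.+1 a).
- by move=> x _; rewrite derive1E; apply: derive_val; exact: deriv_F.
Qed.

Lemma integral_gshape n a : - Num.sqrt n.+1%:R <= a ->
  (\int[mu]_(u in `[a, +oo[) (gshape n.+1 u)%:E =
    (Gtail n.+2 (n.+1%:R + a * Num.sqrt n.+1%:R) / gpeak n.+1)%:E)%E.
Proof.
move=> ha; rewrite mulrC EFinM -integral_gden // -ge0_integralZl_EFin //.
- apply: eq_integral => u; rewrite inE /= in_itv /= andbT => au.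
  by rewrite /gshape patchE mem_set /= ?in_itv /= ?andbT ?(le_trans ha) // mulrC.
- move=> u /=; rewrite in_itv /= andbT => au; rewrite lee_fin.
  apply: mulr_ge0 => //; apply: gam_ge0.
  have -> : n.+1%:R + u * Num.sqrt n.+1%:R = (Num.sqrt n.+1%:R + u) * Num.sqrt n.+1%:R :> R.
    by rewrite mulrDl -expr2 sqr_sqrtr.
  by apply: mulr_ge0; [lra|exact: sqrtr_ge0].
- apply/measurable_EFinP; apply: measurable_funTS.
  by apply: continuous_measurable_fun; exact: gden_continuous.
- by rewrite invr_ge0 ltW // gpeak_gt0.
Qed.

Lemma integral_gshapeT n : (\int[mu]_u (gshape n.+1 u)%:E = (gpeak n.+1)^-1%:E)%E.
Proof.
have r0 : 0 <= Num.sqrt n.+1%:R :> R by exact: sqrtr_ge0.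
transitivity (\int[mu]_(u in `[(- Num.sqrt n.+1%:R)%R, +oo[) (gshape n.+1 u)%:E)%E.
  rewrite [RHS]integral_mkcond; apply: eq_integral => u _.
  rewrite [RHS]patchE; case: ifPn => // h; rewrite /gshape patchE.
  by rewrite (negbTE h).
rewrite integral_gshape // mulNr -expr2 sqr_sqrtr // subrr.
by rewrite /Gtail lexx mul1r.
Qed.

Lemma gauss_ge0 u : 0 <= gauss u. Proof. exact: expR_ge0. Qed.

Lemma gauss_continuous : continuous gauss.
Proof.
move=> u; have := deriv_scale (deriv_mul (deriv_id u) (deriv_id u)) (- 2^-1).
move/deriv_exp/is_derive_cvg; congr continuous_at.
by apply/funext => x; rewrite /gauss expr2; congr expR; ring.
Qed.

Lemma measurable_gauss : measurable_fun setT gauss.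
Proof. exact: continuous_measurable_fun gauss_continuous. Qed.

Lemma measurable_gshape n : measurable_fun setT (gshape n.+1).
Proof.
apply/(measurable_restrictT _ _).1 => //; apply: measurable_funTS.
apply: continuous_measurable_fun => u; apply: cvgMr_tmp.
exact: gden_continuous.
Qed.

Lemma integral_gaussT : (\int[mu]_u (gauss u)%:E = (Num.sqrt (2 * pi))%:E)%E.
Proof.
have := @integral_normal_pdf R 0 1; rewrite normal_pdfE ?oner_eq0 //.
set c := normal_peak 1.
have cE : c = (Num.sqrt (2 * pi))^-1.
  by rewrite /c /normal_peak expr1n mul1r mulr_natl.
have s0 : Num.sqrt (2 * pi) != 0 :> R by rewrite gt_eqF // sqrtr_gt0 mulr_gt0 ?pi_gt0.
have -> : (\int[mu]_x (c * normal_fun 0 1 x)%:E = c%:E * \int[mu]_u (gauss u)%:E)%E.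
  rewrite -ge0_integralZl_EFin //.
  - apply: eq_integral => x _; rewrite -EFinM; congr (_ * _)%:E.
    by rewrite /normal_fun /gauss subr0 expr1n.
  - by move=> x _; rewrite lee_fin gauss_ge0.
  - by apply/measurable_EFinP; exact: measurable_gauss.
  - by rewrite cE invr_ge0 sqrtr_ge0.
move=> h; have : ((Num.sqrt (2 * pi))%:E * (c%:E * \int[mu]_u (gauss u)%:E) = (Num.sqrt (2 * pi))%:E * 1)%E by rewrite h.
by rewrite mule1 muleA -EFinM cE mulfV // mul1e.
Qed.

Let dom u : R := expR ((1 - `|u|) / 2).

Lemma integrable_dom : mu.-integrable setT (EFin \o dom).
Proof.
have cd : continuous dom.
  move=> x; apply: (cvg_comp (fun u : R => (1 - `|u|) / 2) expR); last exact: continuous_expR.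
  by apply: cvgMr_tmp; apply: cvgB; [exact: cvg_cst|exact: norm_continuous].
have md : measurable_fun setT dom by exact: continuous_measurable_fun.
apply/integrableP; split; first exact/measurable_EFinP.
have -> : (\int[mu]_x `|(EFin \o dom) x| = \int[mu]_x (dom x)%:E)%E.
  by apply: eq_integral => x _; rewrite /= ger0_norm // expR_ge0.
rewrite ge0_symfun_integralT //; last 2 first.
- by move=> x; exact: expR_ge0.
- by move=> x; rewrite /dom /= normrN.
rewrite lte_mul_pinfty // -set_itvcy.
pose G u : R := - 2 * expR ((1 - u) / 2).
have dG (u : R) : is_derive u 1 G (expR ((1 - u) / 2)).
  have d1 := deriv_mul (deriv_sub (deriv_cst u 1) (deriv_id u)) (deriv_cst u 2^-1).
  by apply: (is_derive_eq (deriv_scale (deriv_exp d1) (- 2))); field.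
have -> : (\int[mu]_(x in `[0%R, +oo[) (dom x)%:E =
    \int[mu]_(x in `[0%R, +oo[) (expR ((1 - x) / 2))%:E)%E.
  apply: eq_integral => x; rewrite inE /= in_itv /= andbT => x0.
  by rewrite /dom ger0_norm.
suff -> : (\int[mu]_(x in `[0%R, +oo[) (expR ((1 - x) / 2))%:E = 0%:E - (G 0)%:E)%E.
  by rewrite -EFinB ltry.
apply: ge0_continuous_FTC2y.
- by move=> x _; exact: expR_ge0.
- apply: derivable_within_continuous => x _.
  have d1 := deriv_mul (deriv_sub (deriv_cst x 1) (deriv_id x)) (deriv_cst x 2^-1).
  by have [] := deriv_exp d1.
- rewrite -[X in _ --> X](mulr0 (- 2)); apply: cvgMl_tmp.
  have -> : (fun x : R => expR ((1 - x) / 2)) = (fun u => expR (- u)) \o (fun u : R => (u - 1) / 2).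
    by apply/funext => x /=; congr expR; ring.
  apply: cvg_comp (@cvgr_expR R); apply/cvgryPge => A; near=> x.
  have : 2 * A + 1 <= x by near: x; apply: nbhs_pinfty_ge; exact: num_real.
  by rewrite ler_pdivlMr //; lra.
- by move=> x _; have [] := dG x.
- by apply: cvg_at_right_filter; exact: is_derive_cvg (dG 0).
- by move=> x _; rewrite derive1E; apply: derive_val; exact: dG.
Unshelve. all: by end_near. Qed.

Lemma gshape_dct (D : set R) : measurable D ->
  (\int[mu]_(u in D) (gshape n.+1 u)%:E @[n --> \oo] --> \int[mu]_(u in D) (gauss u)%:E)%E.
Proof.
move=> mD.
have [//|||||_ _] := @dominated_convergence _ _ R mu D mD
  (fun n u => (gshape n.+1 u)%:E) (fun u => (gauss u)%:E) (EFin \o dom).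
- by move=> n; apply/measurable_EFinP; apply: measurable_funTS; exact: measurable_gshape.
- by apply/measurable_EFinP; apply: measurable_funTS; exact: measurable_gauss.
- by apply: aeW => u _; apply: cvg_EFin; [exact: nearW|exact: gshape_cvg].
- by apply: integrableS integrable_dom.
- apply: aeW => u n _; rewrite /= lee_fin ger0_norm ?gshape_ge0 //.
  exact: gshape_le.
- by [].
Qed.


(** This is Stirling's formula, obtained by comparing total masses: [gshape] integrates to the
    inverse of [gpeak], and its limit integrates to sqrt(2 pi). *)
Lemma gpeak_cvg : gpeak n.+1 @[n --> \oo] --> (Num.sqrt (2 * pi))^-1.
Proof.
have s0 : Num.sqrt (2 * pi) != 0 :> R by rewrite gt_eqF // sqrtr_gt0 mulr_gt0 ?pi_gt0.
have := gshape_dct measurableT; rewrite integral_gaussT.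
under eq_cvg do rewrite integral_gshapeT.
move=> /fine_cvgP[_] /(cvgV s0); apply: cvg_trans.
by apply: near_eq_cvg; apply: nearW => n /=; rewrite invrK.
Qed.

Lemma sqrtn_cvgV : (Num.sqrt n.+1%:R)^-1 @[n --> \oo] --> (0 : R).
Proof.
apply/gtr0_cvgV0; first by apply: nearW => k; rewrite sqrtr_gt0.
apply/cvgryPge => A; exists (Num.truncn (A ^+ 2)).+1 => // k /= Ak.
rewrite (le_trans (ler_norm A)) // -sqrtr_sqr ler_sqrt //.
by rewrite (le_trans (ltW (truncnS_gt _))) // ler_nat ltnW.
Qed.

Lemma gam_max_cvg : gam_max R n @[n --> \oo] --> (0 : R).
Proof.
rewrite -cvg_shiftS /=.
have -> : (fun n => gam_max R n.+1) = (fun n => gpeak n.+1 * (Num.sqrt n.+1%:R)^-1).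
  by apply/funext => n; rewrite /gpeak mulrC mulKf // gt_eqF // sqrtr_gt0.
by have H := cvgM gpeak_cvg sqrtn_cvgV; rewrite mulr0 in H; exact: H.
Qed.

Definition gauss_tail t : R :=
  (Num.sqrt (2 * pi))^-1 * fine (\int[mu]_(u in `[t, +oo[) (gauss u)%:E)%E.

Lemma integrable_gauss (D : set R) : measurable D ->
  (\int[mu]_(u in D) (gauss u)%:E \is a fin_num)%E.
Proof.
move=> mD; rewrite ge0_fin_numE; last first.
  by apply: integral_ge0 => u _; rewrite lee_fin gauss_ge0.
apply: (@le_lt_trans _ _ (\int[mu]_u (gauss u)%:E)%E); last by rewrite integral_gaussT ltry.
apply: ge0_subset_integral => //.
- by apply/measurable_EFinP; exact: measurable_gauss.
- by move=> u _; rewrite lee_fin gauss_ge0.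
Qed.

Lemma Gtail_cvg t :
  Gtail n.+2 (n.+1%:R + t * Num.sqrt n.+1%:R) @[n --> \oo] --> gauss_tail t.
Proof.
have f2 := integrable_gauss (measurable_itv `[t, +oo[).
have h := gshape_dct (measurable_itv `[t, +oo[).
rewrite -(fineK f2) in h; have {}h := fine_cvg h.
apply: cvg_trans (cvgM gpeak_cvg (h _)); apply: near_eq_cvg.
exists (Num.truncn (t ^+ 2)).+1 => // n /= tn.
rewrite integral_gshape /=; first by rewrite mulrC divfK // gt_eqF // gpeak_gt0.
rewrite lerNl (le_trans (ler_norm (- t))) // normrN -sqrtr_sqr ler_sqrt //.
by rewrite (le_trans (ltW (truncnS_gt _))) // ler_nat ltnW.
Qed.

Lemma gauss_tailC t : (((Num.sqrt (2 * pi))^-1)%:E *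
  (\int[mu]_(u in `]-oo, t]) (gauss u)%:E))%E = (1 - gauss_tail t)%:E.
Proof.
have s0 : Num.sqrt (2 * pi) != 0 :> R by rewrite gt_eqF // sqrtr_gt0 mulr_gt0 ?pi_gt0.
have mg (D : set R) : measurable_fun D (EFin \o gauss).
  by apply/measurable_EFinP; apply: measurable_funTS; exact: measurable_gauss.
have g0 (D : set R) x : D x -> (0 <= (gauss x)%:E)%E by rewrite lee_fin gauss_ge0.
have E : (\int[mu]_u (gauss u)%:E = \int[mu]_(u in `]-oo, t]) (gauss u)%:E +
   \int[mu]_(u in `[t, +oo[) (gauss u)%:E)%E.
  rewrite -integral_itv_obnd_cbnd //.
  rewrite -ge0_integral_setU //.
  - congr (integral _ _ _); apply/seteqP; split => // x _ /=.
    by rewrite !in_itv /= andbT; case: (leP x t) => ?; [left|right].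
  - exact: mg.
  - by move=> x _; rewrite lee_fin gauss_ge0.
  - apply/disj_set2P; apply/seteqP; split => // x [] /=; rewrite !in_itv /= andbT => h1 h2.
    by move: h1; rewrite leNgt h2.
rewrite integral_gaussT in E.
have f1 := integrable_gauss (measurable_itv `]-oo, t]).
have f2 := integrable_gauss (measurable_itv `[t, +oo[).
rewrite -(fineK f1) -EFinM /gauss_tail; congr (_%:E).
move: E; rewrite -(fineK f1) -(fineK f2) -EFinD => -[e].
by move: s0 e => /=; move: (Num.sqrt _) => c s0 e; rewrite -(mulVf s0) {3}e mulrDr addrK.
Qed.

End GammaCLT.

(** * Central limit theorem *)

Section ChainCLT.
Variable R : realType.
Implicit Types (x y b : R) (n k i j p : nat) (A B : set R).
Notation mu := (@lebesgue_measure R).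

Lemma cvg_scale_harmonic (c : R) : c * harmonic n @[n --> \oo] --> 0.
Proof.
have H := cvgMl_tmp (a := c) (@cvg_harmonic R).
by rewrite mulr0 in H; exact: H.
Qed.

Lemma kern_sum1 i : \sum_(0 <= k < N) kern R i (i + k) @[N --> \oo] --> (1 : R).
Proof.
have -> : (fun N => \sum_(0 <= k < N) kern R i (i + k)) =
    (fun N => \sum_(0 <= k < N) kern R i (i + k) * (fun=> 1) (i + k)%N).
  by apply/funext => N; apply: eq_bigr => l _; rewrite mulr1.
apply: (@kern_sum_telescope R i (fun=> 1) (fun j => (2 * i + 1)%:R / (2 * j + 2)%:R)).
- move=> j ij; rewrite mulr1 /kern gtn_eqF // ltnS ij.
  have -> : (2 * j + 2)%:R = (2 * j.+1)%:R :> R by congr _%:R; lia.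
  rewrite (natrD _ (2 * j.+1) 2) (natrD _ (2 * i) 1) !natrM -[j.+2%:R]natr1.
  have : 1 <= j.+1%:R :> R by rewrite ler1n.
  move: (j.+1%:R : R) => l l1.
  by field; rewrite !gt_eqF //; lra.
- rewrite mulr1 /kern eqxx -[X in X + _]mul1r -mulrDl.
  rewrite (natrD _ (2 * i) 1) (natrD _ (2 * i) 2).
  have : 0 <= (2 * i)%:R :> R by [].
  move: ((2 * i)%:R : R) => l l1.
  by field; rewrite gt_eqF //; lra.
- have -> : (fun j => (2 * i + 1)%:R / (2 * j + 2)%:R) =
      (fun j => (2 * i + 1)%:R / 2 * harmonic j : R).
    apply/funext => j /=; rewrite -mulrA -invfM -natrM; congr (_ * _%:R^-1); lia.
  exact: cvg_scale_harmonic.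
Qed.

(** * One step of the chain acting on a Gamma tail *)

Section Average.
Variables (b : R) (i k : nat).
Hypothesis b0 : 0 < b.

(** Points of state [j] fill the interval from 1/(2j+2) to 1/(2j), cut at 1/(2i+1) when j = i; these
    are its endpoints multiplied by [b]. *)
Let vlo j := b / (2 * j + 2)%:R.
Let vhi j := b / (if j == i then 2 * i + 1 else 2 * j)%:R.

(* Mean of the Gamma tail over the interval on which the chain moves from [i] to [j]. *)
Definition tail_avg j :=
  (Wtail k.+2 (vhi j) - Wtail k.+2 (vlo j)) / (vhi j - vlo j).

(** [kern R i j] is (2i+1)/b times [vhi j - vlo j], and consecutive intervals share an endpoint, so
    the averages recombine exactly; the only error of the approximation comes from replacing an
    average by a point value. *)
Lemma tail_avg_sum :
  \sum_(0 <= l < N) kern R i (i + l) * tail_avg (i + l) @[N --> \oo] -->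
    Gtail k.+2 (ln (b / (2 * i + 1)%:R)).
Proof.
have bn : b != 0 by rewrite gt_eqF.
apply: (@kern_sum_telescope R i _ (fun j => (2 * i + 1)%:R / b * Wtail k.+2 (vlo j))).
- move=> j ij; rewrite -mulrBr /tail_avg.
  have <- : vhi j.+1 = vlo j.
    by rewrite /vhi /vlo gtn_eqF //; congr (_ / _%:R); lia.
  rewrite [RHS]mulrC mulrCA; congr (_ * _).
  rewrite /kern /vhi /vlo gtn_eqF // ltnS ij.
  rewrite (natrD _ (2 * j.+1) 2) (natrD _ (2 * i) 1) !natrM -[j.+2%:R]natr1.
  have : 1 <= j.+1%:R :> R by rewrite ler1n.
  move: (j.+1%:R : R) => l l1.
  have l0 : l != 0 by rewrite gt_eqF //; lra.
  have l2 : l + 1 != 0 by rewrite gt_eqF //; lra.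
  have -> : b / (2 * l) - b / (2 * l + 2) = b / (2 * l * (l + 1)).
    by field; rewrite l0 /= gt_eqF //; lra.
  by field; rewrite l2 l0 bn.
- rewrite /tail_avg /kern eqxx.
  set m : R := (2 * i + 1)%:R.
  have m0 : 0 < m by rewrite ltr0n addn1.
  have m2 : (2 * i + 2)%:R = m + 1 :> R by rewrite /m natr1 addn1 addn2.
  have -> : vhi i = b / m by rewrite /vhi eqxx.
  rewrite /vlo m2.
  have d0 : b / m - b / (m + 1) = b / (m * (m + 1)).
    by field; rewrite !gt_eqF //; lra.
  rewrite d0 {1}/Wtail; move: (Wtail _ _) (Gtail _ _) => w g.
  by field; rewrite bn !gt_eqF //; lra.
- apply: (@squeeze_cvgr _ _ _ _ (fun=> 0) (fun j => (2 * i + 1)%:R * harmonic j)).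
  + apply: nearW => j; have v0 : 0 < vlo j by rewrite divr_gt0 // ltr0n addn2.
    have /andP[g0 g1] := Gtail_itv k.+2 (ln (vlo j)).
    apply/andP; split.
      apply: mulr_ge0; first by rewrite divr_ge0 // ltW.
      by rewrite /Wtail mulr_ge0 // ltW.
    apply: (@le_trans _ _ ((2 * i + 1)%:R / b * vlo j)).
      apply: ler_wpM2l; first by rewrite divr_ge0 // ltW.
      by rewrite /Wtail -[leRHS]mulr1 ler_wpM2l // ltW.
    rewrite -mulrA ler_wpM2l // /vlo mulrA mulVf // mul1r /=.
    by rewrite lef_pV2 ?posrE ?ltr0n ?addn2 // ler_nat; lia.
  + exact: cvg_cst.
  + exact: cvg_scale_harmonic.
Qed.

(** The point b/(2j+1) lies between [vlo j] and [vhi j], each within a factor 1 + 1/(2i+1) of it,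
    and [gam_max R k] is a Lipschitz constant of the tail as a function of the logarithm. *)
Lemma tail_avg_close j : (i <= j)%N ->
  `|tail_avg j - Gtail k.+1 (ln (b / (2 * j + 1)%:R))| <= gam_max R k / (2 * i + 1)%:R.
Proof.
move=> ij; set w := b / (2 * j + 1)%:R.
have m0 : 0 <= gam_max R k by apply: gam_ge0.
have i0 : 0 < (2 * i + 1)%:R :> R by rewrite ltr0n addn1.
set q : nat := if j == i then (2 * i + 1)%N else (2 * j)%N.
have q1 : (0 < q)%N by rewrite /q; case: eqP; lia.
have q2 : (q <= 2 * j + 1)%N by rewrite /q; case: eqP; lia.
have q3 : ((2 * i + 1) * (2 * j + 1 - q) <= q)%N by rewrite /q; case: eqP => ?; nia.
have hE : vhi j = b / q%:R by [].
have lo0 : 0 < vlo j by rewrite divr_gt0 // ltr0n addn2.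
have w0 : 0 < w by rewrite divr_gt0 // ltr0n addn1.
have hi0 : 0 < vhi j by rewrite hE divr_gt0 // ltr0n.
have lw : vlo j <= w by rewrite ler_pM2l // lef_pV2 ?posrE ?ltr0n ?addn1 ?addn2 // ler_nat.
have wh : w <= vhi j by rewrite hE ler_pM2l // lef_pV2 ?posrE ?ltr0n ?addn1 // ler_nat -addn1.
have lh : vlo j < vhi j.
  rewrite hE ltr_pM2l // ltf_pV2 ?posrE ?ltr0n ?addn2 // ltr_nat; lia.
have /andP[s1 s2] := Wtail_slope k lo0 (ltW lh).
have {}s1 : Gtail k.+1 (ln (vhi j)) <= tail_avg j.
  by rewrite ler_pdivlMr ?subr_gt0 // mulrC.
have {}s2 : tail_avg j <= Gtail k.+1 (ln (vlo j)).
  by rewrite ler_pdivrMr ?subr_gt0 // mulrC.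
have lnd (u v : R) : 0 < u -> 0 < v -> ln u - ln v <= u / v - 1.
  by move=> u0 v0; rewrite -ln_div ?posrE // ln_le_subr1 // divr_gt0.
have Gd (u v : R) : 0 < u -> u <= v -> v / u - 1 <= (2 * i + 1)%:R^-1 ->
    Gtail k.+1 (ln u) - Gtail k.+1 (ln v) <= gam_max R k / (2 * i + 1)%:R.
  move=> u0 uv h; have v0 : 0 < v by exact: lt_le_trans uv.
  have /andP[_ h1] := Gtail_lip k (s := ln u) (t := ln v) ltac:(by rewrite ler_ln ?posrE).
  by apply: (le_trans h1); rewrite ler_wpM2l // (le_trans (lnd _ _ v0 u0)).
have rat (u v : R) : 0 < u -> 0 < v -> b / u / (b / v) - 1 = (v - u) / u.
  by move=> u0 v0; field; rewrite !gt_eqF.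
have h1 : Gtail k.+1 (ln w) - Gtail k.+1 (ln (vhi j)) <= gam_max R k / (2 * i + 1)%:R.
  apply: Gd => //; rewrite hE rat; [|by rewrite ltr0n|by rewrite ltr0n addn1].
  rewrite -natrB //.
  rewrite ler_pdivrMr ?ltr0n // -ler_pdivrMl ?invr_gt0 // invrK -natrM.
  by rewrite ler_nat.
have h2 : Gtail k.+1 (ln (vlo j)) - Gtail k.+1 (ln w) <= gam_max R k / (2 * i + 1)%:R.
  apply: Gd => //; rewrite rat; [|by rewrite ltr0n addn1|by rewrite ltr0n addn2].
  rewrite -natrB ?leq_add2l // subnDl mul1r.
  rewrite lef_pV2 ?posrE ?ltr0n ?addn1 //.
  by rewrite ler_nat ltnS leq_mul2l.
by move: h1 h2 s1 s2; clear; rewrite ler_norml => *; apply/andP; split; lra.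
Qed.
End Average.

(** For t = 3/2 the eigenfunction decays like (2i+1)^(-1/2), more slowly than the one-step error.
    The exact order (2i+1)^(-1) would require t = 2, where the product vanishes. *)
Lemma eigen_ge_inv i : (2 * i + 1)%:R^-1 <= expR 16 * eigen (3 / 2 : R) i.
Proof.
have /(eigen_bound i)/andP[h _] : (2^-1 <= (3 / 2 : R) <= 3 / 2) by rewrite lexx andbT; lra.
 rewrite -(ler_pM2l (expR_gt0 16)) mulrA -expRD subrr expR0 mul1r in h.
apply: le_trans h; have m0 : 0 < (2 * i + 1)%:R :> R by rewrite ltr0n addn1.
rewrite -[X in X^-1 <= _]lnK ?posrE // -expRN ler_expR -/(lodd R i).
by have := lodd_ge0 R i; lra.
Qed.

(** 2J is the least even number above [y], and the digit equals 2l exactly when T^n x lies between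
    1/(2l+1) and 1/(2l-1); so the event is an interval for T^n x. *)
Lemma digit_gt n x y (J := (Num.truncn (y / 2)).+1) : irr01 x -> 0 <= y ->
  (y < digit n.+1 x) = ((2 * J - 1)%:R * iter n (@Tmap R) x < 1).
Proof.
move=> Hx y0; have Hz := irr01_iter n Hx; have [/andP[z0 _] _] := Hz.
have hy l : (y < (2 * l)%:R) = (J <= l)%N.
  by rewrite /J natrM -ltr_pdivrMl // mulrC -truncn_lt_nat // divr_ge0.
have key l : digit n.+1 x = (2 * l)%:R -> (2 * l - 1)%:R * iter n (@Tmap R) x < 1 ->
    1 < (2 * l + 1)%:R * iter n (@Tmap R) x -> (y < digit n.+1 x) = ((2 * J - 1)%:R * iter n (@Tmap R) x < 1).
  move=> -> h1 h2; rewrite hy; apply/idP/idP => h.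
    by apply: le_lt_trans h1; rewrite ler_pM2r // ler_nat; lia.
  rewrite leqNgt; apply/negP => lJ; have := lt_trans h h2.
  by rewrite ltr_pM2r // ltr_nat; lia.
have /andP[] := state1P Hz; have := Tmap_branch Hz; cbv zeta.
set j := state1 _ => -[[j0 h1 _ e]|[h1 _ e]] l1 l2.
- apply: (key j) => //; apply: le_lt_trans l1; rewrite ler_pM2r // ler_nat; lia.
- apply: (key j.+1); first by rewrite /digit /= e; congr _%:R; lia.
    by rewrite (_ : (2 * j.+1 - 1 = 2 * j + 1)%N) //; lia.
  by apply: (lt_le_trans l2); rewrite ler_pM2r // ler_nat; lia.
Qed.

(** * Gamma approximation of the digit tails *)

Section TailBound.
Variable y : R.
Hypothesis y0 : 0 <= y.
Let b : R := (2 * (Num.truncn (y / 2)).+1 - 1)%:R.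

(* The error of one step is O(gam_max / (2i+1)); it is absorbed by
   [eigen (3/2) i], whose eigenvalue 2/3 damps earlier errors geometrically. *)
Fixpoint tail_err k : R :=
  if k is k'.+1 then 2 / 3 * tail_err k' + expR 16 * gam_max R k' else 0.

Let b1 : 1 <= b.
Proof. by rewrite ler1n; lia. Qed.

(** No error occurs here: the uniform law gives the probability min(1, (2i+1)/b), which is the tail
    of a single exponential variable. *)
Lemma digit_base p i : 
  cond_lb p i [set x | y < digit p.+1 x] (Gtail 1 (ln (b / (2 * i + 1)%:R))) /\
  cond_lb p i [set x | digit p.+1 x <= y] (1 - Gtail 1 (ln (b / (2 * i + 1)%:R))).
Proof.
have i0 : 0 < (2 * i + 1)%:R :> R by rewrite ltr0n addn1.
have b0 : 0 < b by exact: lt_le_trans ltr01 b1.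
suff H A : unif_on p i A -> measurable (A `&` [set x | y < digit p.+1 x]) /\
    mu (A `&` [set x | y < digit p.+1 x]) = ((Gtail 1 (ln (b / (2 * i + 1)%:R)))%:E * mu A)%E.
  split=> A gA; have [mB eB] := H A gA; first by rewrite eB.
  have mA := unif_on_measurable gA; have fA := unif_on_fin gA.
  have -> : A `&` [set x | digit p.+1 x <= y] = A `\` (A `&` [set x | y < digit p.+1 x]).
    apply/seteqP; split => x /=.
      by move=> [Ax h]; split => // -[_]; rewrite ltNge h.
    by move=> [Ax h]; split => //; rewrite leNgt; apply/negP => h2; apply: h.
  split; first exact: measurableD.
  have -> : mu (A `\` (A `&` [set x | y < digit p.+1 x])) =
      (mu A - mu (A `&` (A `&` [set x | (y < digit p.+1 x)%R])))%E.
    by apply: measureD; rewrite // ltey_eq fA.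
  rewrite setIA setIid eB -(fineK fA) -!EFinM -EFinB lee_fin.
  by rewrite mulrBl mul1r.
move=> gA; have [AI As h] := gA.
pose c := Num.min b^-1 (2 * i + 1)%:R^-1.
have c0 : 0 <= c by rewrite le_min !invr_ge0 !ltW.
have E : A `&` [set x | y < digit p.+1 x] = A `&` win p 0 c.
  apply/seteqP; split => x [Ax /=]; rewrite digit_gt //; try exact: AI.
    move=> hx; split => //; rewrite /win /=; have [/andP[-> _] _] := irr01_iter p (AI _ Ax).
    rewrite lt_min /= -[b^-1]mul1r -[X in _ && (_ < X)]mul1r !ltr_pdivlMr //.
    by rewrite mulrC hx mulrC -(As _ Ax) iter_state_lt //; exact: AI.
  rewrite /win /= lt_min => /andP[_ /andP[h1 _]]; split => //.
  by rewrite -[b^-1]mul1r ltr_pdivlMr // mulrC in h1.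
rewrite E; have [|//||m ->] := h 0 c; rewrite ?subr0 //.
  by rewrite -ler_pdivlMl // mulr1 /c ge_min lexx orbT.
split => //; congr (_%:E * _)%E.
rewrite /Gtail /exp_trunc big_nat1 expr0 fact0 divr1 mulr1 /c.
have r0 : 0 < b / (2 * i + 1)%:R by rewrite divr_gt0.
case: (leP (ln _) 0) => hl.
  have : b / (2 * i + 1)%:R <= 1 by rewrite -ler_ln ?posrE // ln1.
  rewrite ler_pdivrMr // mul1r => bi; rewrite min_r ?mulfV ?gt_eqF //.
  by rewrite lef_pV2.
have : 1 < b / (2 * i + 1)%:R by rewrite -ltr_ln ?posrE // ln1.
rewrite ltr_pdivlMr // mul1r => bi; rewrite min_l; last by rewrite lef_pV2 // ltW.
by rewrite expRN lnK ?posrE // invf_div.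
Qed.

Lemma digit_tail k p i :
  cond_lb p i [set x | y < digit (p + k).+1 x]
    (Gtail k.+1 (ln (b / (2 * i + 1)%:R)) - tail_err k * eigen (3 / 2) i) /\
  cond_lb p i [set x | digit (p + k).+1 x <= y]
    (1 - Gtail k.+1 (ln (b / (2 * i + 1)%:R)) - tail_err k * eigen (3 / 2) i).
Proof.
have b0 : 0 < b by exact: lt_le_trans ltr01 b1.
have ht : (2^-1 <= (3 / 2 : R) <= 3 / 2) by rewrite lexx andbT; lra.
elim: k p i => [|k IH] p i.
  by rewrite addn0 /= mul0r !subr0; exact: digit_base.
have m0 : 0 <= gam_max R k by apply: gam_ge0.
have err : gam_max R k / (2 * i + 1)%:R <= expR 16 * gam_max R k * eigen (3 / 2) i.
  by rewrite [leRHS]mulrAC [leLHS]mulrC ler_wpM2r // eigen_ge_inv.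
have cavg := @tail_avg_sum b i k b0; have c1 := kern_sum1 i; have ce := @eigen_sum R _ i ht.
have close := @tail_avg_close b i k b0.
(* The pairs (0, 1) and (1, -1) for (s0, s1) treat the event and its complement together; the second
   supplies the upper bound that [cond_lb] alone cannot express. *)
have gen (s0 s1 : R) (B : set R) :
  (forall j, (i <= j)%N -> cond_lb p.+1 j B (s0 + s1 * Gtail k.+1 (ln (b / (2 * j + 1)%:R)) - tail_err k * eigen (3 / 2) j)) ->
  `|s1| <= 1 ->
  cond_lb p i B (s0 + s1 * Gtail k.+2 (ln (b / (2 * i + 1)%:R)) - tail_err k.+1 * eigen (3 / 2) i).
  move=> H s1le.
  apply: (@cond_lb_le _ _ _ _ _ (s0 * 1 + s1 * Gtail k.+2 (ln (b / (2 * i + 1)%:R)) - tail_err k * (eigen (3 / 2) i / (3 / 2)) - gam_max R k / (2 * i + 1)%:R * 1)).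
    apply: (@cond_lb_step _ _ _ _ (fun j => s0 * 1 + s1 * tail_avg b i k j - tail_err k * eigen (3 / 2) j - gam_max R k / (2 * i + 1)%:R * 1)).
      move=> j ij; apply: cond_lb_le (H j ij) _.
      have := close j ij; rewrite ler_norml => /andP[h1 h2].
      have : `|s1 * (tail_avg b i k j - Gtail k.+1 (ln (b / (2 * j + 1)%:R)))| <= gam_max R k / (2 * i + 1)%:R.
        rewrite normrM; apply: le_trans (close j ij); rewrite -[leRHS]mul1r.
        by rewrite ler_wpM2r.
      rewrite ler_norml mulrBr => /andP[_]; lra.
    have H1 := cvgB (cvgB (cvgD (cvgMl_tmp (a := s0) c1) (cvgMl_tmp (a := s1) cavg))
      (cvgMl_tmp (a := tail_err k) ce)) (cvgMl_tmp (a := gam_max R k / (2 * i + 1)%:R) c1).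
    pose S f N : R := \sum_(0 <= l < N) kern R i (i + l) * f (i + l)%N.
    pose S1 N : R := \sum_(0 <= l < N) kern R i (i + l).
    have E N : S (fun j => s0 * 1 + s1 * tail_avg b i k j - tail_err k * eigen (3 / 2) j - gam_max R k / (2 * i + 1)%:R * 1) N =
      s0 * S1 N + s1 * S (tail_avg b i k) N - tail_err k * S (eigen (3 / 2)) N - gam_max R k / (2 * i + 1)%:R * S1 N.
      by rewrite /S /S1 !mulr_sumr -big_split /= -!sumrB; apply: eq_bigr => l _; ring.
    by rewrite (eq_cvg _ _ E); exact: H1.
  rewrite /=; move: err; move: (eigen _ _) (gam_max _ _) (_^-1) => E g v; lra.
split.
- have := @gen 0 1 [set x | y < digit (p + k.+1).+1 x]; rewrite !add0r !mul1r; apply.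
    by move=> j _; rewrite add0r mul1r -addSnnS; have [] := IH p.+1 j.
  by rewrite normr1.
- have := @gen 1 (-1) [set x | digit (p + k.+1).+1 x <= y]; rewrite !mulN1r; apply.
    by move=> j _; rewrite mulN1r -addSnnS; have [] := IH p.+1 j.
  by rewrite normrN1.
Qed.

End TailBound.
End ChainCLT.

(** * Convergence of the distribution functions of the digits *)

Section CLT.
Variable R : realType.
Implicit Types (x y t : R) (n k : nat).
Notation mu := (@lebesgue_measure R).

Lemma tail_err_ge0 k : 0 <= tail_err R k.
Proof.
elim: k => [|k IH] //=; rewrite addr_ge0 ?mulr_ge0 ?expR_ge0 ?divr_ge0 //.
Qed.

Lemma tail_err_cvg : tail_err R k @[k --> \oo] --> 0.
Proof.
have u0 : expR 16 * gam_max R k @[k --> \oo] --> (0 : R).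
  by have H := cvgMl_tmp (a := expR 16) (@gam_max_cvg R); rewrite mulr0 in H; exact: H.
apply/cvgrPdist_le => eps eps0.
(* With forcing at most eps/6, the value eps/2 is the fixed point of the recursion z -> 2z/3 +
   eps/6. *)
have eps6 : 0 < eps / 6 by rewrite divr_gt0.
move/cvgrPdist_le : u0 => /(_ _ eps6) [K _ HK].
have bd m : tail_err R (m + K) <= (2 / 3) ^+ m * tail_err R K + eps / 2.
  elim: m => [|m IH]; first by rewrite add0n expr0 mul1r lerDl divr_ge0 // ltW.
  rewrite addSn /= exprS.
  have := HK (m + K)%N (leq_addl _ _); rewrite /= sub0r normrN => h.
  have {}h := le_trans (ler_norm _) h.
  rewrite -[in leRHS]mulrA; move: h IH.
  by move: (expR 16 * _) (_ ^+ _ * _) (tail_err _ (m + K)) => u a e; lra.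
have g0 : (2 / 3 : R) ^+ m * tail_err R K @[m --> \oo] --> 0.
  have z1 : `|2 / 3 : R| < 1 by rewrite ger0_norm; lra.
  have H := cvgMr_tmp (b := tail_err R K) (cvg_expr z1).
  by rewrite mul0r in H; exact: H.
have eps2 : 0 < eps / 2 by rewrite divr_gt0.
move/cvgrPdist_le : g0 => /(_ _ eps2) [M _ HM].
exists (M + K)%N => // k /= Mk.
rewrite sub0r normrN ger0_norm ?tail_err_ge0 //.
have -> : k = ((k - K) + K)%N by rewrite subnK //; lia.
apply: le_trans (bd _) _.
have := HM (k - K)%N; rewrite /= sub0r normrN => /(_ ltac:(lia)) h.
by have := le_trans (ler_norm _) h; lra.
Qed.

Lemma measure_setI_compl (A B C : set R) : measurable A -> measurable (A `&` B) ->
  (forall x, A x -> C x <-> ~ B x) -> mu A \is a fin_num ->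
  mu (A `&` C) = (mu A - mu (A `&` B))%E.
Proof.
move=> mA mAB CB fA; have -> : A `&` C = A `\` (A `&` B).
  apply/seteqP; split => x /= [Ax h]; split => //.
    by move=> [_]; apply/CB.
  by apply/(CB _ Ax) => Bx; apply: h.
have -> : mu (A `\` (A `&` B)) = (mu A - mu (A `&` (A `&` B)))%E.
  by apply: measureD; rewrite // ltey_eq fA.
by rewrite setIA setIid.
Qed.

Lemma digit_gt0 n x : irr01 x -> 0 < digit n.+1 x.
Proof. by move=> /(digit_state n) [->|[s ->]]; rewrite ltr0n; lia. Qed.

Let tgt t n : R := n%:R + t * Num.sqrt n%:R.

Lemma ln_near_trunc y (b := (2 * (Num.truncn (y / 2)).+1 - 1)%:R : R) : 2 <= y ->
  `|ln b - ln y| <= 1.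
Proof.
move=> y2; have y0 : 0 < y by lra.
have /truncn_itv/andP[h1 h2] : 0 <= y / 2 by rewrite divr_ge0 // ltW.
have bE : b = 2 * (Num.truncn (y / 2)).+1%:R - 1.
  by rewrite /b natrB ?natrM //; lia.
clearbody b; rewrite -[(Num.truncn _).+1%:R]natr1 in bE h2; have : 0 <= (Num.truncn (y / 2))%:R :> R by [].
move: bE h1 h2; move: ((Num.truncn (y / 2))%:R : R) => z bE h1 h2 z0.
have l2 : ln 2 <= 1 :> R by apply: le_trans (@ln_le_subr1 R 2 _) _ => //; lra.
have yz : y = 2 * (y / 2) by field.
have b1 : y / 2 <= b by lra.
have b2 : b <= 2 * y by lra.
have b0 : 0 < b by lra.
have e1 : ln (y / 2) <= ln b by rewrite ler_ln ?posrE //; lra.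
have e2 : ln b <= ln (2 * y) by rewrite ler_ln ?posrE //; lra.
rewrite ln_div ?posrE // in e1; rewrite lnM ?posrE // in e2.
by rewrite ler_norml; apply/andP; split; lra.
Qed.

(** The digit has index n+2 while [Gtail_cvg] centres at n+1: the shift costs at most 1 + |t|, and
    rounding the threshold to an odd integer costs 1 in the logarithm. Both are multiplied by
    [gam_max], which tends to 0. The hypothesis on n makes the threshold at least 2. *)
Lemma digit_cdf n t : 1 + `|t| <= Num.sqrt n.+2%:R ->
  let P := mu [set x : R | [/\ 0 < x < 1, irrational x &
    (ln (digit n.+2 x) - n.+2%:R) / Num.sqrt (n.+2%:R) <= t]] in
  P = (fine P)%:E /\
  `|fine P - (1 - Gtail n.+2 (tgt t n.+1))| <= tail_err R n.+1 + gam_max R n.+1 * (2 + `|t|).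
Proof.
move=> ht P.
have r0 : 0 < Num.sqrt n.+2%:R :> R by rewrite sqrtr_gt0.
pose y := expR (tgt t n.+2).
have y2 : 2 <= y.
  apply: le_trans (expR_ge1Dx _); suff : 1 <= tgt t n.+2 by lra.
  rewrite /tgt -[n.+2%:R in X in _ <= X + _](@sqr_sqrtr R) //.
  move: ht; set r := Num.sqrt _; rewrite expr2 -mulrDl => ht.
  have : - `|t| <= t by rewrite lerNl; have := ler_norm (- t); rewrite normrN.
  have := normr_ge0 t; nra.
have PE : P = mu (@irr01 R `&` [set x | digit (0 + n.+1).+1 x <= y]).
  congr (mu _); apply/seteqP; split => x /=.
    move=> [h1 h2 h3]; have ix : irr01 x by split.
    split => //; rewrite add0n -[digit _ _]lnK ?posrE ?digit_gt0 // ler_expR.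
    by move: h3; rewrite ler_pdivrMr // lerBlDl.
  move=> [ix]; rewrite add0n; have [h1 h2] := ix.
  move=> h3; rewrite -[digit _ _]lnK ?posrE ?digit_gt0 // ler_expR in h3; split => //.
  by rewrite ler_pdivrMr // lerBlDl.
have y0 : 0 <= y by exact: expR_ge0.
have [L1 L2] := digit_tail y0 n.+1 0 0.
have [gI m1] := @unif_on_irr01 R.
have [mB1] := L1 _ gI; have [mB2] := L2 _ gI; rewrite m1 !mule1.
have e0 : eigen (3 / 2) 0 = 1 :> R by rewrite /eigen /ppi big_geq // mulr1.
rewrite e0 mulr1 divr1 => {L1 L2}; set b := ln _.
have fI := unif_on_fin gI.
have eC : mu (@irr01 R `&` [set x | y < digit (0 + n.+1).+1 x]) = (1 - P)%E.
  rewrite PE -m1; apply: measure_setI_compl => //.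
    exact: unif_on_measurable gI.
  by move=> x _ /=; rewrite ltNge; split => [/negP//|h]; apply/negP.
have fP : P \is a fin_num.
  rewrite PE ge0_fin_numE // (@le_lt_trans _ _ 1%E) ?ltry // -m1.
  by apply: le_measure; rewrite ?inE //; exact: unif_on_measurable gI.
rewrite eC -PE -(fineK fP) -EFinB !lee_fin => l1 l2; split => //.
have hb : `|b - tgt t n.+1| <= 2 + `|t|.
  have := ln_near_trunc y2; rewrite -/b expRK => h1.
  have : `|tgt t n.+2 - tgt t n.+1| <= 1 + `|t|.
    rewrite /tgt -[n.+2%:R]natr1.
    have -> : n.+1%:R + 1 + t * Num.sqrt (n.+1%:R + 1) - (n.+1%:R + t * Num.sqrt n.+1%:R) =
      1 + t * (Num.sqrt (n.+1%:R + 1) - Num.sqrt n.+1%:R) :> R by ring.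
    apply: (le_trans (ler_normD _ _)); rewrite normr1 lerD2l normrM -[leRHS]mulr1 ler_wpM2l //.
    set u : R := Num.sqrt n.+1%:R; set v : R := Num.sqrt _.
    have q0 : 0 <= u by exact: sqrtr_ge0.
    have q1 : u <= v by rewrite ler_sqrt // lerDl.
    have e1 : u ^+ 2 = n.+1%:R by rewrite sqr_sqrtr.
    have e2 : v ^+ 2 = u ^+ 2 + 1 by rewrite e1 sqr_sqrtr // addr_ge0.
    have n1 : 1 <= u ^+ 2 by rewrite e1 ler1n.
    clearbody u v; rewrite ger0_norm ?subr_ge0 //.
    by move: q0 q1 e2 n1; clear; nra.
  have -> : b - tgt t n.+1 = (b - tgt t n.+2) + (tgt t n.+2 - tgt t n.+1) by ring.
  by move=> h2; apply: (le_trans (ler_normD _ _)); lra.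
have := Gtail_lip_norm n.+1 b (tgt t n.+1).
have m0 : 0 <= gam_max R n.+1 by apply: gam_ge0.
have : gam_max R n.+1 * `|b - tgt t n.+1| <= gam_max R n.+1 * (2 + `|t|).
  by rewrite ler_wpM2l.
move: (gam_max _ _ * _) (gam_max _ _ * _) => g1 g2 h1 h2.
have {h1 h2} := le_trans h2 h1.
move: l1 l2; move: (Gtail _ _) (Gtail _ _) (tail_err _ _) => G1 G2 e l1 l2.
by rewrite !ler_norml => /andP[h1 h2]; apply/andP; split; lra.
Qed.

Theorem digit_clt t :
  (mu [set x : R | [/\ (0 < x < 1)%R, irrational x &
    ((ln (digit n x) - n%:R) / Num.sqrt (n%:R) <= t)%R]] @[n --> \oo] -->
    (1 - gauss_tail t)%:E)%E.
Proof.
rewrite -(cvg_shiftn 2) /=.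
under eq_fun do rewrite addn2.
have lim0 : tail_err R n.+1 + gam_max R n.+1 * (2 + `|t|) @[n --> \oo] --> (0 : R).
  have H1 := tail_err_cvg; have H2 := @gam_max_cvg R.
  rewrite -cvg_shiftS in H1; rewrite -cvg_shiftS in H2.
  have H := cvgD H1 (cvgMr_tmp (b := 2 + `|t|) H2).
  by rewrite mul0r addr0 in H; exact: H.
have sqy : \forall n \near \oo, 1 + `|t| <= Num.sqrt n.+2%:R :> R.
  exists (Num.truncn ((1 + `|t|) ^+ 2)).+1 => // k /= Ak.
  rewrite (le_trans (ler_norm _)) // -sqrtr_sqr ler_sqrt //.
  by rewrite (le_trans (ltW (truncnS_gt _))) // ler_nat (leq_trans Ak) // -addn2 leq_addr.
apply/fine_cvgP; split.
  apply: filterS sqy => n hn; have [-> _] := digit_cdf hn; exact: isT.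
have Gc := @Gtail_cvg R t.
have G1 : 1 - Gtail n.+2 (tgt t n.+1) @[n --> \oo] --> 1 - gauss_tail t.
  by apply: cvgB; [exact: cvg_cst|exact: Gc].
apply/cvgrPdist_le => eps eps0; have eps2 : 0 < eps / 2 by rewrite divr_gt0.
move/cvgrPdist_le : G1 => /(_ _ eps2) hG.
move/cvgrPdist_le : lim0 => /(_ _ eps2) h0.
near=> n.
have hn : 1 + `|t| <= Num.sqrt n.+2%:R by near: n.
have [_ h1] := digit_cdf hn.
have tri (u g f : R) : `|1 - u - (1 - g)| <= eps / 2 -> `|f - (1 - g)| <= eps / 2 ->
    `|1 - u - f| <= eps.
  have -> : 1 - u - f = (1 - u - (1 - g)) - (f - (1 - g)) by ring.
  by move=> ? ?; apply: (le_trans (ler_normB _ _)); lra.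
apply: (tri _ (Gtail n.+2 (tgt t n.+1))); first by near: n.
apply: (le_trans h1); apply: (le_trans (ler_norm _)).
by rewrite -normrN -sub0r; near: n.
Unshelve. all: by end_near. Qed.

End CLT.

(** * Martingales and maximal inequality *)

Section ChainTools.
Variable R : realType.
Implicit Types (x t th c a : R) (n k i j p m l : nat) (A B : set R).
Notation mu := (@lebesgue_measure R).

Lemma cond_lb_mart (g : nat -> nat -> R) B p k i :
  (forall l j, \sum_(0 <= r < N) kern R j (j + r) * g l.+1 (j + r)%N @[N --> \oo] --> g l j) ->
  (forall j, cond_lb (p + k) j B (g k j)) -> cond_lb p i B (g 0%N i).
Proof.
elim: k p g i => [|k IH] p g i Hg HB; first by have := HB i; rewrite addn0.
apply: (cond_lb_step _ (Hg 0%N i)) => j _.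
by apply: (IH p.+1 (fun l => g l.+1)) => // j'; rewrite addSnnS.
Qed.

Lemma cond_lb_cst B (c : R) p k i : (forall j, cond_lb (p + k) j B c) -> cond_lb p i B c.
Proof.
move=> HB; apply: (@cond_lb_mart (fun _ _ => c) B p k i) => // l j.
have H := cvgMr_tmp (b := c) (@kern_sum1 R j); rewrite mul1r in H.
have E N : \sum_(0 <= r < N) kern R j (j + r) * c = (\sum_(0 <= r < N) kern R j (j + r)) * c.
  by rewrite mulr_suml.
by rewrite (eq_cvg _ _ E); exact: H.
Qed.

Lemma eigen_mart t i p : 2^-1 <= t <= 3 / 2 ->
  \sum_(0 <= r < N) kern R i (i + r) * (eigen t (i + r) * t ^+ p.+1) @[N --> \oo]
    --> eigen t i * t ^+ p.
Proof.
move=> ht; have t0 : t != 0 by rewrite gt_eqF //; lra.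
have H := cvgMr_tmp (b := t ^+ p.+1) (@eigen_sum R t i ht).
have E N : \sum_(0 <= r < N) kern R i (i + r) * (eigen t (i + r) * t ^+ p.+1) =
   (\sum_(0 <= r < N) kern R i (i + r) * eigen t (i + r)) * t ^+ p.+1.
  by rewrite mulr_suml; apply: eq_bigr => r _; rewrite mulrA.
rewrite (eq_cvg _ _ E).
have -> : eigen t i * t ^+ p = eigen t i / t * t ^+ p.+1 by rewrite exprS mulrA divfK.
exact: H.
Qed.

(* Doob's maximal inequality for the martingale [eigen t (state p x) * t ^+ p]. *)
Lemma cond_lb_max t c m p i : 2^-1 <= t <= 3 / 2 -> 0 < c ->
  cond_lb p i [set x | forall l, (l < m)%N ->
      eigen t (state (p + l) x) * t ^+ (p + l) < c]
    (1 - eigen t i * t ^+ p / c).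
Proof.
move=> ht c0; have t0 : 0 < t by lra.
elim: m p i => [|m IH] p i.
  move=> A gA; set B0 := [set x | _]; have -> : A `&` B0 = A.
    by apply/seteqP; split; [move=> x []|move=> x Ax; split].
  split; first exact: unif_on_measurable gA.
  rewrite -[leRHS]mul1e lee_wpmul2r // lee_fin gerBl.
  by rewrite divr_ge0 // ltW // mulr_gt0 ?exprn_gt0 // eigen_gt0.
(* If the martingale has already reached [c], the claimed bound is nonpositive; otherwise the
   constraint at time [p] holds throughout and can be added for free. *)
have [zc|zc] := ltP (eigen t i * t ^+ p) c; last first.
  move=> A gA; have [AI As _] := gA.
  set B0 := [set x | _]; have -> : A `&` B0 = set0.
    apply/seteqP; split => // x [Ax /= /(_ 0%N isT)]; rewrite addn0 (As _ Ax).
    by rewrite ltNge zc.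
  split => //; rewrite measure0 -(fineK (unif_on_fin gA)) -EFinM lee_fin.
  rewrite mulr_le0_ge0 ?fine_ge0 // subr_le0 ler_pdivlMr // mul1r.
  exact: zc.
have H : cond_lb p i [set x | forall l, (l < m)%N -> eigen t (state (p.+1 + l) x) * t ^+ (p.+1 + l) < c]
    (1 - eigen t i * t ^+ p / c).
  apply: (cond_lb_step (g := fun j => 1 - eigen t j * t ^+ p.+1 / c) (fun j _ => IH p.+1 j)).
  have H := cvgB (@kern_sum1 R i) (cvgMr_tmp (b := c^-1) (@eigen_mart t i p ht)).
  have E N : \sum_(0 <= r < N) kern R i (i + r) * (1 - eigen t (i + r) * t ^+ p.+1 / c) =
   \sum_(0 <= r < N) kern R i (i + r) - (\sum_(0 <= r < N) kern R i (i + r) * (eigen t (i + r) * t ^+ p.+1)) / c.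
    by rewrite mulr_suml -sumrB; apply: eq_bigr => r _; ring.
  by rewrite (eq_cvg _ _ E); exact: H.
move=> A gA; have [AI As _] := gA; have := H A gA.
rewrite (_ : A `&` _ = A `&` [set x | forall l, (l < m.+1)%N -> eigen t (state (p + l) x) * t ^+ (p + l) < c]) //.
apply/seteqP; split => x [Ax hx]; split => //.
  by case=> [|l] lm; [rewrite addn0 (As _ Ax)|rewrite -addSnnS; exact: hx].
by move=> l lm; have := hx l.+1 lm; rewrite addSnnS.
Qed.

Definition centred n x : R := lodd R (state n x) - n%:R.

(** Doob's inequality with t = 1 - s h. Since ln t = -psi(s h) - s h, the logarithm of the
    martingale at time l is at least s h [centred] - l psi(s h) - 16, the 16 coming from
    [eigen_bound]. The sign [s] serves both sides of the law. *)
Lemma max_event (s h a : R) m (N : R) : s = 1 \/ s = -1 -> 0 <= h <= 2^-1 ->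
  (forall l, (l < m)%N -> l%:R <= N) ->
  exists F : set R, [/\ measurable F,
    (mu F <= (expR (16 - h * a + N * psi (s * h)))%:E)%E &
    forall x, irr01 x -> forall l, (l < m)%N -> a <= s * centred l x -> F x].
Proof.
move=> hs /andP[h0 h1] hN; set th := s * h; pose t := 1 - th.
have ht : 2^-1 <= t <= 3 / 2.
  by rewrite /t /th; case: hs => ->; apply/andP; split; lra.
have t0 : 0 < t by lra.
have p0 : 0 <= psi th by apply: psi_ge0; rewrite /t in ht; lra.
set c := expR (h * a - N * psi th - 16).
have c0 : 0 < c by exact: expR_gt0.
have [gI m1] := @unif_on_irr01 R.
have [mB] := @cond_lb_max t c m 0 0 ht c0 _ gI.
set B := [set x | _] in mB *; rewrite m1 mule1 expr0 mulr1.
have -> : eigen t 0 = 1 by rewrite /eigen /ppi big_geq // mulr1.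
rewrite mul1r => hB.
exists (@irr01 R `&` ~` B); split.
- have -> : @irr01 R `&` ~` B = @irr01 R `\` (@irr01 R `&` B).
    apply/seteqP; split => x [ix nB]; split => //.
      by move=> [_].
    by move=> Bx; apply: nB.
  exact: measurableD (unif_on_measurable gI) mB.
- rewrite (@measure_setI_compl R _ B) ?(unif_on_fin gI) //; last exact: unif_on_measurable gI.
  have fB : mu (@irr01 R `&` B) \is a fin_num.
    rewrite ge0_fin_numE // (@le_lt_trans _ _ 1%E) ?ltry // -m1.
    by apply: le_measure; rewrite ?inE //; exact: unif_on_measurable gI.
  move: hB; rewrite m1 -(fineK fB) -EFinB !lee_fin /c -expRN => hB.
  have -> : 16 - h * a + N * psi th = - (h * a - N * psi th - 16) by ring.
  lra.
- move=> x ix l lm hx; split => // Bx; have := Bx l lm; rewrite add0n /=.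
  have /andP[e1 _] := eigen_bound (state l x) ht.
  have tl : t ^+ l = expR (l%:R * ln t) by rewrite expRM_natl lnK.
  rewrite ltNge tl => /negP; apply.
  apply: (@le_trans _ _ (expR (- 16) * expR ((1 - t) * lodd R (state l x)) * expR (l%:R * ln t))); last first.
    by rewrite ler_wpM2r // expR_ge0.
  rewrite -!expRD /c ler_expR.
  have -> : 1 - t = th by rewrite /t; ring.
  have lt' : ln t = - psi th - th by rewrite /psi /t; ring.
  have h2 : h * a <= th * centred l x by rewrite /th (mulrC s) -mulrA ler_wpM2l.
  have h3 : l%:R * psi th <= N * psi th by rewrite ler_wpM2r // hN.
  rewrite lt'; move: h2; rewrite /centred mulrBr => h2.
  have -> : l%:R * (- psi th - th) = - (l%:R * psi th) - th * l%:R by ring.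
  move: (th * lodd _ _) (th * l%:R) (l%:R * psi _) (N * psi _) (h * a) h2 h3.
  by move=> v1 v2 v3 v4 v5; lra.
Qed.

End ChainTools.

(** * Lower bounds on blocks *)

Section Blocks.
Variable R : realType.
Implicit Types (x th u : R) (n k i j p m l : nat) (A B : set R).
Notation mu := (@lebesgue_measure R).

(** Likelihood ratio, over [k] steps from [i] to [j], of the chain transformed by the eigenfunction
    with t = 1 - u. *)
Definition tilt u i k j : R := eigen (1 - u) j * (1 - u) ^+ k / eigen (1 - u) i.

Lemma tilt_bound u i k j (E := u * (lodd R j - lodd R i - k%:R) - k%:R * psi u) :
  `|u| <= 2^-1 ->
  expR (- 32 + E) <= tilt u i k j <= expR (32 + E).
Proof.
rewrite ler_norml => /andP[u1 u2].
have ht : 2^-1 <= 1 - u <= 3 / 2 by apply/andP; split; lra.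
have t0 : 0 < 1 - u by lra.
have /andP[a1 a2] := eigen_bound i ht; have /andP[b1 b2] := eigen_bound j ht.
have uu : 1 - (1 - u) = u by ring.
rewrite uu -!expRD in a1 a2 b1 b2.
have e0 := eigen_gt0 i ht.
have tk : (1 - u) ^+ k = expR (k%:R * ln (1 - u)) by rewrite expRM_natl lnK.
have lE : ln (1 - u) = - psi u - u by rewrite /psi; ring.
rewrite /tilt tk; apply/andP; split.
- rewrite ler_pdivlMr //; apply: le_trans (ler_wpM2r (expR_ge0 _) b1).
  apply: le_trans (ler_wpM2l (expR_ge0 _) a2) _.
  by rewrite -!expRD ler_expR lE /E le_eqVlt; apply/orP; left; apply/eqP; ring.
- rewrite ler_pdivrMr //; apply: le_trans (ler_wpM2r (expR_ge0 _) b2) _.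
  apply: le_trans (ler_wpM2l (expR_ge0 _) a1).
  by rewrite -!expRD ler_expR lE /E le_eqVlt; apply/orP; left; apply/eqP; ring.
Qed.

Lemma tilt_mart u i l j : `|u| <= 2^-1 ->
  \sum_(0 <= r < N) kern R j (j + r) * tilt u i l.+1 (j + r) @[N --> \oo]
    --> tilt u i l j.
Proof.
rewrite ler_norml => /andP[u1 u2].
have ht : 2^-1 <= 1 - u <= 3 / 2 by apply/andP; split; lra.
have H := cvgMr_tmp (b := (eigen (1 - u) i)^-1) (@eigen_mart R _ j l ht).
have E N : \sum_(0 <= r < N) kern R j (j + r) * tilt u i l.+1 (j + r) =
  (\sum_(0 <= r < N) kern R j (j + r) * (eigen (1 - u) (j + r) * (1 - u) ^+ l.+1)) * (eigen (1 - u) i)^-1.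
  by rewrite mulr_suml; apply: eq_bigr => r _; rewrite /tilt !mulrA.
by rewrite (eq_cvg _ _ E); exact: H.
Qed.

(** * Probability of a prescribed drift on one block *)

Section OneBlock.
Variables (th : R) (k i : nat).
Let K : R := k%:R.
Let r : R := Num.sqrt K.
Hypothesis k0 : (0 < k)%N.
Hypothesis small1 : `|th| + r^-1 <= 2^-1.
Hypothesis small2 : 2 * K * (`|th| + r^-1) ^+ 3 <= 1.

Let r0 : 0 < r. Proof. by rewrite sqrtr_gt0 ltr0n. Qed.
Let rr : r ^+ 2 = K. Proof. by rewrite sqr_sqrtr. Qed.

Definition near_drift j : Prop := `|lodd R j - lodd R i - K - K * th| <= 72 * r.

(** K th^2/2 is the Gaussian cost of an extra drift [th] per step; the other term bounds the
    variation of the tilt inside the window [near_drift]. *)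
Definition block_exp : R := K * th ^+ 2 / 2 + 72 * `|th| * r.

(* Up to constants, the tilted weight minus its perturbations by 1/r is positive
   only on [near_drift], so a martingale bounds that probability from below. *)
Let G l j : R := expR (- 32) * tilt th i l j
  - expR (- 35) * (tilt (th + r^-1) i l j + tilt (th - r^-1) i l j).

Let rV0 : 0 < r^-1. Proof. by rewrite invr_gt0. Qed.

Let abs_th : `|th| <= 2^-1.
Proof. by have := rV0; have := small1; lra. Qed.

Let abs_thD : `|th + r^-1| <= `|th| + r^-1.
Proof. by apply: (le_trans (ler_normD _ _)); rewrite (gtr0_norm rV0). Qed.

Let abs_thB : `|th - r^-1| <= `|th| + r^-1.
Proof. by apply: (le_trans (ler_normB _ _)); rewrite (gtr0_norm rV0). Qed.

(** [small2] is tuned so that the cubic error of [psi], accumulated over [K] steps, is at most 1 for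
    [th] and for both of its perturbations. *)
Let psi_small u : `|u| <= `|th| + r^-1 -> `|K * psi u - K * u ^+ 2 / 2| <= 1.
Proof.
move=> hu; have K0 : 0 <= K by [].
have := @psi_cubic R u (le_trans hu small1) => h.
have -> : K * psi u - K * u ^+ 2 / 2 = K * (psi u - u ^+ 2 / 2) by ring.
rewrite normrM (ger0_norm K0); apply: le_trans small2.
apply: le_trans (ler_wpM2l K0 h) _.
rewrite mulrCA mulrA ler_wpM2l ?mulr_ge0 //.
by rewrite lerXn2r ?nnegrE ?addr_ge0 // ltW.
Qed.

Let G_out j : ~ near_drift j -> G k j <= 0.
Proof.
move=> /negP; rewrite -ltNge => hD.
have hs u : `|u| <= `|th| + r^-1 -> `|u| <= 2^-1 by move=> h; exact: le_trans small1.
have /andP[_ hi] := tilt_bound i k j abs_th.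
have /andP[lo1 _] := tilt_bound i k j (hs _ abs_thD).
have /andP[lo2 _] := tilt_bound i k j (hs _ abs_thB).
have := psi_small abs_thD; rewrite ler_norml => /andP[_ p1].
have := psi_small abs_thB; rewrite ler_norml => /andP[_ p2].
have := psi_small (_ : `|th| <= `|th| + r^-1); rewrite lerDl (ltW rV0) => /(_ isT).
rewrite ler_norml => /andP[p3 _].
rewrite -/K in hi lo1 lo2.
set Y := lodd R j - lodd R i - K in hi lo1 lo2 hD *.
have E1 : K * (th + r^-1) ^+ 2 / 2 = K * th ^+ 2 / 2 + K * th / r + 2^-1.
  by rewrite -rr; field; rewrite gt_eqF // r0.
have E2 : K * (th - r^-1) ^+ 2 / 2 = K * th ^+ 2 / 2 - K * th / r + 2^-1.
  by rewrite -rr; field; rewrite gt_eqF // r0.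
rewrite E1 in p1; rewrite E2 in p2.
have hi' : expR (- 32) * tilt th i k j <= expR (th * Y - K * psi th).
  apply: le_trans (ler_wpM2l (expR_ge0 _) hi) _.
  by rewrite -expRD ler_expR; lra.
have pos v : `|v| <= 2^-1 -> 0 <= tilt v i k j.
  by move=> /(tilt_bound i k j) /andP[h _]; apply: le_trans h; exact: expR_ge0.
have pos1 := pos _ (hs _ abs_thD); have pos2 := pos _ (hs _ abs_thB).
rewrite /G subr_le0 mulrDr; apply: (le_trans hi').
(* A perturbed tilt wins once |Y - K th|/r exceeds 35 + 32 + 5/2: the weight in [G], the constant of
   [tilt_bound], the 1/2 from expanding the square, and two errors of [psi_small]. Hence the width
   72; the sign of Y - K th selects the perturbation. *)
have [D0|D0] := leP 0 (Y - K * th).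
- rewrite ger0_norm // in hD.
  have hr : 72 < (Y - K * th) / r by rewrite ltr_pdivlMr.
  apply: (@le_trans _ _ (expR (- 35) * tilt (th + r^-1) i k j)); last first.
    by rewrite lerDl mulr_ge0 // expR_ge0.
  apply: le_trans (ler_wpM2l (expR_ge0 _) lo1).
  rewrite -expRD ler_expR mulrDl.
  have e : r^-1 * Y = (Y - K * th) / r + K * th / r by ring.
  rewrite e; move: hr p1 p3.
  move: (K * psi (th + _)) (K * psi th) ((Y - _) / r) (K * th / r) (th * Y) (K * th ^+ 2 / 2).
  by move=> q1 q2 d1 d2 d3 d4; lra.
- rewrite ltr0_norm // in hD.
  have hr : (Y - K * th) / r < - 72 by rewrite ltr_pdivrMr //; lra.
  apply: (@le_trans _ _ (expR (- 35) * tilt (th - r^-1) i k j)); last first.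
    by rewrite lerDr mulr_ge0 // expR_ge0.
  apply: le_trans (ler_wpM2l (expR_ge0 _) lo2).
  rewrite -expRD ler_expR mulrBl.
  have e : r^-1 * Y = (Y - K * th) / r + K * th / r by ring.
  rewrite e; move: hr p2 p3.
  move: (K * psi (th - _)) (K * psi th) ((Y - _) / r) (K * th / r) (th * Y) (K * th ^+ 2 / 2).
  by move=> q1 q2 d1 d2 d3 d4; lra.
Qed.

Let G_in j : near_drift j -> G k j <= expR (block_exp + 1).
Proof.
rewrite /near_drift => hD.
have hs u : `|u| <= `|th| + r^-1 -> `|u| <= 2^-1 by move=> h; exact: le_trans small1.
have /andP[_ hi] := tilt_bound i k j abs_th.
have := psi_small (_ : `|th| <= `|th| + r^-1); rewrite lerDl (ltW rV0) => /(_ isT).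
rewrite ler_norml => /andP[p3 _].
rewrite -/K in hi.
set Y := lodd R j - lodd R i - K in hi hD *.
have pos v : `|v| <= 2^-1 -> 0 <= tilt v i k j.
  by move=> /(tilt_bound i k j) /andP[h _]; apply: le_trans h; exact: expR_ge0.
have pos1 := pos _ (hs _ abs_thD); have pos2 := pos _ (hs _ abs_thB).
apply: (@le_trans _ _ (expR (- 32) * tilt th i k j)).
  by rewrite gerBl mulr_ge0 ?expR_ge0 // addr_ge0.
apply: le_trans (ler_wpM2l (expR_ge0 _) hi) _.
rewrite -expRD ler_expR /block_exp.
have : th * (Y - K * th) <= `|th| * (72 * r).
  apply: le_trans (ler_norm _) _; rewrite normrM; exact: ler_wpM2l.
have -> : th * (Y - K * th) = th * Y - 2 * (K * th ^+ 2 / 2) by field.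
have -> : 72 * `|th| * r = `|th| * (72 * r) by ring.
move: p3; move: (K * psi th) (th * Y) (`|th| * _) (K * th ^+ 2 / 2).
by move=> q1 d1 d2 d3; lra.
Qed.

(** At time 0 the three tilts equal 1, so the right side is the initial value of [G]; the gap
    between 32 and 35 keeps it positive. *)
Lemma expR35 : expR (- 33) <= expR (- 32) - expR (- 35) * 2 :> R.
Proof.
have e2 : 2 <= expR 1 :> R by apply: le_trans (expR_ge1Dx 1); lra.
have e35 : 0 < expR (- 35) :> R by exact: expR_gt0.
have -> : - 33 = - 35 + 1 + 1 :> R by lra.
have -> : - 32 = - 35 + 1 + 1 + 1 :> R by lra.
rewrite !expRD; move: (expR 1) (expR (- 35)) e2 e35 => e a e2 a0.
have : 0 <= a * (e * e * e - 2 - e * e) by apply: mulr_ge0; [exact: ltW|nra].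
by lra.
Qed.

(** [B] stands for success in a later block. The martingale [g] ends at most at 1 on [near_drift]
    and at most at [c] elsewhere, so its initial value is a lower bound; 34 is 33 from [expR35] plus
    1 from [G_in]. *)
Lemma cond_lb_block p B (c : R) : 0 <= c <= 1 -> (forall j, cond_lb (p + k) j B c) ->
  cond_lb p i ([set x | near_drift (state (p + k) x)] `|` B)
    (c + (1 - c) * expR (- (block_exp + 34))).
Proof.
move=> /andP[c0 c1] HB.
have hs u : `|u| <= `|th| + r^-1 -> `|u| <= 2^-1 by move=> h; exact: le_trans small1.
pose g l j := c + (1 - c) * expR (- (block_exp + 1)) * G l j.
apply: (@cond_lb_le _ _ _ _ _ (g 0%N i)); last first.
  rewrite /g lerD2l -mulrA ler_wpM2l ?subr_ge0 //.
  have -> : - (block_exp + 34) = - (block_exp + 1) + (- 33) by lra.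
  rewrite expRD ler_wpM2l ?expR_ge0 // /G.
  have ti u : `|u| <= 2^-1 -> tilt u i 0 i = 1.
    rewrite ler_norml => /andP[u1 u2].
    have ht : 2^-1 <= 1 - u <= 3 / 2 by apply/andP; split; lra.
    by rewrite /tilt expr0 mulr1 mulfV // gt_eqF // eigen_gt0.
  rewrite (ti _ abs_th) (ti _ (hs _ abs_thD)) (ti _ (hs _ abs_thB)) mulr1.
  exact: expR35.
apply: (@cond_lb_mart _ g _ p k i).
- move=> l j.
  have Hc : (\sum_(0 <= q < N) kern R j (j + q)) * c @[N --> \oo] --> c.
    by have H := cvgMr_tmp (b := c) (@kern_sum1 R j); rewrite mul1r in H; exact: H.
  have H0 := @tilt_mart _ i l j abs_th.
  have H1 := @tilt_mart _ i l j (hs _ abs_thD).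
  have H2 := @tilt_mart _ i l j (hs _ abs_thB).
  have H := cvgD Hc (cvgMl_tmp (a := (1 - c) * expR (- (block_exp + 1)))
    (cvgB (cvgMl_tmp (a := expR (- 32)) H0) (cvgMl_tmp (a := expR (- 35)) (cvgD H1 H2)))).
  pose S f N : R := \sum_(0 <= l < N) kern R j (j + l) * f (j + l)%N.
  have E N : S (g l.+1) N = (\sum_(0 <= l < N) kern R j (j + l)) * c +
    (1 - c) * expR (- (block_exp + 1)) * (expR (- 32) * S (tilt th i l.+1) N -
      expR (- 35) * (S (tilt (th + r^-1) i l.+1) N + S (tilt (th - r^-1) i l.+1) N)).
    rewrite /S -big_split /= mulr_suml !mulr_sumr -sumrB mulr_sumr -big_split /=.
    by apply: eq_bigr => q _; rewrite /g /G; ring.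
  by rewrite (eq_cvg _ _ E); exact: H.
- move=> j; have w0 : 0 <= (1 - c) * expR (- (block_exp + 1)).
    by rewrite mulr_ge0 ?expR_ge0 // subr_ge0.
  have [hj|hj] := pselect (near_drift j).
    move=> A gA; have [AI As _] := gA.
    have -> : A `&` ([set x | near_drift (state (p + k) x)] `|` B) = A.
      by apply/seteqP; split => [x []//|x Ax]; split => //; left; rewrite /= (As _ Ax).
    split; first exact: unif_on_measurable gA.
    rewrite -[leRHS]mul1e lee_wpmul2r // lee_fin /g -[leRHS](subrKC c) lerD2l.
    rewrite -mulrA -[leRHS]mulr1 ler_wpM2l ?subr_ge0 //.
    apply: le_trans (ler_wpM2l (expR_ge0 _) (G_in hj)) _.
    by rewrite -expRD addNr expR0.
  move=> A gA; have [AI As _] := gA.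
  have -> : A `&` ([set x | near_drift (state (p + k) x)] `|` B) = A `&` B.
    apply/seteqP; split => x [Ax].
      by move=> [|Bx]; [rewrite /= (As _ Ax)|split].
    by move=> Bx; split => //; right.
  have [mB hB] := HB j A gA; split => //; apply: le_trans hB.
  by rewrite lee_wpmul2r // lee_fin /g gerDl mulr_ge0_le0 // G_out.
Qed.

End OneBlock.

(** * Success in at least one of several blocks *)

Section ManyBlocks.
Variables (nn : nat -> nat) (th : nat -> R).
Let len l : nat := (nn l.+1 - nn l)%N.
Let r l : R := Num.sqrt (len l)%:R.

Definition block_ok l := [/\ (nn l < nn l.+1)%N, `|th l| + (r l)^-1 <= 2^-1 &
  2 * (len l)%:R * (`|th l| + (r l)^-1) ^+ 3 <= 1].

Definition block_success l : set R :=
  [set x | near_drift (th l) (len l) (state (nn l) x) (state (nn l.+1) x)].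

Definition success_lb l : R := expR (- (block_exp (th l) (len l) + 34)).

Lemma success_lb_itv l : 0 <= success_lb l <= 1.
Proof.
rewrite expR_ge0 /= -expR0 ler_expR oppr_le0 addr_ge0 // addr_ge0 //.
by rewrite divr_ge0 // mulr_ge0 // sqr_ge0.
Qed.

(** Induction on the number of blocks, adding each new one in front. As every success bound holds
    for any past, the failure bounds multiply as they would under independence. *)
Lemma cond_lb_blocks m l i : (forall q, (l <= q)%N -> block_ok q) ->
  cond_lb (nn l) i [set x | exists2 q, (l <= q < l + m)%N & block_success q x]
    (1 - \prod_(l <= q < l + m) (1 - success_lb q)).
Proof.
elim: m l i => [|m IH] l i ok.
  rewrite addn0 big_geq // subrr => A gA.
  have -> : A `&` [set x | exists2 q, (l <= q < l)%N & block_success q x] = set0.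
    by apply/seteqP; split => // x [_ [q]]; lia.
  by split => //; rewrite mul0e measure0.
have [n1 s1 s2] := ok l (leqnn l).
have kE : (nn l + len l = nn l.+1)%N by rewrite subnKC // ltnW.
have k0 : (0 < len l)%N by rewrite subn_gt0.
set c := 1 - \prod_(l.+1 <= q < l.+1 + m) (1 - success_lb q).
have pr : 0 <= \prod_(l.+1 <= q < l.+1 + m) (1 - success_lb q) <= 1.
  apply/andP; split.
    by apply: prodr_ge0 => q _; rewrite subr_ge0; have /andP[] := success_lb_itv q.
  by apply: prodr_ile1 => q _; have /andP[? ?] := success_lb_itv q; apply/andP; split; lra.
have c01 : 0 <= c <= 1 by move: pr => /andP[? ?]; rewrite /c; apply/andP; split; lra.
have HB j : cond_lb (nn l + len l) j [set x | exists2 q, (l.+1 <= q < l.+1 + m)%N & block_success q x] c.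
  by rewrite kE; apply: IH => q lq; apply: ok; exact: ltnW.
have H := @cond_lb_block (th l) (len l) i k0 s1 s2 (nn l) _ c c01 HB.
have -> : 1 - \prod_(l <= q < l + m.+1) (1 - success_lb q) = c + (1 - c) * success_lb l.
  by rewrite big_ltn ?addnS ?ltnS ?leq_addr // -addSn /c; ring.
move=> A gA; have [AI As _] := gA; have := H A gA; rewrite kE.
set C := A `&` _; set D := A `&` _; suff -> : C = D by [].
apply/seteqP; split => x [Ax].
- move=> [h|[q /andP[q1 q2] h]]; split => //.
    by exists l; [rewrite leqnn addnS ltnS leq_addr|rewrite /block_success /= (As _ Ax)].
  by exists q => //; rewrite ltnW //= -addSnnS.
- move=> [q /andP[q1 q2] h]; split => //.
  move: q1; rewrite leq_eqVlt => /predU1P[e|lq].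
    by left; rewrite /= -(As _ Ax) {}e.
  by right; exists q => //; rewrite lq addSnnS.
Qed.

End ManyBlocks.
End Blocks.

(** * Borel-Cantelli arguments *)

Section BorelCantelli.
Variable R : realType.
Implicit Types (x u c : R) (n k l m : nat).
Notation mu := (@lebesgue_measure R).

Lemma borel_cantelli_fst (F : nat -> set R) (v : nat -> R) (C : R) :
  (forall k, measurable (F k)) -> (forall k, (mu (F k) <= (v k)%:E)%E) ->
  (forall N, \sum_(0 <= k < N) v k <= C) ->
  {ae mu, forall x, exists K, forall k, (K <= k)%N -> ~ F k x}.
Proof.
move=> mF Fv vC; exists (lim_sup_set F); split.
- apply: bigcap_measurable => // n _.
  by apply: bigcup_measurable => k _; exact: mF.
- apply: lim_sup_set_cvg0 => //; apply: (@le_lt_trans _ _ C%:E); last exact: ltry.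
  apply: lime_le; first by apply: is_cvg_nneseries => n _ _; exact: measure_ge0.
  apply: nearW => N; apply: (@le_trans _ _ (\sum_(0 <= k < N) v k)%:E); last by rewrite lee_fin.
  by rewrite -sumEFin; apply: lee_sum => k _; exact: Fv.
- move=> x /= nx n _; apply: contrapT => h; apply: nx; exists n => k nk Fk.
  by apply: h; exists k.
Qed.

Lemma harmonic_unbounded J (A : R) :
  exists m, A <= \sum_(J <= q < J + m) harmonic q.
Proof.
have mono : {homo series (@harmonic R) : n m / (n <= m)%N >-> n <= m}.
  by apply: nondecreasing_series => k _ _; exact: harmonic_ge0.
have := nondecreasing_dvgn_lt mono (@dvg_harmonic R).
move=> /cvgryPge /(_ (A + series harmonic J)) [N _ HN].
have e : series (@harmonic R) (J + N)%N = series (@harmonic R) J + \sum_(J <= q < J + N) harmonic q.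
  by rewrite /series /= -big_cat_nat ?leq_addr.
have := HN (J + N)%N (leq_addl _ _); rewrite /= e => h.
by exists N; lra.
Qed.

(** The probability of failing on m consecutive blocks is at most exp(-c H), where H is a stretch of
    m terms of the harmonic series, and H is unbounded in m. *)
Lemma block_success_infinitely_often nn (th : nat -> R) q0 c : 0 < c ->
  (forall q, (q0 <= q)%N -> block_ok nn th q) ->
  (forall q, (q0 <= q)%N -> c * harmonic q <= success_lb nn th q) ->
  {ae mu, forall x, irr01 x -> forall J, exists2 q, (J <= q)%N & block_success nn th q x}.
Proof.
move=> c0 ok hrho; suff H J : {ae mu, forall x, irr01 x -> exists2 q, (J <= q)%N & block_success nn th q x}.
  by apply: filterS (ae_foralln H) => x h ix J; exact: h.
pose J' := maxn J q0.
have [gI m1] := @unif_on_irr01 R.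
pose B m := [set x | exists2 q, (J' <= q < J' + m)%N & block_success nn th q x].
pose P m : R := \prod_(J' <= q < J' + m) (1 - success_lb nn th q).
have ok' q : (J' <= q)%N -> block_ok nn th q.
  by move=> h; apply: ok; apply: leq_trans h; exact: leq_maxr.
have L m : cond_lb 0 0 (B m) (1 - P m).
  by apply: (@cond_lb_cst R _ _ 0 (nn J') 0) => j; rewrite add0n; exact: cond_lb_blocks.
have mB m : measurable (@irr01 R `&` B m) by have [] := L m _ gI.
have fB m : mu (@irr01 R `&` B m) \is a fin_num.
  rewrite ge0_fin_numE // (@le_lt_trans _ _ 1%E) ?ltry // -m1.
  by apply: le_measure; rewrite ?inE //; [exact: mB|exact: unif_on_measurable gI].
pose D m := @irr01 R `\` (@irr01 R `&` B m).
have mD m : measurable (D m) by apply: measurableD => //; exact: unif_on_measurable gI.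
have muD m : (mu (D m) <= (P m)%:E)%E.
  have -> : D m = @irr01 R `&` ~` B m.
    apply/seteqP; split => x [ix nB]; split => //.
      by move=> Bx; apply: nB.
    by move=> [_].
  rewrite (@measure_setI_compl R _ (B m)) ?(unif_on_fin gI) //; last exact: unif_on_measurable gI.
  have [_] := L m _ gI; rewrite m1 mule1 -(fineK (fB m)) -EFinB !lee_fin; lra.
have P_le m : P m <= expR (- (c * \sum_(J' <= q < J' + m) harmonic q)).
  rewrite mulr_sumr -sumrN expR_sum /P !big_nat; apply: ler_prod => q /andP[h _].
  have /andP[r0 r1] := success_lb_itv nn th q; rewrite subr_ge0 r1 /=.
  have hq : (q0 <= q)%N by apply: leq_trans h; exact: leq_maxr.
  apply: (@le_trans _ _ (1 + - (c * harmonic q))); last exact: expR_ge1Dx.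
  by rewrite lerD2l lerN2; exact: hrho.
have mI : measurable (\bigcap_m D m) by apply: bigcap_measurable => // m _; exact: mD.
exists (\bigcap_m D m); split => //.
- apply/eqP; rewrite eq_le measure_ge0 andbT; apply/lee_addgt0Pr => e e0.
  rewrite add0e; have [m hm] := harmonic_unbounded J' (- ln e / c).
  apply: (@le_trans _ _ (mu (D m))).
    by apply: le_measure; rewrite ?inE; [exact: mI|exact: mD|exact: bigcap_inf].
  apply: le_trans (muD m) _; rewrite lee_fin; apply: le_trans (P_le m) _.
  rewrite -[leRHS]lnK ?posrE // ler_expR lerNl.
  by rewrite mulrC -ler_pdivrMr.
- move=> x /= /not_implyP[ix nx] m _; split => // -[_ [q /andP[q1 _] sq]].
  by apply: nx; exists q => //; apply: leq_trans q1; exact: leq_maxl.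
Qed.

(** Telescoped comparison with an integral: k^(-1-e) is at most ((k-1)^(-e) - k^(-e))/e. *)
Lemma zeta_tail (e : R) N : 0 < e ->
  \sum_(0 <= k < N) expR (- ((1 + e) * ln k.+2%:R)) <= e^-1.
Proof.
move=> e0; pose v k : R := expR (- (e * ln k.+1%:R)).
have step k : expR (- ((1 + e) * ln k.+2%:R)) <= e^-1 * (v k - v k.+1).
  have -> : - ((1 + e) * ln k.+2%:R) = - ln k.+2%:R - e * ln k.+2%:R :> R by ring.
  rewrite expRD expRN lnK ?posrE // -/(v k.+1).
  have k1 : 0 < k.+1%:R :> R by [].
  have k2 : k.+2%:R = k.+1%:R + 1 :> R by rewrite -natr1.
  have -> : v k = v k.+1 * expR (e * ln (k.+2%:R / k.+1%:R)).
    by rewrite /v -expRD ln_div ?posrE //; congr expR; ring.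
  have : 1 + e / k.+2%:R <= expR (e * ln (k.+2%:R / k.+1%:R)).
    apply: le_trans (expR_ge1Dx _); rewrite lerD2l ler_wpM2l ?(ltW e0) //.
    have r0 : 0 < k.+2%:R / k.+1%:R :> R by rewrite divr_gt0.
    apply: le_trans (ln_ge_1subV r0); rewrite invf_div k2 le_eqVlt.
    by apply/orP; left; apply/eqP; field; rewrite gt_eqF //; lra.
  move=> h; have v0 : 0 < v k.+1 by exact: expR_gt0.
  have {h} h := ler_wpM2l (ltW v0) h.
  rewrite mulrDr mulr1 in h.
  rewrite ler_pdivlMl // lerBrDl; apply: le_trans h.
  by rewrite le_eqVlt; apply/orP; left; apply/eqP; ring.
apply: (@le_trans _ _ (\sum_(0 <= k < N) e^-1 * (v k - v k.+1))).
  by apply: ler_sum => k _; exact: step.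
rewrite -mulr_sumr -[leRHS]mulr1 ler_wpM2l ?invr_ge0 ?(ltW e0) //.
have -> : \sum_(0 <= k < N) (v k - v k.+1) = v 0%N - v N.
  elim: N => [|N IH]; first by rewrite big_geq // subrr.
  by rewrite big_nat_recr //= IH; ring.
have -> : v 0%N = 1 by rewrite /v ln1 mulr0 oppr0 expR0.
by rewrite gerBl expR_ge0.
Qed.

(** The form is dictated by [block_params]: for K at least exp(u)/2 it gives sqrt K at least 2
    (u+2)^3. *)
Lemma expR_dominates_pow6 : exists2 U : R, 2 <= U & forall u, U <= u -> 8 * (u + 2) ^+ 6 <= expR u.
Proof.
have [F F0 hF] : exists2 F : R, 0 < F & forall u, 0 < u -> u ^+ 7 / F <= expR u.
  exists (7`!%:R); first by rewrite ltr0n fact_gt0.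
  by move=> u u0; apply: le_trans (@expR_ge1Dxn R u 6 (ltW u0)); rewrite lerDr.
exists (512 * F + 2) => [|u hu]; first by lra.
have u2 : 2 <= u by lra.
have u0 : 0 < u by lra.
apply: le_trans (hF u u0); rewrite ler_pdivlMr //.
apply: (@le_trans _ _ (8 * (2 * u) ^+ 6 * F)).
  rewrite ler_wpM2r ?(ltW F0) // ler_wpM2l // lerXn2r ?nnegrE; lra.
have -> : 8 * (2 * u) ^+ 6 * F = u ^+ 6 * (512 * F) by ring.
by rewrite (exprSr u 6) ler_wpM2l ?exprn_ge0 ?(ltW u0) //; lra.
Qed.

End BorelCantelli.

(** * Law of the iterated logarithm *)

Section LIL.
Variable R : realType.
Implicit Types (x u s e : R) (n k l m : nat).
Notation mu := (@lebesgue_measure R).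

Definition lil_scale u : R := Num.sqrt (2 * u * ln (ln u)).

Lemma eventually_natmul (P : R -> Prop) c : 0 < c -> (exists U, forall u, U <= u -> P u) ->
  exists k0, forall k, (k0 <= k)%N -> P (k%:R * c).
Proof.
move=> c0 [U HU]; exists (Num.truncn (U / c)).+1 => k hk; apply: HU.
rewrite -ler_pdivrMr // (le_trans (ltW (truncnS_gt _))) // ler_nat.
exact: hk.
Qed.

Lemma upper_lil s e : s = 1 \/ s = -1 -> 0 < e <= 1 ->
  {ae mu, forall x, irr01 x -> exists n0, forall n, (n0 <= n)%N ->
    s * centred n x <= (1 + e) * lil_scale n%:R}.
Proof.
move=> hs /andP[e0 e1]; pose q := 1 + e.
have q1 : 1 < q by rewrite /q; lra.
have q0 : 0 < q by lra.
pose c := ln q; have c0 : 0 < c by exact: ln_gt0.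
have qc : q = expR c by rewrite /c lnK.
pose L k : R := ln (k%:R * c); pose Nk k : R := expR (k%:R * c).
(* With horizon q N and level a = q N h this tilt is optimal: -h a + q N h^2/2 = -q L, and exp(-q L)
   is of order k^(-q), which is summable. The level is [q] times the iterated-logarithm scale at
   time N, so it serves the whole block from N to q N. *)
pose h k := Num.sqrt (2 * L k / Nk k).
have [U U2 HU] := expR_dominates_pow6 R.
have [k0 Hk0] : exists k0, forall k, (k0 <= k)%N -> U <= k%:R * c.
  by apply: (@eventually_natmul (fun u => U <= u)) => //; exists U.
have Lb k : (k0 <= k)%N -> 0 <= L k <= k%:R * c.
  move=> hk; have u2 := le_trans U2 (Hk0 k hk).
  by rewrite ln_ge0; [rewrite ltW // ln_sublinear|]; lra.
have hb k : (k0 <= k)%N -> [/\ 0 <= h k, h k ^+ 2 = 2 * L k / Nk k, h k <= 2^-1 & 4 * q * L k * h k <= 1].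
  move=> hk; have /andP[L0 Lu] := Lb k hk.
  have N0 : 0 < Nk k by exact: expR_gt0.
  have h0 : 0 <= h k by exact: sqrtr_ge0.
  have hE : h k ^+ 2 = 2 * L k / Nk k by rewrite sqr_sqrtr // divr_ge0 ?(ltW N0) // mulr_ge0.
  have u2 := le_trans U2 (Hk0 k hk).
  have g := HU _ (Hk0 k hk); rewrite -/(Nk k) in g.
  have q2 : q <= 2 by rewrite /q; lra.
  move: L0 Lu N0 h0 hE u2 g; move: (L k) (Nk k) (h k) (k%:R * c) => l N hh u L0 Lu N0 h0 hE u2 g.
  have p3 : 27 * u ^+ 3 <= (u + 2) ^+ 6.
    have a1 : 27 <= (u + 2) ^+ 3 by rewrite !exprS expr0; nra.
    have a2 : u ^+ 3 <= (u + 2) ^+ 3 by rewrite lerXn2r ?nnegrE; lra.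
    have -> : (u + 2) ^+ 6 = (u + 2) ^+ 3 * (u + 2) ^+ 3 by rewrite -exprD.
    by apply: ler_pM => //; rewrite exprn_ge0 //; lra.
  have p4 : l ^+ 3 <= u ^+ 3 by rewrite lerXn2r ?nnegrE //; lra.
  have p5 : 216 * l ^+ 3 <= N by lra.
  have p6 : 8 * l <= N.
    have : u <= u ^+ 3 by rewrite !exprS expr0; nra.
    by lra.
  split => //.
    rewrite -(@ler_pXn2r _ 2) ?nnegrE // hE ler_pdivrMr //; lra.
  have h1 : 0 <= 4 * q * l * hh by rewrite !mulr_ge0 // ltW.
  rewrite -(@ler_pXn2r _ 2) ?nnegrE // expr1n.
  have -> : (4 * q * l * hh) ^+ 2 = 16 * q ^+ 2 * l ^+ 2 * hh ^+ 2 by ring.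
  rewrite hE mulrA ler_pdivrMr // mul1r.
  have -> : 16 * q ^+ 2 * l ^+ 2 * (2 * l) = 32 * q ^+ 2 * l ^+ 3 by ring.
  apply: le_trans p5; rewrite ler_wpM2r ?exprn_ge0 //.
  by rewrite expr2; nra.
pose a k := q * Nk k * h k.
pose m k := (Num.truncn (q * Nk k)).+1.
have hm k l : (l < m k)%N -> l%:R <= q * Nk k.
  rewrite /m ltnS => lm; apply: (@le_trans _ _ (Num.truncn (q * Nk k))%:R); first by rewrite ler_nat.
  by rewrite truncn_le mulr_ge0 ?(ltW q0) // expR_ge0.
(* The shift makes the estimates in [hb] available, and the extra 2 allows comparison with
   [zeta_tail], whose terms start at 2. *)
pose K k := (k + k0.+2)%N.
have K0 k : (k0 <= K k)%N by rewrite /K !addnS ltnW // ltnW // !ltnS leq_addl.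
have hh k : 0 <= h (K k) <= 2^-1 by have [-> _ -> _] := hb _ (K0 k).
have ME k := @max_event R s (h (K k)) (a (K k)) (m (K k)) _ hs (hh k) (hm (K k)).
pose F k := projT1 (cid (ME k)).
have HF k : [/\ measurable (F k),
    (mu (F k) <= (expR (16 - h (K k) * a (K k) + q * Nk (K k) * psi (s * h (K k))))%:E)%E &
    forall x, irr01 x -> forall l, (l < m (K k))%N -> a (K k) <= s * centred l x -> F k x].
  by rewrite /F; case: cid.
have Fv k : (mu (F k) <= (expR (17 - q * ln c) * expR (- ((1 + e) * ln k.+2%:R)))%:E)%E.
  have [_ h1 _] := HF k; apply: (le_trans h1); rewrite lee_fin -expRD ler_expR.
  have [b1 b2 b3 b4] := hb _ (K0 k).
  have N0 : 0 < Nk (K k) by exact: expR_gt0.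
  have psi_le : psi (s * h (K k)) <= h (K k) ^+ 2 / 2 + 2 * h (K k) ^+ 3.
    have sh : `|s * h (K k)| = h (K k).
      by rewrite normrM (ger0_norm b1); case: hs => ->; rewrite ?normrN1 ?normr1 mul1r.
    have s2 : (s * h (K k)) ^+ 2 = h (K k) ^+ 2.
      by case: hs => ->; rewrite ?mulN1r ?mul1r // sqrrN.
    have := @psi_cubic R (s * h (K k)); rewrite sh s2 => /(_ b3).
    by rewrite ler_norml => /andP[_]; rewrite lerBlDl.
  have {}psi_le := ler_wpM2l (ltW (mulr_gt0 q0 N0)) psi_le.
  have hN : Nk (K k) * h (K k) ^+ 2 = 2 * L (K k) by rewrite b2 mulrC divfK // gt_eqF.
  have E1 : h (K k) * a (K k) = q * (2 * L (K k)) by rewrite -hN /a; ring.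
  have E2 : q * Nk (K k) * (h (K k) ^+ 2 / 2 + 2 * h (K k) ^+ 3) = q * L (K k) + 4 * q * L (K k) * h (K k).
    have -> : q * Nk (K k) * (h (K k) ^+ 2 / 2 + 2 * h (K k) ^+ 3) =
      q * (Nk (K k) * h (K k) ^+ 2) / 2 + 2 * q * (Nk (K k) * h (K k) ^+ 2) * h (K k) by ring.
    by rewrite hN; field.
  have Lk : ln k.+2%:R + ln c <= L (K k).
    rewrite -lnM ?posrE // /L ler_ln ?posrE ?mulr_gt0 ?ltr0n /K ?addnS //.
    by rewrite ler_pM2r // ler_nat !ltnS leq_addr.
  have {}Lk := ler_wpM2l (ltW q0) Lk.
  rewrite E2 in psi_le; rewrite E1 -/q; rewrite mulrDr in Lk.
  have e5 : q * (2 * L (K k)) = 2 * (q * L (K k)) by ring.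
  by rewrite e5; clear -psi_le b4 Lk; lra.
have mF k : measurable (F k) by have [] := HF k.
have Cb N : \sum_(0 <= k < N) expR (17 - q * ln c) * expR (- ((1 + e) * ln k.+2%:R)) <=
    expR (17 - q * ln c) * e^-1.
  by rewrite -mulr_sumr ler_wpM2l ?expR_ge0 // zeta_tail.
have BC : {ae mu, forall x, exists K, forall k, (K <= k)%N -> ~ F k x}.
  exact: borel_cantelli_fst mF Fv Cb.
apply: (@filterS _ _ (ae_filter_ringOfSetsType mu) _ _ _ BC) => x [K1 HK1] ix.
have [n0 Hn0] : exists n0, forall n, (n0 <= n)%N -> (K1 + k0.+2)%:R * c <= ln n%:R.
  exists (Num.truncn (expR ((K1 + k0.+2)%:R * c))).+1 => n hn.
  have n0 : (0 < n)%N by apply: leq_trans hn.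
  rewrite -[leLHS]expRK ler_ln ?posrE ?expR_gt0 ?ltr0n //.
  by rewrite (le_trans (ltW (truncnS_gt _))) // ler_nat.
exists (maxn n0 1) => n; rewrite geq_max => /andP[/Hn0 hn n1].
have ln0 : 0 <= ln n%:R :> R by rewrite ln_ge0 // ler1n.
pose k' := Num.truncn (ln n%:R / c).
have /truncn_itv /andP[t1 t2] : 0 <= ln n%:R / c by rewrite divr_ge0 // ltW.
rewrite -/k' ler_pdivlMr // in t1; rewrite -/k' ltr_pdivrMr // in t2.
have kk : (K1 + k0.+2 <= k')%N.
  by rewrite /k' truncn_ge_nat ?divr_ge0 ?(ltW c0) // ler_pdivlMr.
have k2k : (k0.+2 <= k')%N := leq_trans (leq_addl _ _) kk.
have kE : k' = K (k' - k0.+2)%N by rewrite /K subnK.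
have nF := HK1 (k' - k0.+2)%N; have {}nF : ~ F (k' - k0.+2)%N x by apply: nF; rewrite -(leq_add2r k0.+2) subnK.
have [_ _ h3] := HF (k' - k0.+2)%N; rewrite -kE in h3.
have nE : n%:R = expR (ln n%:R) :> R by rewrite lnK // posrE ltr0n.
have lm : (n < m k')%N.
  rewrite /m ltnS truncn_ge_nat ?mulr_ge0 ?expR_ge0 ?(ltW q0) //.
  rewrite nE qc -expRD ler_expR; apply: ltW; apply: (lt_le_trans t2).
  by rewrite -natr1 mulrDl mul1r addrC.
have /ltW : s * centred n x < a k'.
  by rewrite ltNge; apply/negP => h4; apply: nF; exact: h3 ix n lm h4.
move=> h4; apply: (le_trans h4); rewrite /a /h -mulrA ler_wpM2l ?(ltW q0) //.
have N0 : 0 < Nk k' by exact: expR_gt0.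
have k0k : (k0 <= k')%N by exact: ltnW (ltnW k2k).
have /andP[L0 _] := Lb k' k0k.
have -> : Nk k' = Num.sqrt (Nk k' ^+ 2) by rewrite sqrtr_sqr gtr0_norm.
rewrite -sqrtrM ?sqr_ge0 // /lil_scale ler_sqrt; last first.
  have : 1 <= ln n%:R :> R.
    apply: le_trans hn; have := le_trans U2 (Hk0 _ (ltnW (ltnW (leq_addl K1 k0.+2)))); clear; lra.
  by move=> /ln_ge0 ?; rewrite !mulr_ge0.
have -> : Nk k' ^+ 2 * (2 * L k' / Num.sqrt (Nk k' ^+ 2)) = 2 * (Nk k' * L k').
  by rewrite sqrtr_sqr gtr0_norm //; field; rewrite gt_eqF.
rewrite -mulrA ler_wpM2l //; apply: ler_pM => //; first exact: ltW.
  by rewrite nE ler_expR.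
have kc0 : 0 < k'%:R * c.
  by have := le_trans U2 (Hk0 k' k0k); lra.
by rewrite /L ler_ln ?posrE //; exact: lt_le_trans t1.
Qed.

End LIL.

(** * Lower half of the law of the iterated logarithm *)

Section LowerLIL.
Variable R : realType.
Implicit Types (x u s e : R) (n k l m : nat).
Notation mu := (@lebesgue_measure R).

Lemma lil_scale_ge0 u : 0 <= lil_scale u.
Proof. exact: sqrtr_ge0. Qed.

(** Here exp(u) is the right end of a block, [K] its length, and [th] the drift producing (1-e)
    [lil_scale]. Of the factor (1-e)^2 in the cost, one is spent on K being only at least (1-e)
    exp(u); the other leaves room for the linear term. The cost is then ln u + O(1), so success has
    probability of order 1/u. *)
Lemma block_params e u K th : 0 < e < 1 -> 2 <= u ->
  8 * (u + 2) ^+ 6 <= expR u -> expR u <= 2 * K -> (1 - e) * expR u <= K ->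
  `|th| = (1 - e) * lil_scale (expR u) / K ->
  [/\ `|th| + (Num.sqrt K)^-1 <= 2^-1,
      2 * K * (`|th| + (Num.sqrt K)^-1) ^+ 3 <= 1 &
      K * th ^+ 2 / 2 + 72 * `|th| * Num.sqrt K <= ln u + 2592 / e].
Proof.
move=> /andP[e0 e1] u2 hu hK hK' hth.
have n0 : 0 < expR u by exact: expR_gt0.
have K0 : 0 < K by lra.
have L0 : 0 <= ln u by apply: ln_ge0; lra.
have Lu : ln u <= u by apply/ltW/ln_sublinear; lra.
pose r := Num.sqrt K; have r0 : 0 < r by rewrite sqrtr_gt0.
have rK : r ^+ 2 = K by rewrite sqr_sqrtr // ltW.
pose w := (1 - e) * lil_scale (expR u) / r.
have w0 : 0 <= w by rewrite divr_ge0 ?(ltW r0) // mulr_ge0 ?lil_scale_ge0 // subr_ge0 ltW.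
have thw : `|th| = w / r by rewrite hth /w -rK expr2 invfM mulrA.
have w2 : w ^+ 2 <= 2 * (1 - e) * ln u.
  rewrite /w expr_div_n rK exprMn /lil_scale expRK sqr_sqrtr; last by rewrite !mulr_ge0 // ltW.
  rewrite ler_pdivrMr //.
  have h1 : 0 <= 2 * (1 - e) * ln u by rewrite !mulr_ge0 // subr_ge0 ltW.
  apply: le_trans (ler_wpM2l h1 hK').
  by rewrite le_eqVlt; apply/orP; left; apply/eqP; ring.
have th2 : th ^+ 2 = w ^+ 2 / K by rewrite -real_normK ?num_real // thw expr_div_n rK.
have r2 : 2 * (u + 2) ^+ 3 <= r.
  have u3 : 0 <= 2 * (u + 2) ^+ 3 by rewrite mulr_ge0 // exprn_ge0 //; lra.
  rewrite -(@ler_pXn2r _ 2) ?nnegrE ?(ltW r0) // rK.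
  have -> : (2 * (u + 2) ^+ 3) ^+ 2 = 4 * (u + 2) ^+ 6 by ring.
  by lra.
have wu : w + 1 <= u + 2.
  have : w <= (w ^+ 2 + 1) / 2 by have := sqr_ge0 (w - 1); rewrite sqrrB mulr1 expr1n; lra.
  have : (1 - e) * ln u <= ln u by rewrite ler_piMl //; lra.
  by lra.
have E : `|th| + (Num.sqrt K)^-1 = (w + 1) / r by rewrite thw -/r mulrDl mul1r.
rewrite E; split.
- rewrite ler_pdivrMr //.
  have : u + 2 <= (u + 2) ^+ 3 by rewrite !exprS expr0; nra.
  by lra.
- have -> : 2 * K * ((w + 1) / r) ^+ 3 = 2 * (w + 1) ^+ 3 / r.
    by rewrite -rK; field; rewrite gt_eqF.
  rewrite ler_pdivrMr // mul1r; apply: le_trans r2.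
  by rewrite ler_wpM2l // lerXn2r ?nnegrE //; lra.
- have -> : K * th ^+ 2 / 2 + 72 * `|th| * Num.sqrt K = w ^+ 2 / 2 + 72 * w.
    by rewrite th2 thw -/r; field; rewrite !gt_eqF.
  (* [72 w <= e w^2 / 2 + 72^2 / (2 e)] *)
  have am : 72 * w <= e / 2 * w ^+ 2 + 2592 / e.
    have : 0 <= (2 * e)^-1 * (e * w - 72) ^+ 2.
      by rewrite mulr_ge0 ?sqr_ge0 // invr_ge0 mulr_ge0 // ltW.
    have -> : (2 * e)^-1 * (e * w - 72) ^+ 2 = e / 2 * w ^+ 2 + 2592 / e - 72 * w.
      by field; rewrite gt_eqF.
    by rewrite subr_ge0.
  have : (1 + e) * w ^+ 2 <= 2 * ln u.
    apply: (le_trans (ler_wpM2l _ w2)); first lra.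
    have -> : (1 + e) * (2 * (1 - e) * ln u) = 2 * ln u - 2 * e ^+ 2 * ln u by ring.
    by rewrite lerBlDr lerDl !mulr_ge0 // ltW.
  by lra.
Qed.

(** On geometric times u = ln(Q^(l+1)) is linear in l, so success probabilities of order 1/u are of
    harmonic order. The condition 1/e <= Q makes a block at least (1-e) times as long as its right
    end. *)
Lemma lower_block s e Q : s = 1 \/ s = -1 -> 0 < e < 1 -> (2 <= Q)%N -> e^-1 <= Q%:R ->
  {ae mu, forall x, irr01 x -> forall J, exists2 l, (J <= l)%N &
    (1 - e) * lil_scale (Q ^ l.+1)%:R - 72 * Num.sqrt (Q ^ l.+1)%:R
      <= s * (centred (Q ^ l.+1) x - centred (Q ^ l) x)}.
Proof.
move=> hs he Q2 eQ; have /andP[e0 e1] := he.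
have Q1 : 1 < Q%:R :> R by rewrite ltr1n.
have Q0 : 0 < Q%:R :> R by lra.
pose c := ln (Q%:R : R); have c0 : 0 < c by exact: ln_gt0.
pose len l := (Q ^ l.+1 - Q ^ l)%N.
pose th l : R := s * ((1 - e) * lil_scale (Q ^ l.+1)%:R / (len l)%:R).
have le_pow l : (Q ^ l <= Q ^ l.+1)%N by rewrite leq_exp2l.
have lenE l : (len l)%:R = (Q ^ l.+1)%:R - (Q ^ l)%:R :> R by rewrite natrB.
have powE l : (Q ^ l.+1)%:R = expR (l.+1%:R * c).
  by rewrite natrX /c mulr_natl -lnXn // lnK // posrE exprn_gt0.
have thE l : `|th l| = (1 - e) * lil_scale (Q ^ l.+1)%:R / (len l)%:R.
  have h : 0 <= (1 - e) * lil_scale (Q ^ l.+1)%:R / (len l)%:R :> R.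
    by rewrite divr_ge0 // mulr_ge0 ?lil_scale_ge0 // subr_ge0 ltW.
  by rewrite /th normrM (ger0_norm h); case: hs => ->; rewrite ?normrN1 ?normr1 mul1r.
have powS l : (Q ^ l.+1)%:R = Q%:R * (Q ^ l)%:R :> R by rewrite expnS natrM.
have pow0 l : 0 < (Q ^ l)%:R :> R by rewrite ltr0n expn_gt0 (ltn_trans _ Q2).
have Qe : 1 <= e * Q%:R by rewrite -ler_pdivrMl // mulr1.
have len2 l : (Q ^ l.+1)%:R <= 2 * (len l)%:R :> R.
  rewrite lenE powS; have : 2 <= Q%:R :> R by rewrite ler_nat.
  by move: (pow0 l) (Q%:R) => p0 q hq; nra.
have lene l : (1 - e) * (Q ^ l.+1)%:R <= (len l)%:R :> R.
  rewrite lenE powS; have := ler_wpM2r (ltW (pow0 l)) Qe; lra.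
have [U U2 HU] := expR_dominates_pow6 R.
pose q0 := (Num.truncn (U / c)).+1.
have Hq l : (q0 <= l)%N -> U <= l.+1%:R * c.
  move=> hl; rewrite -ler_pdivrMr // (le_trans (ltW (truncnS_gt _))) // ler_nat.
  by rewrite -/q0 (leq_trans hl).
have par l : (q0 <= l)%N -> [/\ `|th l| + (Num.sqrt (len l)%:R)^-1 <= 2^-1,
      2 * (len l)%:R * (`|th l| + (Num.sqrt (len l)%:R)^-1) ^+ 3 <= 1 &
      block_exp (th l) (len l) <= ln (l.+1%:R * c) + 2592 / e].
  move=> /Hq hl; have u2 := le_trans U2 hl.
  have hu := HU _ hl; apply: block_params => //.
  - by rewrite -powE.
  - by rewrite -powE.
  - by rewrite -powE.
have H := @block_success_infinitely_often R (fun l => (Q ^ l)%N) th q0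
  (expR (- (2592 / e + 34)) / c) (divr_gt0 (expR_gt0 _) c0).
have ok q : (q0 <= q)%N -> block_ok (fun l => (Q ^ l)%N) th q.
  by move=> /par[h1 h2 h3]; split; rewrite // ltn_exp2l.
have hrho q : (q0 <= q)%N ->
    expR (- (2592 / e + 34)) / c * harmonic q <= success_lb (fun l => (Q ^ l)%N) th q.
  move=> /par[_ _ h].
  have -> : expR (- (2592 / e + 34)) / c * harmonic q =
      expR (- (ln (q.+1%:R * c) + 2592 / e + 34)).
    have u0 : 0 < q.+1%:R * c by rewrite mulr_gt0.
    have -> : - (ln (q.+1%:R * c) + 2592 / e + 34) = - (2592 / e + 34) - ln (q.+1%:R * c) by ring.
    rewrite expRD [expR (- ln _)]expRN lnK ?posrE //.
    by rewrite /harmonic /= invfM -mulrA (mulrC c^-1).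
  by rewrite /success_lb ler_expR lerN2 lerD2r.
have {}H := H ok hrho.
apply: (@filterS _ _ (ae_filter_ringOfSetsType mu) _ _ _ H) => x {}H ix J.
have [l Jl] := H ix J; rewrite /block_success /= /near_drift => sl.
exists l => //; move: sl; rewrite ler_norml => /andP[s1 s2].
have len0 : 0 < (len l)%:R :> R by have := len2 l; have := pow0 l.+1; lra.
have thK : (len l)%:R * th l = s * ((1 - e) * lil_scale (Q ^ l.+1)%:R).
  by rewrite /th; field; rewrite gt_eqF.
rewrite -/(len l) thK in s1 s2.
have rr : Num.sqrt (len l)%:R <= Num.sqrt (Q ^ l.+1)%:R :> R.
  by rewrite ler_sqrt // ler_nat leq_subr.
have cE : centred (Q ^ l.+1) x - centred (Q ^ l) x =
    lodd R (state (Q ^ l.+1) x) - lodd R (state (Q ^ l) x) - (len l)%:R.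
  by rewrite /centred lenE; ring.
rewrite cE; clear -hs s1 s2 rr; case: hs s1 s2 => -> s1 s2; lra.
Qed.

(** A large increment over a block helps only if the starting value is not too negative; the upper
    law for [- s] bounds that value. The three losses of [e] are the reduced drift, the width 72
    sqrt n and the starting value. *)
Lemma lower_lil s e : s = 1 \/ s = -1 -> 0 < e < 1 ->
  {ae mu, forall x, irr01 x -> forall J, exists2 n, (J <= n)%N &
    (1 - 3 * e) * lil_scale n%:R <= s * centred n x}.
Proof.
move=> hs he; have /andP[e0 e1] := he.
(* Q at least 4/e^2 makes 2 [lil_scale] at Q^l at most e [lil_scale] at Q^(l+1). *)
pose Q := (Num.truncn (4 / e ^+ 2)).+2.
have Q2 : (2 <= Q)%N by [].
have e20 : 0 < e ^+ 2 by rewrite exprn_gt0.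
have hQ : 4 / e ^+ 2 <= Q%:R.
  by rewrite (le_trans (ltW (truncnS_gt _))) // ler_nat.
have eQ : e^-1 <= Q%:R.
  apply: le_trans hQ; rewrite expr2 invfM mulrA ler_peMl ?invr_ge0 ?(ltW e0) //.
  by rewrite ler_pdivlMr //; lra.
have Q0 : 0 < Q%:R :> R by [].
have Q1 : 1 < Q%:R :> R by rewrite ltr1n.
have hs' : - s = 1 \/ - s = -1 by case: hs => ->; [right|left; rewrite opprK].
have up := @upper_lil R (- s) 1 hs' ltac:(lra).
have lo := lower_block hs he Q2 eQ.
apply: (@filterS2 _ _ (ae_filter_ringOfSetsType mu) _ _ _ _ up lo) => x {}up {}lo ix J.
have [n0 Hn0] := up ix; have {}lo := lo ix.
pose c := ln (Q%:R : R); have c0 : 0 < c by exact: ln_gt0.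
(* ln M at least U gives ln ln M at least 1 and at least 2592/e^2; since 72^2 = 2 * 2592, the latter
   makes 72 sqrt N at most e [lil_scale N]. *)
pose U := expR 1 + expR (2592 / e ^+ 2); pose l0 := (Num.truncn (U / c)).+1.
have [l] := lo (maxn l0 (maxn n0 J)).
rewrite !geq_max => /and3P[hl0 hn0 hJ] h; exists (Q ^ l.+1)%N.
  exact: leq_trans hJ (ltnW (ltn_trans (ltnSn l) (ltn_expl l.+1 Q2))).
have lQ : (n0 <= Q ^ l)%N by rewrite (leq_trans hn0) // ltnW // ltn_expl.
have {}Hn0 := Hn0 _ lQ.
pose N : R := (Q ^ l.+1)%:R; pose M : R := (Q ^ l)%:R.
have pow0 k : 0 < (Q ^ k)%:R :> R by rewrite ltr0n expn_gt0.
have NM : N = Q%:R * M by rewrite /N expnS natrM.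
have lnp k : ln (Q ^ k)%:R = k%:R * c :> R by rewrite natrX lnXn // mulr_natl.
have hu : U <= l%:R * c.
  rewrite -ler_pdivrMr // (le_trans (ltW (truncnS_gt _))) // ler_nat.
  exact: hl0.
have U1 : expR 1 <= U by rewrite /U lerDl expR_ge0.
have U2 : expR (2592 / e ^+ 2) <= U by rewrite /U lerDr expR_ge0.
have lnM : U <= ln M by rewrite lnp.
have ex0 (z : R) : 0 < expR z by exact: expR_gt0.
have M0 : 0 < M by exact: pow0.
have lnM0 : 0 < ln M by apply: lt_le_trans lnM; apply: lt_le_trans U1.
have lll z : expR z <= U -> z <= ln (ln M).
  by move=> hz; rewrite -[z]expRK ler_ln ?posrE //; exact: le_trans lnM.
have LM1 : 1 <= ln (ln M) by exact: lll.
have LM2 : 2592 / e ^+ 2 <= ln (ln M) by exact: lll.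
have MN : M <= N by rewrite NM ler_peMl ?(ltW M0) // ltW.
have N0 : 0 < N by exact: pow0.
have lnMN : ln M <= ln N by rewrite ler_ln.
have LMN : ln (ln M) <= ln (ln N).
  by rewrite ler_ln ?posrE //; exact: lt_le_trans lnMN.
have b1 : 2 * lil_scale M <= e * lil_scale N.
  have sq2 : 2 = Num.sqrt (2 ^+ 2) :> R by rewrite sqrtr_sqr ger0_norm.
  have sqe : e = Num.sqrt (e ^+ 2) by rewrite sqrtr_sqr gtr0_norm.
  rewrite {1}sq2 {1}sqe /lil_scale -!sqrtrM ?sqr_ge0 // ler_sqrt; last first.
    by rewrite !mulr_ge0 // ?(ltW e0) ?(ltW N0) //; lra.
  have h4 : 4 <= e ^+ 2 * Q%:R by rewrite mulrC -ler_pdivrMr.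
  have h5 : 4 * M <= e ^+ 2 * N by rewrite NM mulrA ler_wpM2r // ltW.
  have -> : 2 ^+ 2 * (2 * M * ln (ln M)) = 2 * (4 * M * ln (ln M)) by ring.
  have -> : e ^+ 2 * (2 * N * ln (ln N)) = 2 * (e ^+ 2 * N * ln (ln N)) by ring.
  rewrite ler_wpM2l // ler_pM //; last by lra.
  by rewrite mulr_ge0 // ltW.
have b2 : 72 * Num.sqrt N <= e * lil_scale N.
  have sq2 : 72 = Num.sqrt (72 ^+ 2) :> R by rewrite sqrtr_sqr ger0_norm.
  have sqe : e = Num.sqrt (e ^+ 2) by rewrite sqrtr_sqr gtr0_norm.
  rewrite {1}sq2 {1}sqe /lil_scale -!sqrtrM ?sqr_ge0 // ler_sqrt; last first.
    by rewrite !mulr_ge0 // ?(ltW e0) ?(ltW N0) //; lra.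
  have h4 : 2592 <= e ^+ 2 * ln (ln N).
    by rewrite mulrC -ler_pdivrMr //; exact: le_trans LMN.
  have -> : e ^+ 2 * (2 * N * ln (ln N)) = 2 * (e ^+ 2 * ln (ln N)) * N by ring.
  by rewrite ler_wpM2r ?(ltW N0) //; lra.
move: h Hn0 b1 b2; rewrite -/N -/M; clear.
move: (lil_scale N) (lil_scale M) (Num.sqrt N) (centred (Q ^ l.+1) x) (centred (Q ^ l) x).
by move=> *; lra.
Qed.

End LowerLIL.

(** * Passage from states to digits, and the limits superior and inferior *)

Section Conclusion.
Variable R : realType.
Implicit Types (x u s e : R) (n k l m : nat) (y : nat -> R).
Notation mu := (@lebesgue_measure R).

Lemma ae_irr01 (P : R -> Prop) :
  {ae mu, forall x, irr01 x -> P x} -> {ae mu, forall x, 0 < x < 1 -> P x}.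
Proof.
move=> H; have rat0 : {ae mu, forall x, ~ rational x}.
  exists rational; split; [exact: measurable_rational|exact: lebesgue_measure_rat|].
  by move=> x /= /contrapT.
apply: (@filterS2 _ _ (ae_filter_ringOfSetsType mu) _ _ _ _ H rat0) => x h r x01.
exact: h.
Qed.

Lemma ln_digit_centred n x : irr01 x ->
  `|ln (digit n.+1 x) - n.+1%:R - centred n.+1 x| <= 1.
Proof.
move=> ix; set d := digit _ _; pose M : R := (2 * state n.+1 x + 1)%:R.
have M0 : 0 < M by rewrite ltr0n addn1.
have d0 : 0 < d by exact: digit_gt0.
have [dM Md] : d <= 2 * M /\ M <= 2 * d.
  rewrite /d /M; case: (digit_state n ix) => [->|[s0 ->]].
    by rewrite -!natrM !ler_nat; split; lia.
  by rewrite -!natrM !ler_nat; split; lia.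
have -> : ln d - n.+1%:R - centred n.+1 x = ln (d / M).
  by rewrite ln_div ?posrE // /centred /lodd -/M; ring.
have r0 : 0 < d / M by exact: divr_gt0.
have h1 := ln_le_subr1 r0; have h2 := ln_ge_1subV r0.
have h3 : d / M <= 2 by rewrite ler_pdivrMr.
have h4 : (d / M)^-1 <= 2 by rewrite invf_div ler_pdivrMr.
by rewrite ler_norml; apply/andP; split; lra.
Qed.

Lemma lil_scale_unbounded (C : R) : exists n0, forall n, (n0 <= n)%N -> C <= lil_scale n%:R.
Proof.
exists (Num.truncn (expR (expR 1) + C ^+ 2)).+1 => n hn.
have {}hn : expR (expR 1) + C ^+ 2 <= n%:R.
  by rewrite (le_trans (ltW (truncnS_gt _))) // ler_nat.
have hE : expR (expR 1) <= n%:R :> R by apply: le_trans hn; rewrite lerDl sqr_ge0.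
have n0 : 0 < n%:R :> R by apply: lt_le_trans hE; exact: expR_gt0.
have l1 : expR 1 <= ln n%:R :> R by rewrite -[leLHS]expRK ler_ln ?posrE ?expR_gt0.
have l2 : 1 <= ln (ln n%:R) :> R.
  by rewrite -[leLHS]expRK ler_ln ?posrE ?expR_gt0 //; apply: lt_le_trans l1; exact: expR_gt0.
rewrite (le_trans (ler_norm C)) // -sqrtr_sqr /lil_scale ler_sqrt; last first.
  by rewrite !mulr_ge0 //; lra.
apply: (@le_trans _ _ (2 * n%:R)); first by have := expR_gt0 (expR 1 : R); lra.
by rewrite ler_peMr // mulr_ge0.
Qed.

Lemma lil_scale_small e : 0 < e ->
  exists n0, forall n, (n0 <= n)%N -> lil_scale n%:R <= e * n%:R.
Proof.
move=> e0; pose d := e ^+ 2 / 4; have d0 : 0 < d by rewrite divr_gt0 // exprn_gt0.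
exists (Num.truncn (expR 1 + `|ln d| / d)).+1 => n hn.
have {}hn : expR 1 + `|ln d| / d <= n%:R.
  by rewrite (le_trans (ltW (truncnS_gt _))) // ler_nat.
have hE : expR 1 <= n%:R :> R.
  by apply: le_trans hn; rewrite lerDl divr_ge0 ?normr_ge0 // ltW.
have n0 : 0 < n%:R :> R by apply: lt_le_trans hE; exact: expR_gt0.
have l1 : 1 <= ln n%:R :> R by rewrite -[leLHS]expRK ler_ln ?posrE ?expR_gt0.
have h1 : ln (ln n%:R) <= ln n%:R :> R by apply/ltW/ln_sublinear; lra.
have h2 : ln (d * n%:R) <= d * n%:R by apply/ltW/ln_sublinear; rewrite mulr_gt0.
rewrite lnM ?posrE // in h2.
have h3 : `|ln d| <= d * n%:R.
  rewrite -ler_pdivrMl // mulrC; apply: le_trans hn.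
  by rewrite lerDr expR_ge0.
have h4 : - ln d <= `|ln d| by rewrite -normrN ler_norm.
have h5 : ln (ln n%:R) <= 2 * d * n%:R by lra.
have -> : e * n%:R = Num.sqrt ((e * n%:R) ^+ 2) by rewrite sqrtr_sqr gtr0_norm // mulr_gt0.
rewrite /lil_scale ler_sqrt ?sqr_ge0 //.
have -> : (e * n%:R) ^+ 2 = 2 * n%:R * (2 * d * n%:R) by rewrite /d; field.
by rewrite ler_wpM2l // mulr_ge0.
Qed.

Lemma limn_esup_lil y :
  (forall e, 0 < e <= 1 -> exists n0, forall n, (n0 <= n)%N -> y n <= (1 + e) * lil_scale n%:R) ->
  (forall e, 0 < e <= 1 -> forall J, exists2 n, (J <= n)%N & (1 - e) * lil_scale n%:R <= y n) ->
  limn_esup (fun n => (y n / lil_scale n%:R)%:E) = 1%:E.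
Proof.
move=> Hu Hl; set v := fun n => _; rewrite limn_esup_lim.
(* The scale vanishes for small [n], where the quotient is a default value; the bounds are used only
   from [n1] on. *)
have [n1 Hn1] := lil_scale_unbounded 1.
have b0 n : (n1 <= n)%N -> 0 < lil_scale (n%:R : R).
  by move=> /Hn1 h; apply: lt_le_trans h.
apply/eqP; rewrite eq_le; apply/andP; split.
- apply/lee_addgt0Pr => e e0; pose e' := Num.min e 1.
  have he : 0 < e' <= 1 by rewrite lt_min e0 ltr01 ge_min lexx orbT.
  have [n0 Hn0] := Hu _ he.
  apply: (@le_trans _ _ (1 + e')%:E); last by rewrite -EFinD lee_fin lerD2l ge_min lexx.
  apply: lime_le; first exact: is_cvg_esups.
  exists (maxn n0 n1) => // N /=; rewrite geq_max => /andP[N0 N1].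
  apply: ge_ereal_sup => _ [n /= hn <-]; rewrite lee_fin ler_pdivrMr.
    by apply: Hn0; exact: leq_trans hn.
  by apply: b0; exact: leq_trans hn.
- apply: lime_ge; first exact: is_cvg_esups.
  apply: nearW => N; apply/lee_addgt0Pr => e e0; pose e' := Num.min e 1.
  have he : 0 < e' <= 1 by rewrite lt_min e0 ltr01 ge_min lexx orbT.
  have [n] := Hl _ he (maxn N n1); rewrite geq_max => /andP[nN nn1] h.
  apply: (@le_trans _ _ (v n + e%:E)%E).
    rewrite -EFinD lee_fin -lerBlDr ler_pdivlMr; last exact: b0.
    apply: le_trans h; rewrite ler_wpM2r ?lil_scale_ge0 // lerD2l lerN2.
    by rewrite ge_min lexx.
  by rewrite leeD2r //; apply: ereal_sup_ubound; exists n.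
Qed.

Definition lil_bounds s y :=
  (forall e, 0 < e <= 1 -> exists n0, forall n, (n0 <= n)%N -> s * y n <= (1 + e) * lil_scale n%:R) /\
  (forall e, 0 < e <= 1 -> forall J, exists2 n, (J <= n)%N & (1 - e) * lil_scale n%:R <= s * y n).

Lemma digit_lil s : s = 1 \/ s = -1 ->
  {ae mu, forall x, irr01 x -> lil_bounds s (fun n => ln (digit n x) - n%:R)}.
Proof.
(* A countable family keeps the exceptional set null. Of the 4 [eps m] allowed, three go to
   [lower_lil] and one absorbs the bounded difference between digit and state. *)
move=> hs; pose eps m : R := m.+4%:R^-1.
have e0 m : 0 < eps m by rewrite invr_gt0.
have e4 m : 4 * eps m <= 1 by rewrite ler_pdivrMr // mul1r ler_nat.
have ee e : 0 < e <= 1 -> exists m, 4 * eps m <= e.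
  move=> /andP[he _]; exists (Num.truncn (4 / e)); rewrite ler_pdivrMr // mulrC.
  rewrite -ler_pdivrMr // (le_trans (ltW (truncnS_gt _))) // ler_nat.
  by rewrite ltnW // ltnW // ltnW.
have up m := @upper_lil R s (eps m) hs ltac:(by have := e0 m; have := e4 m; lra).
have lo m := @lower_lil R s (eps m) hs ltac:(by have := e0 m; have := e4 m; lra).
have H m := @filterI _ _ (ae_filter_ringOfSetsType mu) _ _ (up m) (lo m).
apply: (@filterS _ _ (ae_filter_ringOfSetsType mu) _ _ _ (ae_foralln H)) => x {}H ix.
have near n : (0 < n)%N -> `|s * (ln (digit n x) - n%:R) - s * centred n x| <= 1.
  case: n => // n _; rewrite -mulrBr normrM.
  by case: hs => ->; rewrite ?normrN1 ?normr1 mul1r; exact: ln_digit_centred.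
have big m : exists n1, forall n, (n1 <= n)%N -> 1 <= eps m * lil_scale n%:R.
  have [n1 Hn1] := lil_scale_unbounded (eps m)^-1; exists n1 => n /Hn1 h.
  by rewrite mulrC -ler_pdivrMr // mul1r.
split=> e he.
- have [m hm] := ee _ he; have [n0 Hn0] := (H m).1 ix; have [n1 Hn1] := big m.
  exists (maxn 1 (maxn n0 n1)) => n; rewrite !geq_max => /and3P[n_gt0 /Hn0 h0 /Hn1 h1].
  have := near n n_gt0; rewrite ler_norml => /andP[_ h2].
  have := e0 m; have := @lil_scale_ge0 R n%:R; clear -h0 h1 h2 hm.
  move: (lil_scale _) (s * centred n x) (s * _) (eps m) h0 h1 h2 hm => b X Y t *; nra.
- move=> J; have [m hm] := ee _ he; have [n1 Hn1] := big m.
  have [n] := (H m).2 ix (maxn 1 (maxn J n1)).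
  rewrite !geq_max => /and3P[n_gt0 Jn /Hn1 h1] h0; exists n => //.
  have := near n n_gt0; rewrite ler_norml => /andP[h2 _].
  have := e0 m; have := @lil_scale_ge0 R n%:R; clear -h0 h1 h2 hm.
  move: (lil_scale _) (s * centred n x) (s * _) (eps m) h0 h1 h2 hm => b X Y t *; nra.
Qed.

Lemma lln_of_lil y : lil_bounds 1 (fun n => y n - n%:R) ->
  lil_bounds (-1) (fun n => y n - n%:R) -> y n / n%:R @[n --> \oo] --> (1 : R).
Proof.
move=> [Hp _] [Hm _]; apply/cvgrPdist_le => e e0.
have i1 : 0 < (1 : R) <= 1 by lra.
have [n0 Hn0] := Hp 1 i1; have [n1 Hn1] := Hm 1 i1.
have e2 : 0 < e / 2 by rewrite divr_gt0.
have [n2 Hn2] := lil_scale_small e2.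
exists (maxn 1 (maxn n0 (maxn n1 n2))) => // n /=.
rewrite !geq_max => /and4P[ngt0 /Hn0 h0 /Hn1 h1 /Hn2 h2].
have n0' : 0 < n%:R :> R by rewrite ltr0n.
have -> : 1 - y n / n%:R = (n%:R - y n) / n%:R by field; rewrite gt_eqF.
rewrite normrM normfV (gtr0_norm n0') ler_pdivrMr // ler_norml.
by apply/andP; split; lra.
Qed.

End Conclusion.

Theorem theorem1p1 (R : realType) :
  (* (1) law of large numbers *)
  {ae (@lebesgue_measure R), forall x : R, 0 < x < 1 ->
      (ln (digit n x) / n%:R @[n --> \oo] --> (1:R))}
  /\
  (* (2) central limit theorem *)
  (forall t : R,
     (fun n : nat =>
        (@lebesgue_measure R)
          [set x : R | [/\ 0 < x < 1, irrational x &
                           (ln (digit n x) - n%:R) / Num.sqrt (n%:R) <= t]])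
     @ \oo -->
     (((Num.sqrt (2 * pi))^-1)%:E *
       (\int[@lebesgue_measure R]_(u in `]-oo, t]) (expR (- (u ^+ 2) / 2))%:E))%E)
  /\
  (* (3) law of the iterated logarithm *)
  {ae (@lebesgue_measure R), forall x : R, 0 < x < 1 ->
      limn_esup (fun n : nat =>
        ((ln (digit n x) - n%:R) / Num.sqrt (2 * n%:R * ln (ln n%:R)))%:E) = 1%:E
   /\ limn_einf (fun n : nat =>
        ((ln (digit n x) - n%:R) / Num.sqrt (2 * n%:R * ln (ln n%:R)))%:E) = (-1)%:E}.
Proof.
have s1 : (1 : R) = 1 \/ (1 : R) = -1 by left.
have s2 : (-1 : R) = 1 \/ (-1 : R) = -1 by right.
have Hp := digit_lil s1; have Hm := digit_lil s2.
split; last split.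
- apply: ae_irr01.
  apply: (@filterS2 _ _ (ae_filter_ringOfSetsType _) _ _ _ _ Hp Hm) => x hp hm ix.
  by apply: lln_of_lil; [exact: hp|exact: hm].
- by move=> t; rewrite gauss_tailC; exact: digit_clt.
- apply: ae_irr01.
  apply: (@filterS2 _ _ (ae_filter_ringOfSetsType _) _ _ _ _ Hp Hm) => x hp hm ix.
  have [up lo] := hp ix; have [um lm] := hm ix; split.
    apply: limn_esup_lil => e he.
      by have [n0 H] := up _ he; exists n0 => n /H; rewrite mul1r.
    by move=> J; have [n nJ h] := lo _ he J; exists n; rewrite // -[leRHS]mul1r.
  rewrite /limn_einf EFinN; apply: (congr1 oppe).
  rewrite -(@limn_esup_lil R (fun n => -1 * (ln (digit n x) - n%:R))) //.
  congr limn_esup; apply/funext => n /=.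
  by rewrite mulN1r mulNr.
Qed.
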